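(* Let $p\in(2,6)$, $\beta=\frac{p-2}{6-p}$, and $N\ge 3$ an integer. For $\ell>0$ let $\mathcal{G}_\ell$ be the metric graph made up of $N$ half-lines and one terminal edge of length $\ell$, all emanating from the same vertex $v$. Then there exists $C^*>0$, depending only on $N$ and $p$, such that for every $\mu>0$ and $\ell>0$: $$\inf_{w\in H^1_\mu(\mathcal{G}_\ell)}E(w,\mathcal{G}_\ell)\ \text{is attained}\iff \mu^\beta\ell\ge C^*.$$
   Context: A metric graph is a connected graph with finitely many edges, each identified with a bounded interval $[0,\ell_e]$ or a half-line $[0,+\infty)$, glued at vertices, with the shortest-path distance. $H^1(\mathcal{G})$ consists of real continuous functions on $\mathcal{G}$ which are $H^1$ on each edge with finite $H^1$ norm. $E(u,\mathcal{G})=\frac12\int_{\mathcal{G}}|u'|^2dx-\frac1p\int_{\mathcal{G}}|u|^pdx$, $H^1_\mu(\mathcal{G})=\{u\in H^1(\mathcal{G}):\|u\|^2_{L^2(\mathcal{G})}=\mu\}$. A terminal edge is a bounded edge one of whose endpoints has degree one. *)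

(* Defs.v *)
From HB Require Import structures.
From mathcomp Require Import all_boot all_order all_algebra.
From mathcomp Require Import all_classical all_reals all_analysis.
Set Implicit Arguments. Unset Strict Implicit. Unset Printing Implicit Defensive.
Import Order.TTheory GRing.Theory Num.Theory.
Local Open Scope classical_set_scope.
Local Open Scope ring_scope.

(* Star graph G_l: N half-lines (edges [Some i], i : 'I_N, identified with
   [0,+oo)) and one terminal edge (edge [None], identified with [0,l]); all
   edges have their coordinate 0 at the common vertex v. *)
Definition edge_dom {R : realType} (N : nat) (l : R) (e : option 'I_N) : set R :=
  match e with
  | None => `[0, l]
  | Some _ => `[0, +oo[
  end.

Definition leb {R : realType} := (@lebesgue_measure R).

Definition L2 {R : realType} (D : set R) (f : R -> R) : Prop :=
  measurable_fun D f /\ (\int[leb]_(x in D) ((f x) ^+ 2)%:E < +oo)%E.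

(* A function on G_l is a family u of edge functions; g is its derivative.
   u is in H^1(G_l) (with derivative g) iff on each edge u, g are in L^2,
   u is the primitive of g (i.e. u is H^1 on the edge with weak derivative g),
   and u is continuous at the vertex v. *)
Definition H1_graph {R : realType} (N : nat) (l : R)
    (u g : option 'I_N -> R -> R) : Prop :=
  (forall e : option 'I_N,
     L2 (edge_dom l e) (u e) /\ L2 (edge_dom l e) (g e) /\
     forall x, edge_dom l e x -> u e x = u e 0 + Rintegral leb `[0, x] (g e))
  /\ (forall i : 'I_N, u (Some i) 0 = u None 0).

Definition mass {R : realType} (N : nat) (l : R) (u : option 'I_N -> R -> R) : R :=
  \sum_(e : option 'I_N) Rintegral leb (edge_dom l e) (fun x => (u e x) ^+ 2).

Definition energy {R : realType} (N : nat) (l p : R) (u g : option 'I_N -> R -> R) : R :=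
  2^-1 * (\sum_(e : option 'I_N) Rintegral leb (edge_dom l e) (fun x => (g e x) ^+ 2))
  - p^-1 * (\sum_(e : option 'I_N) Rintegral leb (edge_dom l e) (fun x => `|u e x| `^ p)).

Definition ground_state_exists {R : realType} (N : nat) (l p mu : R) : Prop :=
  exists u g : option 'I_N -> R -> R, H1_graph l u g /\ mass l u = mu /\
    forall u' g' : option 'I_N -> R -> R, H1_graph l u' g' -> mass l u' = mu ->
      energy l p u g <= energy l p u' g'.

(* Main.v *)
Require Import Defs.
From HB Require Import structures.
From mathcomp Require Import all_boot all_order all_algebra.
From mathcomp Require Import all_classical all_reals all_analysis.
From mathcomp Require Import measurable_realfun ring lra.
Set Implicit Arguments. Unset Strict Implicit. Unset Printing Implicit Defensive.
Import Order.TTheory GRing.Theory Num.Theory.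
Import numFieldNormedType.Exports.
Local Open Scope classical_set_scope.
Local Open Scope ring_scope.

(* Scaling [u x = mu^a v (mu^beta x)] reduces to mass 1. Let [ER] be the infimum
   of the energy over functions of mass at most 1 on a half-line vanishing at its
   origin (the level of the real line), and call [l] good if some [u] on [G_l] of
   mass at most 1 has energy at most [ER]; since a soliton can run away along a
   half-line, [inf E <= ER] for every [l].

   If [u] has energy at most [ER], then [|u|] attains its maximum on the terminal
   edge: otherwise glue the half-line carrying the maximum to a second one, and
   put the mass of the rest of the graph back as a constant piece at the maximum;
   this competitor on the line has too low an energy, the kinetic energy of a
   third half-line ([N >= 3]) being saved. Hence minimizing sequences stay
   on the terminal edge, a concentration-compactness argument applies, good
   lengths are exactly those with a ground state, and they form a closed set
   bounded away from 0. They are upward closed because from a good [l] one gets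
   good [l' > l] with [l' - l] arbitrarily small: cut a small piece out of the
   half-lines and put its mass back as a constant piece at the maximum, which
   lengthens the terminal edge and does not increase the energy. *)

(** * Integrals and H1 functions on intervals *)

(** Every surgery rests on one comparison: a function bounded by [M] with mass [r] has [L^p]
    integral at most [M^(p-2) r], and a constant piece of height [M] and mass [r] reaches this bound
    with no kinetic energy. This takes the place of rearrangement. Admitting all masses up to 1 lets
    pieces be dropped freely, and small excesses of mass are absorbed by [infE_superlinear].

    The obstacle is equality. Goodness allows [gE l = ER], where the strict inequality that usually
    gives compactness is missing. Two facts replace it: functions of energy at most [ER] keep a
    definite amount of mass on the terminal edge, and the energy is strictly superlinear in the
    mass, so the rest of the mass cannot be lost at infinity. Likewise, when the maximum is on a
    half-line, surgery only shows that the energy is at least [ER]; equality is excluded because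
    [ER] is not attained by functions vanishing at the origin of a half-line. *)

Section affine.
Context {R : realType}.
Implicit Types (s t : R) (A D : set R) (f : R -> R).

Definition aff s t : measurableTypeR R -> measurableTypeR R := fun x => s * x + t.

Lemma measurable_aff s t : measurable_fun [set: measurableTypeR R] (aff s t).
Proof. by apply: measurable_funD => //; apply: measurable_funM. Qed.

HB.instance Definition _ s t := isMeasurableFun.Build _ _ _ _ _ (measurable_aff s t).

(** By uniqueness of Lebesgue measure: [|s|] times the pushforward gives half-open intervals their
    length. For [s < 0] the preimage is half-open on the other side. *)
Lemma pushforward_aff s t A : s != 0 -> measurable A ->
  pushforward (@leb R) (aff s t) A = (`|s|^-1%:E * (@leb R) A)%E.
Proof.
move=> s0 mA.
have ns0 : 0 < `|s| by rewrite normr_gt0.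
have -> : (@leb R) A = (`|s|%:E * pushforward (@leb R) (aff s t) A)%E.
  have mphi := measurable_aff s t.
  pose pf : {measure set (measurableTypeR R) -> \bar R} :=
    measure_function_pushforward__canonical__measure_function_Measure (@lebesgue_measure R) mphi.
  suff : (@leb R) A = mscale (NngNum (ltW ns0)) pf A by [].
  apply: lebesgue_measure_unique => //.
  move=> _ [[a b]] _ <- /=.
  rewrite /pf /mscale /pushforward /= lebesgue_measure_itv /=.
  have [sp|sn] : 0 < s \/ s < 0 by move: s0; rewrite neq_lt => /orP[]; [right|left].
    have pE : aff s t @^-1` `]a, b]%classic = `](a - t) / s, (b - t) / s]%classic.
      apply/seteqP; split => x /=; rewrite /aff !in_itv /= ltr_pdivrMr// ler_pdivlMr// => /andP[h1 h2]; apply/andP; split; lra.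
    rewrite /pushforward pE lebesgue_measure_itv /= !lte_fin ltr_pM2r ?invr_gt0// ltrD2r.
    rewrite gtr0_norm//; case: ifPn => ab; last by rewrite mule0.
    by rewrite -!EFinB -EFinM; congr (_%:E); field; rewrite gt_eqF.
  have pE : aff s t @^-1` `]a, b]%classic = `[(b - t) / s, (a - t) / s[%classic.
    apply/seteqP; split => x /=; rewrite /aff !in_itv /= ler_ndivrMr// ltr_ndivlMr// => /andP[h1 h2]; apply/andP; split; lra.
  rewrite /pushforward pE lebesgue_measure_itv /= !lte_fin ltr_nM2r ?invr_lt0// ltrD2r.
  rewrite ltr0_norm//; case: ifPn => ab; last by rewrite mule0.
  by rewrite -!EFinB -EFinM; congr (_%:E); field; rewrite lt_eqF.
by rewrite muleA -EFinM mulVf ?mul1e// normr_eq0.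
Qed.

Lemma ge0_integral_aff s t D (f : R -> \bar R) : s != 0 -> measurable D ->
  measurable_fun D f -> (forall x, D x -> 0 <= f x)%E ->
  (\int[@leb R]_(x in aff s t @^-1` D) (f \o aff s t) x =
   `|s|^-1%:E * \int[@leb R]_(x in D) f x)%E.
Proof.
move=> s0 mD mf f0.
rewrite /leb -ge0_integral_pushforward//; last by move=> x; rewrite inE; exact: f0.
have k0 : 0 <= `|s|^-1 by rewrite invr_ge0.
rewrite -[`|s|^-1]/((NngNum k0)%:num) -ge0_integral_mscale//.
by apply: eq_measure_integral => A mA AD; rewrite /mscale /= -/leb pushforward_aff.
Qed.

Definition intg D f := (@leb R).-integrable D (EFin \o f).

Definition rint D f : R := Rintegral (@leb R) D f.

Lemma intg_meas D f : intg D f -> measurable_fun D f.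
Proof. by move=> /integrableP[/measurable_EFinP]. Qed.

Lemma rintK D f : measurable D -> intg D f ->
  (rint D f)%:E = (\int[@leb R]_(x in D) (f x)%:E)%E.
Proof. by move=> mD itf; rewrite /rint /Rintegral fineK//; apply: integrable_fin_num. Qed.

Lemma measurable_aff_preimage s t D : measurable D -> measurable (aff s t @^-1` D).
Proof. by move=> mD; rewrite -[X in measurable X]setTI; exact: measurable_aff. Qed.

Lemma intg_aff s t D f : s != 0 -> measurable D -> intg D f ->
  intg (aff s t @^-1` D) (f \o aff s t).
Proof.
move=> s0 mD /integrableP[mf fo].
apply/integrableP; split.
  apply: (@measurable_comp _ _ _ _ _ _ D (EFin \o f) _ (aff s t)) => //.
    by move=> y [x] + <-.
  by apply: measurable_funTS; exact: measurable_aff.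
have := @ge0_integral_aff s t D (abse \o (EFin \o f)) s0 mD.
rewrite /comp => ->//; last exact: measurableT_comp.
by rewrite lte_mul_pinfty.
Qed.

Lemma rint_aff s t D f : s != 0 -> measurable D -> intg D f ->
  rint (aff s t @^-1` D) (f \o aff s t) = `|s|^-1 * rint D f.
Proof.
move=> s0 mD itf; rewrite /rint /Rintegral.
have itf' := integrableP _ _ _ itf.
have mf : measurable_fun D (EFin \o f) by case: itf'.
have mD' : @measurable _ (measurableTypeR R) D by [].
have h1 := integrable_pos_fin_num mD' itf.
have h2 := integrable_neg_fin_num mD' itf.
rewrite integralE [in RHS]integralE.
rewrite [X in fine (X - _)%E](_ : _ = `|s|^-1%:E * \int[@leb R]_(x in D) (EFin \o f)^\+%E x)%E; last first.
  rewrite -(ge0_integral_aff t s0 mD (measurable_funepos mf))//.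
  by apply: eq_integral => x _; rewrite !unlock.
rewrite [X in fine (_ - X)%E](_ : _ = `|s|^-1%:E * \int[@leb R]_(x in D) (EFin \o f)^\-%E x)%E; last first.
  rewrite -(ge0_integral_aff t s0 mD (measurable_funeneg mf))//.
  by apply: eq_integral => x _; rewrite !unlock.
have finB c (a b : \bar R) : a \is a fin_num -> b \is a fin_num ->
    fine (c%:E * a - c%:E * b)%E = c * fine (a - b)%E.
  by case: a => // a _; case: b => // b _ /=; rewrite mulrBr.
exact: finB.
Qed.

Lemma intgD D f g : measurable D -> intg D f -> intg D g -> intg D (f \+ g).
Proof. by move=> mD hf hg; apply: (integrableD _ hf hg). Qed.

Lemma intgZ D f k : measurable D -> intg D f -> intg D (fun x => k * f x).
Proof. by move=> mD hf; apply: (integrableZl _ _ hf). Qed.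

Lemma intgB D f g : measurable D -> intg D f -> intg D g -> intg D (f \- g).
Proof. by move=> mD hf hg; apply: (integrableB _ hf hg). Qed.

Lemma rintD D f g : measurable D -> intg D f -> intg D g ->
  rint D (f \+ g) = rint D f + rint D g.
Proof. by move=> mD hf hg; apply: RintegralD. Qed.

Lemma rintB D f g : measurable D -> intg D f -> intg D g ->
  rint D (f \- g) = rint D f - rint D g.
Proof. by move=> mD hf hg; apply: RintegralB. Qed.

Lemma rintZ D f k : measurable D -> intg D f ->
  rint D (fun x => k * f x) = k * rint D f.
Proof. by move=> mD hf; apply: RintegralZl. Qed.

Lemma eq_intg D f g : measurable D -> (forall x, D x -> f x = g x) -> intg D f -> intg D g.
Proof.
by move=> mD fg; apply: eq_integrable => // x; rewrite inE => Dx /=; rewrite fg.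
Qed.

Lemma eq_rint D f g : (forall x, D x -> f x = g x) -> rint D f = rint D g.
Proof. by move=> fg; apply: eq_Rintegral => x; rewrite inE => /fg. Qed.

Lemma rint_ge0 D f : (forall x, D x -> 0 <= f x) -> 0 <= rint D f.
Proof. by move=> f0; rewrite /rint; apply: Rintegral_ge0. Qed.

Lemma le_rint D f g : measurable D -> intg D f -> intg D g ->
  (forall x, D x -> f x <= g x) -> rint D f <= rint D g.
Proof. by move=> mD hf hg fg; apply: le_Rintegral. Qed.

Lemma intgS D E f : measurable D -> measurable E -> D `<=` E -> intg E f -> intg D f.
Proof. by move=> mD mE DE; apply: integrableS. Qed.

Lemma intg_le D f g : measurable D -> measurable_fun D f -> intg D g ->
  (forall x, D x -> `|f x| <= g x) -> intg D f.
Proof.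
move=> mD mf hg fg; apply: (le_integrable _ _ _ hg) => //; first exact/measurable_EFinP.
by move=> x Dx; rewrite /= lee_fin (le_trans (fg _ Dx))// ler_norm.
Qed.

Lemma intg_cst (a c : R) : intg `[0, a] (fun=> c).
Proof.
apply: (@measurable_bounded_integrable _ _ _ _ (fun=> c)) => //=.
  by rewrite lebesgue_measure_itv /=; case: ifPn => // _; rewrite ltry.
by exists `|c|; split=> // M /ltW cM x _.
Qed.

Lemma rint_cst (a c : R) : 0 <= a -> rint `[0, a] (fun=> c) = c * a.
Proof.
move=> a0; rewrite /rint Rintegral_cst//; congr (c * _).
rewrite -[LHS]/(fine (@lebesgue_measure R `[0, a]%classic)) lebesgue_measure_itv /= lte_fin.
by case: ifPn => /= [_|]; rewrite ?oppr0 ?addr0// -leNgt => a0'; apply/le_anti/andP.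
Qed.

Lemma intg_bd (a : R) f c : measurable_fun `[0, a] f ->
  (forall x, 0 <= x <= a -> `|f x| <= c) -> intg `[0, a] f.
Proof.
move=> mf fc; apply: (intg_le _ mf (intg_cst a c)) => //.
Qed.

Lemma L2P D f : measurable D ->
  L2 D f <-> measurable_fun D f /\ intg D (fun x => f x ^+ 2).
Proof.
move=> mD; split=> -[mf h]; split=> //.
  apply/integrableP; split; first by apply/measurable_EFinP; exact: measurable_funX.
  by under eq_integral do rewrite /= ger0_norm ?sqr_ge0//.
move/integrableP : h => [_].
by under eq_integral do rewrite /= ger0_norm ?sqr_ge0//.
Qed.

Lemma rint_setU D E f : measurable D -> measurable E -> intg D f -> intg E f ->
  [disjoint D & E] ->
  intg (D `|` E) f /\ rint (D `|` E) f = rint D f + rint E f.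
Proof.
move=> mD mE hD hE DE.
have hDE : intg (D `|` E) f.
  move/integrableP : (hD) => [m1 f1]; move/integrableP : (hE) => [m2 f2].
  have mU : measurable_fun (D `|` E) (EFin \o f) by apply/measurable_funU.
  apply/integrableP; split=> //.
  rewrite ge0_integral_setU//; first by rewrite lte_add_pinfty.
  exact: measurableT_comp.
by split=> //; rewrite /rint Rintegral_setU.
Qed.

End affine.

Section domains.
Context {R : realType}.
Implicit Types (a c x : R) (b : option R) (f h u v g : R -> R).

(* [Some a] is the edge [0, a], [None] is a half-line. *)
Definition dom b : set R := match b with Some c => `[0, c] | None => `[0, +oo[ end.

Definition oadd a b : option R := omap (fun c => a + c) b.

Definition okb b : bool := if b is Some c then 0 <= c else true.

Definition concat a f h : R -> R := fun x => if x <= a then f x else h (x - a).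

Lemma measurable_dom b : measurable (dom b).
Proof. by case: b => [c|]; exact: measurable_itv. Qed.
Hint Resolve measurable_dom : core.

Lemma domP b x : dom b x = (0 <= x) && (if b is Some c then x <= c else true) :> Prop.
Proof. by case: b => [c|] /=; rewrite in_itv. Qed.

Lemma sub_dom b x : dom b x -> `[0, x]%classic `<=` dom b.
Proof.
rewrite domP => /andP[x0 xb] y /=; rewrite in_itv /= domP => /andP[-> yx] /=.
by case: b xb => // c; apply: le_trans.
Qed.

Lemma dom0 b : okb b -> dom b 0.
Proof. by case: b => [c|] /=; rewrite in_itv /= lexx. Qed.

Lemma sub_dom_oadd a b : 0 <= a -> okb b -> `[0, a]%classic `<=` dom (oadd a b).
Proof.
move=> a0 ob; apply: sub_dom; rewrite domP a0 /=.
by case: b ob => // c /= c0; rewrite lerDl.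
Qed.

Lemma rint_cat a b f h : 0 <= a -> okb b ->
  intg `[0, a] f -> intg (dom b) h ->
  intg (dom (oadd a b)) (concat a f h) /\
  rint (dom (oadd a b)) (concat a f h) = rint `[0, a] f + rint (dom b) h.
Proof.
move=> a0 ob itf ith.
(* [concat] takes the value of [f] at the junction, so the second piece loses its endpoint 0, a null
   set. *)
pose E b : set R := match b with Some c => `]0, c]%classic | None => `]0, +oo[%classic end.
have mE b' : measurable (E b') by case: b' => [c|]; exact: measurable_itv.
have Eb : E b `<=` dom b.
  move=> x; rewrite domP /E; case: (b) => [c|] /=; rewrite in_itv /=.
    by move=> /andP[/ltW -> ->].
  by rewrite !andbT => /ltW.
have itE : intg (E b) h by apply: intgS ith.
have rE : rint (E b) h = rint (dom b) h.
  move: itE; rewrite /rint; case: (b) => [c|] /= itE; exact: Rintegral_itv_obnd_cbnd.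
have s1 : (1 : R) != 0 by [].
have it2 := intg_aff (- a) s1 (mE b) itE.
have r2 := rint_aff (- a) s1 (mE b) itE.
pose S := aff 1 (- a) @^-1` E b.
have SP x : S x = (a < x) && (if b is Some c then x <= a + c else true) :> Prop.
  rewrite /S /E /aff /=; case: (b) => [c|] /=; rewrite in_itv /= mul1r subr_gt0 ?andbT//.
  by rewrite lerBlDl.
have domE : dom (oadd a b) = `[0, a]%classic `|` S.
  apply/seteqP; split => x; rewrite domP.
    move=> /andP[x0 xb]; case: (leP x a) => xa; [left|right].
      by rewrite /= in_itv /= x0.
    by rewrite SP xa /=; case: (b) xb.
  case.
    rewrite /= in_itv /= => /andP[-> xa] /=; case: (b) ob => //= c c0.
    by rewrite (le_trans xa)// lerDl.
  by rewrite SP => /andP[ax xb]; rewrite (le_trans a0 (ltW ax)) /=; case: (b) xb.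
have mS : measurable S by exact: measurable_aff_preimage.
have itf' : intg `[0, a] (concat a f h).
  apply: eq_intg itf => //.
  by move=> x /=; rewrite in_itv /= /concat => /andP[_ ->].
have catS x : S x -> (h \o aff 1 (- a)) x = concat a f h x.
  by rewrite SP => /andP[ax _]; rewrite /concat leNgt ax /= /aff mul1r.
have ith' : intg S (concat a f h) by apply: eq_intg it2.
have aS : [disjoint `[0, a]%classic & S].
  apply/disj_setPS => x [] /=; rewrite in_itv /= => /andP[_ xa].
  by rewrite SP => /andP[ax _]; move: (lt_le_trans ax xa); rewrite ltxx.
have [i1 i2] := rint_setU (measurable_itv _) mS itf' ith' aS.
rewrite domE; split=> //; rewrite i2; congr (_ + _).
  by apply: eq_rint => x /=; rewrite in_itv /= /concat => /andP[_ ->].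
rewrite -rE -[RHS]mul1r -[X in X * _]invr1 -[X in X^-1 * _]normr1 -r2.
by apply: eq_rint => x Sx; rewrite -catS.
Qed.

Lemma rint_split a b f : 0 <= a -> okb b -> intg (dom (oadd a b)) f ->
  [/\ intg `[0, a] f, intg (dom b) (fun x => f (a + x)) &
   rint (dom (oadd a b)) f = rint `[0, a] f + rint (dom b) (fun x => f (a + x))].
Proof.
move=> a0 ob itf.
have i1 : intg `[0, a] f by apply: intgS itf => //; exact: sub_dom_oadd.
pose T : set R := match b with Some c => `[a, a + c]%classic | None => `[a, +oo[%classic end.
have mT : measurable T by rewrite /T; case: (b) => [c|]; exact: measurable_itv.
have iT : intg T f.
  apply: intgS itf => // x; rewrite domP /T; case: (b) => [c|] /=; rewrite in_itv /=.
    by move=> /andP[ax ->]; rewrite (le_trans a0).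
  by rewrite !andbT; apply: le_trans.
have preT : aff 1 a @^-1` T = dom b.
  apply/seteqP; split => x; rewrite domP /T /aff; case: (b) => [c|] /=;
    by rewrite in_itv /= mul1r [x + a]addrC lerDl ?lerD2l.
have i2 : intg (dom b) (fun x => f (a + x)).
  rewrite -preT; apply: (eq_intg _ _ (intg_aff a _ mT iT)) => //.
    by rewrite preT.
  by move=> x _ /=; rewrite /aff mul1r addrC.
have [h1 h2] := rint_cat a0 ob i1 i2.
split=> //; rewrite -h2; apply: eq_rint => x _; rewrite /concat; case: ifP => // _.
by congr f; rewrite addrC subrK.
Qed.

End domains.
#[global] Hint Resolve measurable_dom : core.

(** * Sobolev functions on one edge: gluing, cutting and pointwise bounds *)

Section H1.
Context {R : realType}.
Implicit Types (a c k x y : R) (b : option R) (f h u v g : R -> R).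

Definition sq b f : R := rint (dom b) (fun x => f x ^+ 2).

Lemma sq_ge0 b f : 0 <= sq b f.
Proof. by apply: rint_ge0 => x _; exact: sqr_ge0. Qed.

Lemma L2_meas b f : L2 (dom b) f -> measurable_fun (dom b) f.
Proof. by case. Qed.

Lemma L2_sq b f : L2 (dom b) f -> intg (dom b) (fun x => f x ^+ 2).
Proof. by case/(L2P _ (measurable_dom b)). Qed.

Lemma L2_sub b x f : dom b x -> L2 (dom b) f -> L2 (dom (Some x)) f.
Proof.
move=> bx /L2P -/(_ (measurable_dom b)) [mf i]; apply/L2P => //; split.
  exact: measurable_funS (measurable_dom b) (sub_dom bx) mf.
exact: intgS (sub_dom bx) i.
Qed.

Lemma L2_intg a f : L2 (dom (Some a)) f -> intg `[0, a] f.
Proof.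
move=> /L2P -/(_ (measurable_dom _)) [mf i].
apply: (intg_le _ mf (intgD _ (intg_cst a 1) i)) => // x _ /=.
by rewrite -(real_normK (num_real (f x))); set y := `|f x|; have := sqr_ge0 (y - 1); have := sqr_ge0 y; nra.
Qed.

Lemma cauchy_schwarz a f : 0 <= a -> L2 (dom (Some a)) f ->
  rint `[0, a] f ^+ 2 <= a * rint `[0, a] (fun x => f x ^+ 2).
Proof.
move=> a0 Lf; have [mf i2] : _ /\ _ := (L2P _ (measurable_dom (Some a))).1 Lf.
have i1 := L2_intg Lf.
move: a0; rewrite le_eqVlt => /predU1P[<-|a0].
  by rewrite mul0r /rint set_itv1 Rintegral_set1 expr0n.
(* The mean of [f]: integrating [(f - t)^2 >= 0] over [[0, a]] is the inequality. *)
pose t := rint `[0, a] f / a.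
have q t' : 0 <= rint `[0, a] (fun x => f x ^+ 2) - 2 * t' * rint `[0, a] f + t' ^+ 2 * a.
  have h : 0 <= rint `[0, a] (((fun x => f x ^+ 2) \- (fun x => 2 * t' * f x)) \+ (fun=> t' ^+ 2)).
    by apply: rint_ge0 => x _ /=; have := sqr_ge0 (f x - t'); nra.
  move: h; rewrite rintD//; last 2 first.
    by apply: intgB => //; exact: intgZ.
    exact: intg_cst.
  have i3 := intgZ (2 * t') (measurable_itv _) i1.
  by rewrite rintB// rintZ// rint_cst// ltW.
have := q t; rewrite /t; set I := rint _ f; set J := rint _ _.
have -> : J - 2 * (I / a) * I + (I / a) ^+ 2 * a = J - I ^+ 2 / a by field; rewrite gt_eqF.
by rewrite subr_ge0 ler_pdivrMr// mulrC.
Qed.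

Definition H1 b u g : Prop :=
  [/\ L2 (dom b) u, L2 (dom b) g & forall x, dom b x -> u x = u 0 + rint `[0, x] g].

Lemma H1_L2 b u g : H1 b u g -> L2 (dom b) u. Proof. by case. Qed.
Lemma H1_L2d b u g : H1 b u g -> L2 (dom b) g. Proof. by case. Qed.

Lemma H1_sub b x u g : dom b x -> H1 b u g -> H1 (Some x) u g.
Proof.
move=> bx [Lu Lg ug]; split; [exact: L2_sub Lu|exact: L2_sub Lg|].
by move=> y xy; apply: ug; apply: (sub_dom bx).
Qed.

Lemma measurable_cat a b f h : 0 <= a -> okb b ->
  measurable_fun `[0, a] f -> measurable_fun (dom b) h ->
  measurable_fun (dom (oadd a b)) (concat a f h).
Proof.
move=> a0 ob mf mh.
pose T : set R := `]a, +oo[ `&` dom (oadd a b).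
have mT : measurable T by apply: measurableI.
have -> : dom (oadd a b) = `[0, a]%classic `|` T.
  rewrite /T; apply/seteqP; split => x.
    move=> xd; move: (xd); rewrite domP => /andP[x0 xb].
    case: (leP x a) => xa; [left|right]; first by rewrite /= in_itv /= x0.
    by split=> //=; rewrite in_itv /= xa.
  by case=> [|[]//]; exact: sub_dom_oadd.
apply/measurable_funU => //; split.
  apply: (eq_measurable_fun f) => // x; rewrite inE /= in_itv /= /concat => /andP[_ ->] //.
apply: (eq_measurable_fun (h \o aff 1 (- a))) => //.
  move=> x; rewrite inE /T /= in_itv /= andbT => -[ax _].
  by rewrite /concat leNgt ax /= /aff mul1r.
apply: (@measurable_comp _ _ _ _ _ _ (dom b)) => //; first exact: measurable_dom.
  move=> y [x] [] /=; rewrite in_itv /= andbT => ax xd <-.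
  move: xd; rewrite /aff mul1r !domP subr_ge0 (ltW ax) => /andP[_].
  by case: (b) => //= c; rewrite lerBlDl.
by apply: measurable_funTS; exact: measurable_aff.
Qed.

Lemma concatX a f h n : (fun x => concat a f h x ^+ n) = concat a (fun x => f x ^+ n) (fun x => h x ^+ n).
Proof. by apply/funext => x; rewrite /concat; case: ifP. Qed.

Lemma L2_cat a b f h : 0 <= a -> okb b -> L2 (dom (Some a)) f -> L2 (dom b) h ->
  L2 (dom (oadd a b)) (concat a f h) /\ sq (oadd a b) (concat a f h) = sq (Some a) f + sq b h.
Proof.
move=> a0 ob /L2P -/(_ (measurable_dom _)) [mf if2] /L2P -/(_ (measurable_dom _)) [mh ih2].
have [h1 h2] := rint_cat a0 ob if2 ih2.
split; last by rewrite /sq concatX.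
by apply/L2P => //; split; [exact: measurable_cat|rewrite concatX].
Qed.

Lemma concat0 a u v : 0 <= a -> concat a u v 0 = u 0.
Proof. by move=> a0; rewrite /concat a0. Qed.

Lemma H1_cat a b u g v h : 0 <= a -> okb b -> H1 (Some a) u g -> H1 b v h -> u a = v 0 ->
  H1 (oadd a b) (concat a u v) (concat a g h).
Proof.
move=> a0 ob [Lu Lg ug] [Lv Lh vh] uv.
split; [by have [] := L2_cat a0 ob Lu Lv|by have [] := L2_cat a0 ob Lg Lh|].
move=> x; rewrite domP => /andP[x0 xb]; rewrite concat0//; case: (leP x a) => xa.
  rewrite /concat xa ug; last by rewrite domP x0.
  congr (_ + _); apply: eq_rint => y /=; rewrite in_itv /= => /andP[_ yx].
  by rewrite (le_trans yx xa).
have xa0 : 0 <= x - a by rewrite subr_ge0 ltW.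
have bxa : dom b (x - a) by rewrite domP xa0 /=; case: (b) xb => //= c; rewrite lerBlDl.
rewrite {1}/concat leNgt xa /= vh// -uv ug; last by rewrite domP a0 lexx.
have := rint_cat a0 (b := Some (x - a)) xa0 (L2_intg Lg) (L2_intg (L2_sub bxa Lh)).
by rewrite /= [a + _]addrC subrK => -[_ ->]; rewrite addrA.
Qed.

Lemma L2_split a b f : 0 <= a -> okb b -> L2 (dom (oadd a b)) f ->
  [/\ L2 (dom (Some a)) f, L2 (dom b) (fun x => f (a + x)) &
     sq (oadd a b) f = sq (Some a) f + sq b (fun x => f (a + x))].
Proof.
move=> a0 ob /L2P -/(_ (measurable_dom _)) [mf if2].
have [i1 i2 e] := rint_split a0 ob if2.
split=> //; apply/L2P => //; split=> //.
  exact: measurable_funS (measurable_dom _) (sub_dom_oadd a0 ob) mf.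
apply: (@measurable_comp _ _ _ _ _ _ (dom (oadd a b)) _ _ (fun x : R => a + x)) => //; first exact: measurable_dom.
  move=> y [x] + <-; rewrite !domP => /andP[x0 xb]; rewrite addr_ge0//=.
  by case: (b) xb => //= c; rewrite lerD2l.
by apply: measurable_funTS; apply: measurable_funD.
Qed.

Lemma H1_cut a b u g : 0 <= a -> okb b -> H1 (oadd a b) u g ->
  H1 b (fun x => u (a + x)) (fun x => g (a + x)).
Proof.
move=> a0 ob [Lu Lg ug].
split; [by have [] := L2_split a0 ob Lu|by have [] := L2_split a0 ob Lg|].
move=> x bx; have [x0 xb] : 0 <= x /\ dom (oadd a b) (a + x).
  move: bx; rewrite !domP => /andP[x0 xb]; split=> //; rewrite addr_ge0//=.
  by case: (b) xb => //= c; rewrite lerD2l.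
rewrite addr0 ug// [in RHS]ug; last by apply: sub_dom_oadd => //=; rewrite in_itv /= a0 /=.
rewrite -addrA; congr (_ + _).
have i := L2_intg (L2_sub xb Lg).
by have [_ _ /= ->] := @rint_split _ a (Some x) g a0 x0 i.
Qed.

Definition osub b x : option R := omap (fun c => c - x) b.

Lemma oaddK b x : oadd x (osub b x) = b.
Proof. by case: b => //= c; rewrite addrC subrK. Qed.

Lemma okb_osub b x : dom b x -> okb (osub b x).
Proof. by rewrite domP => /andP[_]; case: b => //= c; rewrite subr_ge0. Qed.

Lemma dom_osub b x y : dom b x -> 0 <= y -> dom b (x + y) -> dom (osub b x) y.
Proof.
by rewrite !domP => /andP[x0 _] -> /= /andP[_]; case: b => //= c; rewrite lerBrDl.
Qed.

Lemma dom_ge0 b x : dom b x -> 0 <= x.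
Proof. by rewrite domP => /andP[]. Qed.

Lemma dom_le b x y : 0 <= x <= y -> dom b y -> dom b x.
Proof. by move=> xy /sub_dom; apply; rewrite /= in_itv. Qed.

Lemma rint_cut b x f : dom b x -> intg (dom b) f ->
  [/\ intg `[0, x] f, intg (dom (osub b x)) (fun y => f (x + y)) &
   rint (dom b) f = rint `[0, x] f + rint (dom (osub b x)) (fun y => f (x + y))].
Proof.
move=> bx; have x0 := dom_ge0 bx; have ob := okb_osub bx.
by rewrite -{1 3}(oaddK b x) => /(rint_split x0 ob).
Qed.

Lemma L2_cut b x f : dom b x -> L2 (dom b) f ->
  [/\ L2 (dom (Some x)) f, L2 (dom (osub b x)) (fun y => f (x + y)) &
   sq b f = sq (Some x) f + sq (osub b x) (fun y => f (x + y))].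
Proof.
move=> bx; have x0 := dom_ge0 bx; have ob := okb_osub bx.
by rewrite -{1 3}(oaddK b x) => /(L2_split x0 ob).
Qed.

Lemma H1_cut' b x u g : dom b x -> H1 b u g ->
  H1 (osub b x) (fun y => u (x + y)) (fun y => g (x + y)).
Proof.
move=> bx; have x0 := dom_ge0 bx; have ob := okb_osub bx.
by rewrite -{1}(oaddK b x) => /(H1_cut x0 ob).
Qed.

Lemma sq_sub b x f : dom b x -> L2 (dom b) f -> sq (Some x) f <= sq b f.
Proof. by move=> bx /(L2_cut bx)[_ _ ->]; rewrite lerDl sq_ge0. Qed.

Lemma sq_shift b x f : dom b x -> L2 (dom b) f ->
  sq (osub b x) (fun y => f (x + y)) <= sq b f.
Proof. by move=> bx /(L2_cut bx)[_ _ ->]; rewrite lerDr sq_ge0. Qed.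

Lemma H1_holder b u g x y : H1 b u g -> 0 <= x <= y -> dom b y ->
  (u y - u x) ^+ 2 <= (y - x) * sq b g.
Proof.
move=> hu /andP[x0 xy] by_.
have bx : dom b x by apply: dom_le by_; rewrite x0.
have yx : 0 <= y - x by rewrite subr_ge0.
have byx : dom (osub b x) (y - x) by apply: dom_osub => //; rewrite addrC subrK.
have [_ Lg ug] := H1_sub byx (H1_cut' bx hu).
have -> : u y = u x + rint `[0, y - x] (fun z => g (x + z)).
  have := ug (y - x); rewrite addr0 [x + (y - x)]addrC subrK => -> //.
  by rewrite domP yx /=.
rewrite [u x + _]addrC addrK.
apply: le_trans (cauchy_schwarz yx Lg) _; apply: ler_wpM2l => //.
apply: le_trans (sq_shift bx (H1_L2d hu)).
exact: (sq_sub byx (H1_L2d (H1_cut' bx hu))).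
Qed.

Lemma H1_holderN b u g x y : H1 b u g -> dom b x -> dom b y ->
  (u y - u x) ^+ 2 <= `|y - x| * sq b g.
Proof.
move=> hu bx by_; case: (leP x y) => xy.
  rewrite ger0_norm ?subr_ge0//; apply: (H1_holder hu _ by_).
  by rewrite (dom_ge0 bx).
rewrite ltr0_norm ?subr_lt0// opprB -sqrrN opprB.
by apply: (H1_holder hu _ bx); rewrite (dom_ge0 by_) ltW.
Qed.

Lemma H1_continuous b u g c : H1 b u g -> dom b c -> {within `[0, c], continuous u}.
Proof.
move=> hu bc; have c0 := dom_ge0 bc.
have s0 := sq_ge0 b g.
have dc z : `[0, c]%classic z -> dom b z by exact: sub_dom.
apply/subspace_continuousP => x cx.
apply/cvgrPdist_lt => e e0.
have d0 : 0 < e ^+ 2 / (sq b g + 1) by rewrite divr_gt0 ?exprn_gt0//; lra.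
near=> y.
have cy : `[0, c]%classic y by near: y; exact: withinT.
have h := H1_holderN hu (dc _ cy) (dc _ cx).
rewrite -[ltRHS]gtr0_norm// -ltr_sqr ?nnegrE// !real_normK ?num_real//.
apply: le_lt_trans h _.
apply: (@le_lt_trans _ _ (`|x - y| * (sq b g + 1))).
  by apply: ler_wpM2l => //; lra.
rewrite -ltr_pdivlMr; last lra.
by near: y; apply: cvg_within; apply/nbhs_ballP; exists (e ^+ 2 / (sq b g + 1)).
Unshelve. all: by end_near. Qed.

Lemma H1_ivt b u g x y (v : R) : H1 b u g -> 0 <= x <= y -> dom b y ->
  (u x <= v <= u y) || (u y <= v <= u x) -> exists2 z : R, x <= z <= y & u z = v.
Proof.
move=> hu /andP[x0 xy] by_ uv.
have cu : {within `[x, y], continuous u}.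
  apply: continuous_subspaceW (H1_continuous hu by_).
  by move=> z /=; rewrite !in_itv /= => /andP[xz ->]; rewrite (le_trans x0).
have [|z zxy uz] := @IVT _ u x y v xy cu.
  rewrite /Num.min /Num.max; case/orP: uv => /andP[h1 h2]; case: ifPn; lra.
by exists z => //; move: zxy; rewrite in_itv.
Qed.

Lemma H1_max b u g a : H1 b u g -> dom b a ->
  exists2 z : R, 0 <= z <= a & forall x, 0 <= x <= a -> `|u x| <= `|u z|.
Proof.
move=> hu ba; have a0 := dom_ge0 ba.
have cu : {within `[0, a], continuous (fun x => `|u x|)}.
  have := H1_continuous hu ba => cu x; apply: continuous_comp (cu x) _.
  exact: norm_continuous.
have [z za zm] := EVT_max a0 cu.
exists z; first by move: za; rewrite in_itv.
by move=> x xa; apply: zm; rewrite in_itv.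
Qed.

Lemma H1_min b u g a : H1 b u g -> dom b a ->
  exists2 z : R, 0 <= z <= a & forall x, 0 <= x <= a -> u z <= u x.
Proof.
move=> hu ba; have a0 := dom_ge0 ba.
have [z za zm] := EVT_min a0 (H1_continuous hu ba).
exists z; first by move: za; rewrite in_itv.
by move=> x xa; apply: zm; rewrite in_itv.
Qed.

(** Averages [u(x)^2 <= 2 u(x+y)^2 + 2 (u(x+y) - u(x))^2] over [y] in [[0, s]], the last square
    being at most [s] times the kinetic integral. The length [s] is left free so that each use can
    balance mass against kinetic energy. *)
Lemma H1_sup b u g x s : H1 b u g -> 0 <= s -> dom b x -> dom b (x + s) ->
  u x ^+ 2 * s <= 2 * rint `[0, s] (fun y => u (x + y) ^+ 2) + 2 * s ^+ 2 * sq b g.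
Proof.
move=> hu s0 bx bxs.
have hs := H1_sub (dom_osub bx s0 bxs) (H1_cut' bx hu).
have i := L2_sq (H1_L2 hs).
have k0 := sq_ge0 b g.
rewrite -(rint_cst _ s0).
have -> : 2 * rint `[0, s] (fun y => u (x + y) ^+ 2) + 2 * s ^+ 2 * sq b g =
  rint `[0, s] ((fun y => 2 * (u (x + y) ^+ 2)) \+ (fun=> 2 * s * sq b g)).
  rewrite rintD//; last exact: intg_cst.
    by rewrite rintZ// rint_cst//; ring.
  exact: intgZ.
apply: le_rint => //; first exact: intg_cst.
  by apply: intgD => //; [exact: intgZ|exact: intg_cst].
move=> y /=; rewrite in_itv /= => /andP[y0 ys].
have h : (u (x + y) - u x) ^+ 2 <= s * sq b g.
  apply: le_trans (H1_holder hu _ _) _; first by rewrite (dom_ge0 bx) lerDl.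
    by apply: dom_le bxs; rewrite addr_ge0 ?(dom_ge0 bx)//= lerD2l.
  by rewrite addrC addKr ler_wpM2r.
have := sqr_ge0 (2 * u (x + y) - u x); nra.
Qed.

Lemma rint_tail f : intg (dom None) f -> (forall x, 0 <= x -> 0 <= f x) ->
  forall e : R, 0 < e -> exists2 X : R, 0 <= X & forall x, X <= x ->
    rint (dom None) f - rint `[0, x] f <= e.
Proof.
move=> itf f0 e e0.
pose F n : set R := `[0, n%:R]%classic.
have UF : \bigcup_n F n = dom None.
  apply/seteqP; split => [x [n _] | x]; rewrite domP /=.
    by rewrite /F /= in_itv /= => /andP[-> _].
  rewrite andbT => x0; exists (Num.truncn x).+1 => //.
  by rewrite /F /= in_itv /= x0 ltW// truncnS_gt.
have ndF : nondecreasing_seq F.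
  move=> n m nm; apply/subsetPset => x; rewrite /F /= !in_itv /= => /andP[-> xn].
  by rewrite (le_trans xn)// ler_nat.
have itF n : intg (F n) f.
  by have [] := @rint_cut None n%:R f _ itf; first by rewrite domP ler0n.
have c : (\int[@leb R]_(x in F i) (EFin \o f) x @[i --> \oo] -->
    \int[@leb R]_(x in \bigcup_i F i) (EFin \o f) x)%E.
  apply: ge0_nondecreasing_set_cvg_integral => //.
  - by move=> n; exact: measurable_itv.
  - by move=> n; exact: measurable_int (itF n).
  - by move=> n x; rewrite /F /= in_itv /= lee_fin => /andP[x0 _]; exact: f0.
have {}c : rint (F n) f @[n --> \oo] --> rint (dom None) f.
  by apply/fine_cvg; rewrite -/(rint _ _) rintK// -UF; exact: c.
have /cvgrPdist_le /(_ e e0) [N _ hN] := c.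
exists N%:R; first exact: ler0n.
move=> x Nx; have := hN N (leqnn N); rewrite /= ler_norml => /andP[_].
apply: le_trans; rewrite lerD2l lerN2.
have Nx0 : dom (Some x) N%:R by rewrite domP ler0n.
have itx : intg (dom (Some x)) f.
  by have [] := @rint_cut None x f _ itf; first by rewrite domP (le_trans (ler0n _ N)).
have [_ _ ->] := rint_cut Nx0 itx.
rewrite lerDl; apply: rint_ge0 => y; rewrite domP => /andP[y0 _].
by apply: f0; rewrite addr_ge0.
Qed.

End H1.

(** * Reflection, dilation and linear combinations *)

Section transformations.
Context {R : realType}.
Implicit Types (a c k x y s t : R) (b : option R) (f h u v g : R -> R).

Lemma L2_aff s t b b' f : s != 0 -> aff s t @^-1` dom b = dom b' -> L2 (dom b) f ->
  L2 (dom b') (f \o aff s t) /\ sq b' (f \o aff s t) = `|s|^-1 * sq b f.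
Proof.
move=> s0 e /L2P -/(_ (measurable_dom _)) [mf i2].
have j2 := intg_aff t s0 (measurable_dom b) i2.
have r2 := rint_aff t s0 (measurable_dom b) i2.
rewrite e in j2 r2; split=> //.
apply/L2P => //; split=> //.
apply: (@measurable_comp _ _ _ _ _ _ (dom b)) => //; first exact: measurable_dom.
  by move=> y [x] + <-; rewrite -e.
by apply: measurable_funTS; exact: measurable_aff.
Qed.

Lemma aff_rev_dom a : aff (-1) a @^-1` dom (Some a) = dom (Some a).
Proof.
by apply/seteqP; split => x; rewrite /preimage /= !in_itv /= /aff; move=> /andP[h1 h2]; apply/andP; split; lra.
Qed.

Definition frev a f : R -> R := f \o aff (-1) a.

Lemma H1_rev a u g : 0 <= a -> H1 (Some a) u g -> H1 (Some a) (frev a u) (fun x => - frev a g x).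
Proof.
move=> a0 hu; have [Lu Lg ug] := hu.
have m1 : (-1 : R) != 0 by rewrite oppr_eq0 oner_neq0.
have [Lu' _] := L2_aff m1 (aff_rev_dom a) Lu.
have [Lg' _] := L2_aff m1 (aff_rev_dom a) Lg.
split=> //.
  case: Lg' => mg ig; split; first exact: measurable_funN.
  by under eq_integral do rewrite sqrrN.
move=> x; rewrite domP => /andP[x0 xa].
have ax : dom (Some a) (a - x) by rewrite domP subr_ge0 xa /=; lra.
have hc := H1_cut' ax hu.
have xx : dom (osub (Some a) (a - x)) x by rewrite domP x0 /=; lra.
have hx := H1_sub xx hc.
have [_ Lgx ugx] := hx.
have := ugx x; rewrite domP x0 lexx /= => /(_ isT).
rewrite addr0 subrK /frev /= /aff => e.
have -> : -1 * x + a = a - x by ring.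
rewrite mulr0 add0r e -addrA -[LHS]addr0; congr (_ + _).
have ix := L2_intg Lgx.
have := rint_aff x m1 (measurable_itv _) ix.
have := aff_rev_dom x; rewrite /= => ->.
rewrite normrN1 invr1 mul1r => <-.
have ix' : intg `[0, x] ((fun y => g (a - x + y)) \o aff (-1) x).
  by have := intg_aff x m1 (measurable_itv _) ix; have := aff_rev_dom x; rewrite /= => ->.
rewrite -(rintD _ ix') //; last first.
  rewrite -[X in intg _ X]/(fun y : R => - (g \o aff (-1) a) y).
  apply: (@eq_intg _ _ (fun y => (-1) * ((fun y => g (a - x + y)) \o aff (-1) x) y)) => //.
    move=> y _ /=; rewrite mulN1r /aff; congr (- g _); ring.
  exact: intgZ.
rewrite -[LHS](_ : rint `[0, x] (fun=> 0) = 0); last by rewrite rint_cst// mul0r.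
apply: eq_rint => y _ /=; rewrite /aff.
by rewrite (_ : a - x + (-1 * y + x) = -1 * y + a) ?subrr//; ring.
Qed.

Lemma sq_rev a f : L2 (dom (Some a)) f -> sq (Some a) (frev a f) = sq (Some a) f.
Proof.
have m1 : (-1 : R) != 0 by rewrite oppr_eq0 oner_neq0.
by move=> /(L2_aff m1 (aff_rev_dom a)) [_ ->]; rewrite normrN1 invr1 mul1r.
Qed.

Definition odil s b : option R := omap (fun c => c / s) b.

Lemma aff_dil_dom s b : 0 < s -> aff s 0 @^-1` dom b = dom (odil s b).
Proof.
move=> s0; apply/seteqP; split => x; rewrite /preimage /= !domP /aff addr0 pmulr_rge0//;
  by case: b => //= c; rewrite ler_pdivlMr// mulrC.
Qed.

Definition fdil c s f : R -> R := fun x => c * f (aff s 0 x).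

Lemma L2Z c b f : L2 (dom b) f -> L2 (dom b) (fun x => c * f x) /\
  sq b (fun x => c * f x) = c ^+ 2 * sq b f.
Proof.
move=> /L2P -/(_ (measurable_dom _)) [mf i2].
have e : (fun x => (c * f x) ^+ 2) = (fun x => c ^+ 2 * f x ^+ 2).
  by apply/funext => x; rewrite exprMn.
split; last by rewrite /sq e rintZ.
apply/L2P => //; rewrite e; split; last exact: intgZ.
by apply: measurable_funM.
Qed.

Lemma L2_dil c s b f : 0 < s -> L2 (dom b) f ->
  L2 (dom (odil s b)) (fdil c s f) /\ sq (odil s b) (fdil c s f) = c ^+ 2 / s * sq b f.
Proof.
move=> s0 Lf; have [L1 e1] := L2_aff (lt0r_neq0 s0) (aff_dil_dom b s0) Lf.
have [L2 e2] := L2Z c L1; split=> //.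
by rewrite e2 e1 gtr0_norm// mulrA.
Qed.

Lemma H1_dil c s b u g : 0 < s -> H1 b u g -> H1 (odil s b) (fdil c s u) (fdil (c * s) s g).
Proof.
move=> s0 [Lu Lg ug]; split; [by have [] := L2_dil c s0 Lu|by have [] := L2_dil (c * s) s0 Lg|].
move=> x bx; have bx' : dom b (s * x) by move: bx; rewrite -aff_dil_dom// /preimage /= /aff addr0.
rewrite /fdil /aff addr0 mulr0 addr0 ug// mulrDr; congr (_ + _).
have i := L2_intg (L2_sub bx' Lg).
have E : aff s 0 @^-1` dom (Some (s * x)) = dom (Some x).
  by rewrite aff_dil_dom//= [s * x]mulrC mulfK// gt_eqF.
have := rint_aff 0 (lt0r_neq0 s0) (measurable_dom (Some (s * x))) i.
have i' := intg_aff 0 (lt0r_neq0 s0) (measurable_dom (Some (s * x))) i.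
rewrite E in i' *.
rewrite gtr0_norm// => e.
have e2 : rint (dom (Some (s * x))) g = s * rint (dom (Some x)) (g \o aff s 0).
  by rewrite e mulVKf// gt_eqF.
by rewrite -[rint _ g]/(rint (dom (Some (s * x))) g) e2 mulrA -rintZ.
Qed.

Lemma L2D b f h : L2 (dom b) f -> L2 (dom b) h -> L2 (dom b) (fun x => f x + h x).
Proof.
move=> /L2P -/(_ (measurable_dom _)) [mf if2] /L2P -/(_ (measurable_dom _)) [mh ih2].
apply/L2P => //; split; first exact: measurable_funD.
have i2 := intgZ 2 (measurable_dom b) (intgD (measurable_dom b) if2 ih2).
apply: (intg_le (measurable_dom b) _ i2).
  by apply: measurable_funX; exact: measurable_funD.
move=> x _ /=; rewrite ger0_norm ?sqr_ge0//.
by have := sqr_ge0 (f x - h x); nra.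
Qed.

Lemma H1D b u g v h : H1 b u g -> H1 b v h -> H1 b (fun x => u x + v x) (fun x => g x + h x).
Proof.
move=> [Lu Lg ug] [Lv Lh vh]; split; [exact: L2D|exact: L2D|].
move=> x bx; rewrite ug// vh//.
have ig := L2_intg (L2_sub bx Lg); have ih := L2_intg (L2_sub bx Lh).
by rewrite (rintD (measurable_itv _) ig ih); ring.
Qed.

Lemma H1Z c b u g : H1 b u g -> H1 b (fun x => c * u x) (fun x => c * g x).
Proof.
move=> [Lu Lg ug]; split; [by have [] := L2Z c Lu|by have [] := L2Z c Lg|].
move=> x bx; rewrite ug// mulrDr rintZ//.
exact: L2_intg (L2_sub bx Lg).
Qed.

Lemma L2_cst a c : L2 (dom (Some a)) (fun=> c).
Proof. by apply/L2P => //; split=> //; exact: intg_cst. Qed.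

Lemma H1_cst a c : H1 (Some a) (fun=> c) (fun=> 0).
Proof.
split; [exact: L2_cst|exact: L2_cst|].
by move=> x; rewrite domP => /andP[x0 _]; rewrite rint_cst// mul0r addr0.
Qed.

Lemma H1_zero b : H1 b (fun=> 0 : R) (fun=> 0).
Proof.
have z : L2 (dom b) (fun=> 0 : R).
  apply/L2P => //; split=> //; rewrite expr0n /=.
  exact: integrable0.
split=> //; by move=> x; rewrite domP => /andP[x0 _]; rewrite rint_cst// mul0r addr0.
Qed.

Lemma sq0 b : sq b (fun=> 0 : R) = 0.
Proof. by rewrite /sq expr0n /= /rint /Rintegral integral0. Qed.

Lemma H1_ramp c : H1 (Some 1) (fun x => c * x) (fun=> c).
Proof.
split; [|exact: L2_cst|].
  apply/L2P => //; split; first exact: measurable_funM.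
  apply: (@intg_bd _ _ _ (c ^+ 2)).
    by apply: measurable_funX; exact: measurable_funM.
  move=> x /andP[x0 x1]; rewrite ger0_norm ?sqr_ge0// exprMn ler_piMr ?sqr_ge0//.
  by rewrite expr_le1.
by move=> x; rewrite domP => /andP[x0 _]; rewrite mulr0 add0r rint_cst.
Qed.

End transformations.

(** * Pieces of functions and their mass, kinetic energy and potential *)

Section segments.
Context {R : realType} (p : R) (p2 : 2 < p).
Implicit Types (a c x y z s q k P M : R) (b : option R) (f h u v g : R -> R).

Lemma p_gt0 : 0 < p.
Proof. by apply: lt_trans p2. Qed.

Lemma p_gt2 : 0 < p - 2.
Proof. by rewrite subr_gt0. Qed.

Lemma powR_split y : 0 <= y -> y `^ p = y `^ (p - 2) * y ^+ 2.
Proof.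
move=> y0; rewrite -powR_mulrn// -powRD ?subrK//.
by rewrite (gt_eqF p_gt0).
Qed.

Lemma powR_le_sq y M : 0 <= y <= M -> y `^ p <= M `^ (p - 2) * y ^+ 2.
Proof.
move=> /andP[y0 yM]; rewrite powR_split// ler_wpM2r ?sqr_ge0//.
by apply: ge0_ler_powR; rewrite ?nnegrE// ?(ltW p_gt2)// (le_trans y0).
Qed.

Definition Pf b u : R := rint (dom b) (fun x => `|u x| `^ p).

Lemma Pf_ge0 b u : 0 <= Pf b u.
Proof. by apply: rint_ge0 => x _; exact: powR_ge0. Qed.

Lemma intg_pow b u M : L2 (dom b) u -> (forall x, dom b x -> `|u x| <= M) ->
  intg (dom b) (fun x => `|u x| `^ p).
Proof.
move=> /L2P -/(_ (measurable_dom _)) [mu i2] uM.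
apply: (intg_le (measurable_dom b) _ (intgZ (M `^ (p - 2)) (measurable_dom b) i2)).
  by apply: (measurableT_comp (measurable_powR p)); exact: measurableT_comp.
move=> x bx; rewrite ger0_norm ?powR_ge0// -[u x ^+ 2]real_normK ?num_real//.
by apply: powR_le_sq; rewrite normr_ge0 uM.
Qed.

Lemma Pf_ub b u M : L2 (dom b) u -> (forall x, dom b x -> `|u x| <= M) ->
  Pf b u <= M `^ (p - 2) * sq b u.
Proof.
move=> Lu uM; rewrite -rintZ//; last exact: L2_sq.
apply: le_rint => //; first exact: intg_pow uM.
  by apply: intgZ => //; exact: L2_sq.
move=> x bx; rewrite -[u x ^+ 2]real_normK ?num_real//.
by apply: powR_le_sq; rewrite normr_ge0 uM.
Qed.

Lemma H1_bounded b u g : okb b -> H1 b u g ->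
  exists2 M : R, 0 <= M & forall x, dom b x -> `|u x| <= M.
Proof.
case: b => [a|] ob hu.
  have aa : dom (Some a) a by rewrite domP lexx andbT.
  have [z _ zm] := H1_max hu aa.
  by exists `|u z| => // x; rewrite domP; exact: zm.
have q0 := sq_ge0 None u; have k0 := sq_ge0 None g.
exists (1 + 2 * sq None u + 2 * sq None g); first lra.
move=> x bx; have bx1 : dom None (x + 1) by rewrite domP addr_ge0 ?(dom_ge0 bx).
have := H1_sup hu ler01 bx bx1.
have : rint `[0, 1] (fun y => u (x + y) ^+ 2) <= sq None u.
  apply: le_trans (sq_shift bx (H1_L2 hu)).
  apply: (@sq_sub _ None 1); first by rewrite domP ler01.
  by case: (H1_cut' bx hu).
rewrite mulr1 expr1n mulr1 => h1 h2.
have : `|u x| ^+ 2 <= 2 * sq None u + 2 * sq None g by rewrite real_normK ?num_real//; lra.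
have := normr_ge0 (u x); nra.
Qed.

Lemma H1_intg_pow b u g : okb b -> H1 b u g -> intg (dom b) (fun x => `|u x| `^ p).
Proof. by move=> ob hu; have [M _ uM] := H1_bounded ob hu; apply: intg_pow uM; case: hu. Qed.

Lemma Pf_cut b x u g : okb b -> dom b x -> H1 b u g ->
  Pf b u = Pf (Some x) u + Pf (osub b x) (fun y => u (x + y)).
Proof. by move=> ob bx /(H1_intg_pow ob) /(rint_cut bx)[]. Qed.

Lemma Pf_sub b x u g : okb b -> dom b x -> H1 b u g -> Pf (Some x) u <= Pf b u.
Proof. by move=> ob bx /(Pf_cut ob bx) ->; rewrite lerDl Pf_ge0. Qed.

(* A competitor matters only through its values [x], [y] at the ends ([y] is
   irrelevant on a half-line), its mass [q], kinetic integral [k] and [L^p]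
   integral [P]; cutting and pasting functions becomes arithmetic on these. *)
Definition seg b x y q k P := okb b /\ exists u g,
  [/\ H1 b u g, u 0 = x, (if b is Some a then u a = y else True) &
   [/\ sq b u = q, sq b g = k & Pf b u = P]].

Lemma seg_ge0 b x y q k P : seg b x y q k P -> [/\ 0 <= q, 0 <= k & 0 <= P].
Proof.
by move=> [_ [u [g [_ _ _ [<- <- <-]]]]]; split; rewrite ?sq_ge0 ?Pf_ge0.
Qed.

Lemma seg_H1 b u g : okb b -> H1 b u g ->
  seg b (u 0) (if b is Some a then u a else 0) (sq b u) (sq b g) (Pf b u).
Proof. by move=> ob hu; split=> //; exists u, g; split=> //; case: (b). Qed.

Lemma seg_H1T u g : H1 None u g -> seg None (u 0) 0 (sq None u) (sq None g) (Pf None u).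
Proof. by move=> hu; apply: (@seg_H1 None). Qed.

Lemma seg_sub b u g x : dom b x -> H1 b u g ->
  seg (Some x) (u 0) (u x) (sq (Some x) u) (sq (Some x) g) (Pf (Some x) u).
Proof.
by move=> bx /(H1_sub bx); apply: (@seg_H1 (Some x)); exact: (dom_ge0 bx).
Qed.

Lemma seg_cut b u g x : okb b -> dom b x -> H1 b u g ->
  seg (osub b x) (u x) (if b is Some a then u a else 0)
    (sq b u - sq (Some x) u) (sq b g - sq (Some x) g) (Pf b u - Pf (Some x) u).
Proof.
move=> ob bx hu.
have [_ _ ->] := L2_cut bx (H1_L2 hu).
have [_ _ ->] := L2_cut bx (H1_L2d hu).
rewrite (Pf_cut ob bx hu) ![_ (Some x) _ + _]addrC !addrK.
have := seg_H1 (okb_osub bx) (H1_cut' bx hu).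
by rewrite addr0; case: (b) => //= c; rewrite [x + (c - x)]addrC subrK.
Qed.

Lemma seg_cat a b x y z q k P q' k' P' : seg (Some a) x y q k P -> seg b y z q' k' P' ->
  seg (oadd a b) x z (q + q') (k + k') (P + P').
Proof.
move=> [a0 [u [g [hu u0 ua [<- <- <-]]]]] [ob [v [h [hv v0 vb [<- <- <-]]]]].
split; first by case: (b) ob => //= c; exact: addr_ge0.
exists (concat a u v), (concat a g h).
have uv : u a = v 0 by rewrite ua v0.
split; first exact: H1_cat.
- by rewrite concat0.
- case: (b) ob vb => //= c c0 vc; rewrite /concat.
  case: ifP => [|_]; last by rewrite [a + c]addrC addrK.
  rewrite gerDl => c0'; have c00 : c = 0 by apply/le_anti; rewrite c0 c0'.
  by rewrite c00 addr0 uv -vc c00.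
- have [_ ->] := L2_cat a0 ob (H1_L2 hu) (H1_L2 hv).
  have [_ ->] := L2_cat a0 ob (H1_L2d hu) (H1_L2d hv).
  have [_ e] := rint_cat a0 ob (@H1_intg_pow (Some a) _ _ a0 hu) (H1_intg_pow ob hv).
  split=> //; rewrite /Pf -[X in _ = X]e; apply: eq_rint => t _.
  by rewrite /concat; case: ifP.
Qed.

Lemma seg_rev a x y q k P : seg (Some a) x y q k P -> seg (Some a) y x q k P.
Proof.
move=> [a0 [u [g [hu u0 ua [<- <- <-]]]]]; split=> //.
exists (frev a u), (fun t => - frev a g t); split; first exact: H1_rev.
- by rewrite /frev /= /aff mulr0 add0r.
- by rewrite /frev /= /aff mulN1r addNr.
- rewrite sq_rev; last exact: H1_L2 hu.
  rewrite -(sq_rev (H1_L2d hu)).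
  split; [by []|by apply: eq_rint => t _; rewrite sqrrN|].
  have m1 : (-1 : R) != 0 by rewrite oppr_eq0 oner_neq0.
  have := rint_aff a m1 (measurable_dom (Some a)) (@H1_intg_pow (Some a) _ _ a0 hu).
  by rewrite aff_rev_dom normrN1 invr1 mul1r.
Qed.

Lemma seg_cst a c : 0 <= a -> seg (Some a) c c (c ^+ 2 * a) 0 (`|c| `^ p * a).
Proof.
move=> a0; split=> //; exists (fun=> c), (fun=> 0).
split=> //; first exact: H1_cst.
by split; rewrite ?sq0// ?/sq ?/Pf; apply: rint_cst.
Qed.

Lemma seg_zero y : seg None 0 y 0 0 0.
Proof.
split=> //; exists (fun=> 0), (fun=> 0); split=> //; first exact: H1_zero.
split; rewrite ?sq0//.
rewrite /Pf normr0 powR0; last exact: lt0r_neq0 p_gt0.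
by rewrite /rint /Rintegral integral0.
Qed.

(** Brings a truncated function down to 0. For [|c| <= 1] mass, kinetic integral and potential of
    the ramp are all at most [c^2]. *)
Lemma seg_ramp c : exists q P, [/\ seg (Some 1) 0 c q (c ^+ 2) P, q <= c ^+ 2 & P <= `|c| `^ p].
Proof.
have h := H1_ramp c.
have o1 : okb (Some (1 : R)) by exact: ler01.
have := seg_H1 o1 h; rewrite mulr0 mulr1.
have -> : sq (Some 1) (fun=> c) = c ^+ 2 by rewrite /sq rint_cst ?mulr1.
move=> hs; exists (sq (Some 1) (fun x => c * x)), (Pf (Some 1) (fun x => c * x)).
have qle : sq (Some 1) (fun x => c * x) <= c ^+ 2.
  rewrite -[leRHS]mulr1 -(rint_cst _ ler01); apply: le_rint => //; first exact: L2_sq (H1_L2 h).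
    exact: intg_cst.
  move=> x; rewrite /= in_itv /= => /andP[x0 x1].
  by rewrite exprMn ler_piMr ?sqr_ge0// expr_le1.
split=> //.
have uM x : dom (Some 1) x -> `|c * x| <= `|c|.
  by rewrite domP => /andP[x0 x1]; rewrite normrM ler_piMr// ger0_norm.
apply: le_trans (Pf_ub (H1_L2 h) uM) _.
rewrite [X in _ <= X]powR_split// real_normK ?num_real//.
by apply: ler_wpM2l; first exact: powR_ge0.
Qed.

Lemma seg_dil c s b x y q k P : 0 < s -> seg b x y q k P ->
  seg (odil s b) (c * x) (c * y) (c ^+ 2 / s * q) (c ^+ 2 * s * k) (`|c| `^ p / s * P).
Proof.
move=> s0 [ob [u [g [hu u0 uy [<- <- <-]]]]]; split.
  by case: (b) ob => //= a a0; rewrite divr_ge0// ltW.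
exists (fdil c s u), (fdil (c * s) s g); split; first exact: H1_dil.
- by rewrite /fdil /aff mulr0 addr0 u0.
- case: (b) uy => //= a <-; rewrite /fdil /aff addr0 mulrCA divff ?mulr1//.
  exact: lt0r_neq0.
- have [_ ->] := L2_dil c s0 (H1_L2 hu).
  have [_ ->] := L2_dil (c * s) s0 (H1_L2d hu).
  split=> //; first by congr (_ * _); field; exact: lt0r_neq0.
  have i := H1_intg_pow ob hu.
  have := rint_aff 0 (lt0r_neq0 s0) (measurable_dom b) i.
  have := intg_aff 0 (lt0r_neq0 s0) (measurable_dom b) i.
  rewrite aff_dil_dom// gtr0_norm// => i' e.
  rewrite -mulrA -e -rintZ//; apply: eq_rint => t _ /=.
  by rewrite /fdil normrM powRM.
Qed.

Lemma seg_scale c b x y q k P : seg b x y q k P ->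
  seg b (c * x) (c * y) (c ^+ 2 * q) (c ^+ 2 * k) (`|c| `^ p * P).
Proof.
move=> /(seg_dil c ltr01); rewrite !divr1 mulr1 /odil.
by case: b => [a|] /=; rewrite ?divr1.
Qed.

End segments.

Lemma big_option_split (V : nmodType) (I : finType) (F : option I -> V) :
  \sum_(e : option I) F e = F None + \sum_(i : I) F (Some i).
Proof.
rewrite (bigD1 None)//=; congr (_ + _).
rewrite (reindex_omap Some id) => [|[]//]; apply: eq_bigl => i /=; exact: eqxx.
Qed.

(** * Infima over masses at most 1 *)

Section infimum.
Context {R : realType} (p : R) (p2 : 2 < p) (p6 : p < 6).
Implicit Types (q k P d : R).

Definition En k P : R := 2^-1 * k - p^-1 * P.

Lemma En_scale k P c : 1 <= c -> 0 <= P ->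
  En (c ^+ 2 * k) (c `^ p * P) <= c ^+ 2 * En k P.
Proof.
move=> c1 P0.
have hc : c ^+ 2 <= c `^ p.
  rewrite (powR_split p2) ?(le_trans ler01)// ler_peMl ?sqr_ge0//.
  by apply: le_trans (ler_powR c1 (ltW (p_gt2 p2))); rewrite powRr0.
have pP0 : 0 <= p^-1 * P by rewrite mulr_ge0// invr_ge0 ltW// p_gt0.
by have := ler_wpM2r pP0 hc; rewrite /En; lra.
Qed.

(** What the theory of infima needs; it serves both functions on the graph ([gconf]) and functions
    on a half-line vanishing at the origin ([ztail]). [conf_null] covers the competitors of mass 0,
    which cannot be normalized. *)
Record conf_class (C : R -> R -> R -> Prop) : Prop := ConfClass {
  conf_ge0 : forall q k P, C q k P -> [/\ 0 <= q, 0 <= k & 0 <= P];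
  conf_scale : forall q k P c, C q k P -> 0 <= c ->
    C (c ^+ 2 * q) (c ^+ 2 * k) (c `^ p * P);
  conf_null : forall k P, C 0 k P -> P = 0;
  conf0 : C 0 0 0;
  conf_lb : exists B, forall q k P, C q k P -> q <= 1 -> B <= En k P }.

(** With mass at most 1 rather than exactly 1, a competitor stays admissible when mass is removed;
    by [conf_normalize], raising a positive mass to 1 only lowers a negative energy. *)
Definition values (C : R -> R -> R -> Prop) : set R :=
  [set e | exists q k P, [/\ C q k P, q <= 1 & e = En k P]].

Definition infE C : R := inf (values C).

Section theory.
Variables (C : R -> R -> R -> Prop) (CC : conf_class C).

Lemma values_has_inf : has_inf (values C).
Proof.
split; first by exists (En 0 0), 0, 0, 0; split=> //; exact: conf0 CC.
have [B hB] := conf_lb CC; exists B => e [q [k [P [c q1 ->]]]]; exact: hB c q1.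
Qed.

Lemma infE_le q k P : C q k P -> q <= 1 -> infE C <= En k P.
Proof. by move=> c q1; apply: ge_inf; [case: values_has_inf|exists q, k, P]. Qed.

Lemma infE_le0 : infE C <= 0.
Proof. by have := infE_le (conf0 CC) ler01; rewrite /En !mulr0 subr0. Qed.

Lemma infE_approx (e : R) : 0 < e ->
  exists q k P, [/\ C q k P, q <= 1 & En k P < infE C + e].
Proof.
move=> e0; have [_ [q [k [P [c q1 ->]]]] h] := inf_adherent e0 values_has_inf.
by exists q, k, P.
Qed.

Lemma infE_ge (x : R) : (forall q k P, C q k P -> q <= 1 -> x <= En k P) -> x <= infE C.
Proof.
move=> h; apply: lb_le_inf; first by case: values_has_inf.
by move=> _ [q [k [P [c q1 ->]]]]; exact: h c q1.
Qed.

(** Multiplication by [t = q^(-1/2) >= 1] multiplies the kinetic term by [t^2 = 1/q] and the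
    potential by [t^p >= t^2]. *)
Lemma conf_normalize q k P : C q k P -> 0 < q -> q <= 1 -> exists k' P',
  C 1 k' P' /\ En k' P' <= En k P / q.
Proof.
move=> c q0 q1; pose t : R := Num.sqrt q^-1.
have t2 : t ^+ 2 = q^-1 by rewrite sqr_sqrtr// invr_ge0 ltW.
have t1 : 1 <= t by rewrite -(@expr_ge1 _ 2) ?sqrtr_ge0// t2 invf_ge1.
have [_ _ P0] := conf_ge0 CC c.
exists (t ^+ 2 * k), (t `^ p * P); split.
  have := conf_scale CC c (le_trans ler01 t1).
  by rewrite t2 mulVf ?gt_eqF.
by rewrite [_ / q]mulrC -t2; exact: En_scale.
Qed.

(* Superlinearity in the mass [q], with an error term for masses exceeding 1. *)
Lemma infE_superlinear q k P d : C q k P -> 0 <= d -> q <= 1 + d ->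
  q * infE C <= En k P + 3 * d * (p^-1 * P).
Proof.
move=> c d0 qd; have [q0 k0 P0] := conf_ge0 CC c.
have pi0 : 0 < p^-1 by rewrite invr_gt0 p_gt0.
have I0 := infE_le0.
have pP0 : 0 <= p^-1 * P by rewrite mulr_ge0// ltW.
have [q1|q1] := leP q 1.
  apply: (@le_trans _ _ (En k P)); last by rewrite lerDl mulr_ge0// mulr_ge0.
  move: q0; rewrite le_eqVlt => /predU1P[q0|q0].
    rewrite -q0 in c *; rewrite mul0r /En (conf_null CC c) mulr0 subr0; lra.
  have [k' [P' [c' e']]] := conf_normalize c q0 q1.
  by rewrite -ler_pdivlMl// mulrC; apply: le_trans e'; exact: infE_le c' _.
pose t : R := Num.sqrt q^-1.
have qp : 0 < q by lra.
have t2 : t ^+ 2 = q^-1 by rewrite sqr_sqrtr// invr_ge0 ltW.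
have t0 : 0 < t by rewrite sqrtr_gt0 invr_gt0.
have t1 : t <= 1 by rewrite -(@expr_le1 _ 2) ?sqrtr_ge0// t2 invf_le1// ltW.
have c' := conf_scale CC c (ltW t0); rewrite t2 mulVf ?gt_eqF// in c'.
have h := infE_le c' (lexx 1).
(* As [t <= 1] and [p < 6], [t^p >= t^6 = q^(-3) >= (1 + d)^(-3) >= 1 - 3 d]; this is the origin of
   the factor 3. *)
have tp : 1 - 3 * d <= t `^ p.
  apply: (@le_trans _ _ (t `^ 6)); last first.
    by apply: ger_powR; rewrite ?t0// ltW.
  rewrite (powR_mulrn 6 (ltW t0)) (exprM _ 2 3) t2 exprVn.
  rewrite -[leRHS]div1r ler_pdivlMr ?exprn_gt0//.
  have q3 : q ^+ 3 <= (1 + d) ^+ 3 by rewrite lerXn2r ?nnegrE//; lra.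
  have [d3|d3] := leP 0 (1 - 3 * d).
    apply: (le_trans (ler_wpM2l d3 q3)).
    rewrite -subr_ge0 (_ : _ - _ = d ^+ 2 * (6 + 8 * d + 3 * d ^+ 2)); last by ring.
    by apply: mulr_ge0; [exact: sqr_ge0|have := sqr_ge0 d; lra].
  have : 0 <= q ^+ 3 by rewrite exprn_ge0// ltW.
  nra.
have kq : t ^+ 2 * k <= k by rewrite ler_piMl// t2 invf_le1// ltW.
apply: (@le_trans _ _ (infE C)).
  by rewrite -[leRHS]mul1r ler_wnM2r// ltW.
apply: le_trans h _; rewrite -t2 /En.
have hP : (1 - 3 * d) * (p^-1 * P) <= t `^ p * (p^-1 * P) by rewrite ler_wpM2r.
rewrite [p^-1 * (_ * _)]mulrCA; lra.
Qed.

End theory.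
End infimum.

(** * Functions on the star graph *)

Section graphs.
Context {R : realType} (p : R) (p2 : 2 < p) (p6 : p < 6) (N : nat) (N0 : (0 < N)%N).
Implicit Types (l q k P c s x y : R) (u g : option 'I_N -> R -> R).

Definition eb l (e : option 'I_N) : option R := if e is Some _ then None else Some l.

Lemma edge_domE l e : edge_dom l e = dom (eb l e).
Proof. by case: e. Qed.

Definition Kin l g : R := \sum_(e : option 'I_N) sq (eb l e) (g e).
Definition Pot l u : R := \sum_(e : option 'I_N) Pf p (eb l e) (u e).

Lemma massE l u : mass l u = Kin l u.
Proof. by apply: eq_bigr => e _; rewrite edge_domE. Qed.

Lemma energyE l u g : energy l p u g = En p (Kin l g) (Pot l u).
Proof.
by rewrite /energy /En; congr (_ * _ - _ * _); apply: eq_bigr => e _; rewrite edge_domE.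
Qed.

Lemma H1_graphP l u g : H1_graph l u g <->
  (forall e, H1 (eb l e) (u e) (g e)) /\ (forall i, u (Some i) 0 = u None 0).
Proof.
split=> -[h1 h2]; split=> // e; have := h1 e; rewrite edge_domE.
  by move=> [? [? ?]].
by case.
Qed.

Lemma Kin_split l g : Kin l g = sq (Some l) (g None) + \sum_i sq None (g (Some i)).
Proof. exact: big_option_split. Qed.

Lemma Pot_split l u : Pot l u = Pf p (Some l) (u None) + \sum_i Pf p None (u (Some i)).
Proof. exact: big_option_split. Qed.

Definition gconf l q k P : Prop := exists u g,
  H1_graph l u g /\ [/\ Kin l u = q, Kin l g = k & Pot l u = P].

Lemma H1_graph_conf l u g : H1_graph l u g -> gconf l (Kin l u) (Kin l g) (Pot l u).
Proof. by exists u, g. Qed.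

Lemma okb_eb l e : 0 <= l -> okb (eb l e).
Proof. by case: e. Qed.

Lemma gconf_ge0 l q k P : gconf l q k P -> [/\ 0 <= q, 0 <= k & 0 <= P].
Proof.
by move=> [u [g [_ [<- <- <-]]]]; split; apply: sumr_ge0 => e _; rewrite ?sq_ge0 ?Pf_ge0.
Qed.

Lemma segT_any x y y' q k P : seg p None x y q k P -> seg p None x y' q k P.
Proof. by move=> [_ [u [g [hu u0 _ h]]]]; split=> //; exists u, g. Qed.

(** The last conjunct is for [good_limit], which has to keep track of the mass on the terminal
    edge. *)
Lemma graph_intro l x y q k P (qi ki Pi : 'I_N -> R) :
  seg p (Some l) x y q k P -> (forall i, seg p None x 0 (qi i) (ki i) (Pi i)) ->
  exists u g, H1_graph l u g /\ [/\ Kin l u = q + \sum_i qi i, Kin l g = k + \sum_i ki i,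
    Pot l u = P + \sum_i Pi i & sq (Some l) (u None) = q].
Proof.
move=> [l0 [u [g [hu u0 _ [<- <- <-]]]]] h.
have hex i : exists v : (R -> R) * (R -> R), [/\ H1 None v.1 v.2, v.1 0 = x &
    [/\ sq None v.1 = qi i, sq None v.2 = ki i & Pf p None v.1 = Pi i]].
  by have [_ [w [w' [h1 h2 _ h3]]]] := h i; exists (w, w').
have [v hv] := choice hex.
exists (fun e => if e is Some i then (v i).1 else u), (fun e => if e is Some i then (v i).2 else g).
split.
  apply/H1_graphP; split; first by case=> [i|] //=; case: (hv i).
  by move=> i; rewrite u0; case: (hv i).
by rewrite !Kin_split Pot_split; split=> //; congr (_ + _); apply: eq_bigr => i _;
  case: (hv i) => _ _ [].
Qed.

Lemma gconf_intro l x y q k P (qi ki Pi : 'I_N -> R) :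
  seg p (Some l) x y q k P -> (forall i, seg p None x 0 (qi i) (ki i) (Pi i)) ->
  gconf l (q + \sum_i qi i) (k + \sum_i ki i) (P + \sum_i Pi i).
Proof.
by move=> hT ht; have [u [g [hG [? ? ? _]]]] := graph_intro hT ht; exists u, g.
Qed.

Lemma gconf_dil c s l q k P : 0 < s -> 0 <= l -> gconf l q k P ->
  gconf (l / s) (c ^+ 2 / s * q) (c ^+ 2 * s * k) (`|c| `^ p / s * P).
Proof.
move=> s0 l0 [u [g [/H1_graphP[hu u0] [<- <- <-]]]].
rewrite Kin_split Pot_split Kin_split !mulrDr !mulr_sumr.
apply: (gconf_intro (x := c * u None 0) (y := c * u None l)).
  have := seg_dil p2 c s0 (@seg_H1 _ p (Some l) _ _ l0 (hu None)).
  exact.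
move=> i; rewrite -(u0 i) -[X in seg _ _ _ X](mulr0 c).
exact: (seg_dil p2 c s0 (seg_H1T p (hu (Some i)))).
Qed.

Lemma seg_sup x y s q k P : seg p None x y q k P -> 0 < s -> x ^+ 2 <= 2 * q / s + 2 * s * k.
Proof.
move=> [_ [u [g [hu u0 _ [<- <- _]]]]] s0; rewrite -u0.
have d0 : dom None (0 : R) by rewrite domP lexx.
have ds : dom None (0 + s) by rewrite add0r domP ltW.
have := H1_sup hu (ltW s0) d0 ds.
have : rint `[0, s] (fun z => u (0 + z) ^+ 2) <= sq None u.
  rewrite (_ : (fun _ => _) = (fun z => u z ^+ 2)); last by apply/funext => z; rewrite add0r.
  by rewrite add0r in ds; exact: sq_sub ds (H1_L2 hu).
move=> h1 h2; rewrite -(ler_pM2r s0) mulrDl divfK ?gt_eqF//.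
by move: h1 h2; set A := rint _ _; set Z := u 0 ^+ 2 * s; move=> h1 h2; nra.
Qed.

(* A point of the terminal edge is linked to a half-line, which has room for an
   interval of length [s]. *)
Lemma graph_sup l u g e x s : 0 <= l -> H1_graph l u g -> dom (eb l e) x -> 0 < s ->
  u e x ^+ 2 <= 2 * Kin l u / s + 2 * s * Kin l g.
Proof.
move=> l0 /H1_graphP[hu u0] ex s0.
pose i0 : 'I_N := Ordinal N0.
have Ki (v : option 'I_N -> R -> R) i : sq None (v (Some i)) <= Kin l v - sq (Some l) (v None).
  rewrite Kin_split addrAC subrr add0r (bigD1 i)//= lerDl.
  by apply: sumr_ge0 => j _; exact: sq_ge0.
suff [q [k [P [y [h1 hq hk]]]]] : exists q k P y, [/\ seg p None (u e x) y q k P,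
    q <= Kin l u & k <= Kin l g].
  apply: (le_trans (seg_sup h1 s0)); apply: lerD.
    by rewrite ler_pM2r ?invr_gt0// ler_wpM2l.
  by rewrite ler_wpM2l// mulr_ge0// ltW.
have ss (v : option 'I_N -> R -> R) y' : dom (Some l) y' -> sq (Some y') (v None) <= sq (Some l) (v None) -> 
    sq (Some y') (v None) + sq None (v (Some i0)) <= Kin l v.
  by move=> _ h; have := Ki v i0; lra.
case: e ex => [i|] ex.
  have hi := hu (Some i).
  have := @seg_cut _ p p2 None _ _ x isT ex hi.
  move=> h; exists (sq None (u (Some i)) - sq (Some x) (u (Some i))).
  exists (sq None (g (Some i)) - sq (Some x) (g (Some i))).
  exists (Pf p None (u (Some i)) - Pf p (Some x) (u (Some i))), 0; split=> //.
    by have := Ki u i; have := sq_ge0 (Some x) (u (Some i)); have := sq_ge0 (Some l) (u None); lra.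
  by have := Ki g i; have := sq_ge0 (Some x) (g (Some i)); have := sq_ge0 (Some l) (g None); lra.
rewrite -[eb l None]/(Some l) in ex.
have h1 := seg_rev p2 (seg_sub p ex (hu None)).
have h2 := seg_H1T p (hu (Some i0)); rewrite u0 in h2.
have h := seg_cat p2 h1 h2.
do 4 eexists; split; first exact: h.
  by apply: ss => //; apply: (sq_sub (b := Some l)) => //; exact: H1_L2 (hu None).
by apply: ss => //; apply: (sq_sub (b := Some l)) => //; exact: H1_L2d (hu None).
Qed.

Lemma Pot_ub l u g M : 0 <= l -> H1_graph l u g ->
  (forall e x, dom (eb l e) x -> `|u e x| <= M) -> Pot l u <= M `^ (p - 2) * Kin l u.
Proof.
move=> l0 /H1_graphP[hu u0] uM; rewrite /Pot /Kin mulr_sumr; apply: ler_sum => e _.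
by apply: Pf_ub => //; [exact: H1_L2 (hu e)|exact: uM].
Qed.

(* With mass at most 1, [sup |u|^2 <= 4 sqrt k], so negative energy gives
   [k <= P <= C k^((p - 2) / 4)] with exponent less than 1. *)
Lemma energy_bounds : exists B : R, 1 <= B /\ forall l u g, 0 <= l -> H1_graph l u g ->
  Kin l u <= 1 -> En p (Kin l g) (Pot l u) <= 0 ->
  [/\ Kin l g <= B, Pot l u <= B & forall e x, dom (eb l e) x -> `|u e x| <= B].
Proof.
pose c : R := (p - 2) / 4.
have c0 : 0 < c by rewrite divr_gt0//; exact: p_gt2.
have c1 : 0 < 1 - c by have := p6; rewrite /c; lra.
pose A : R := (4 : R) `^ (2 * c).
pose KB : R := A `^ (1 - c)^-1.
have KB0 : 0 <= KB by exact: powR_ge0.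
pose MB : R := 2 + 2 * KB.
exists (KB + MB + MB `^ (p - 2)); split.
  by have := powR_ge0 MB (p - 2); rewrite /MB in KB0 *; lra.
move=> l u g l0 hu m1 e0.
have [q0 k0 P0] := gconf_ge0 (H1_graph_conf hu).
set q := Kin l u in q0 m1 *; set k := Kin l g in e0 k0 *; set P := Pot l u in P0 e0 *.
have sup s e x : 0 < s -> dom (eb l e) x -> u e x ^+ 2 <= 2 / s + 2 * s * k.
  move=> s0 ex; apply: (le_trans (graph_sup l0 hu ex s0)); rewrite lerD2r.
  by rewrite ler_pM2r ?invr_gt0// -/q; lra.
have kP : k <= P.
  have pp : p^-1 * P <= 2^-1 * P.
    by rewrite ler_wpM2r// lef_pV2 ?posrE ?(p_gt0 p2)// ltW.
  by move: e0; rewrite /En; lra.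
have kB : k <= KB.
  move: k0; rewrite le_eqVlt => /predU1P[<-//|k0].
  pose t : R := Num.sqrt k.
  have t0 : 0 < t by rewrite sqrtr_gt0.
  have tt : t ^+ 2 = k by rewrite sqr_sqrtr// ltW.
  have uM e x : dom (eb l e) x -> `|u e x| <= 2 * k `^ (1 / 4).
    (* The window [1 / t = k^(-1/2)] balances the two terms of [sup] and gives [u^2 <= 4 t]. *)
    move=> ex; have ti : 0 < t^-1 by rewrite invr_gt0.
    have := sup _ _ _ ti ex; rewrite invrK -tt.
    have -> : 2 * t + 2 * t^-1 * t ^+ 2 = 4 * t by field; exact: lt0r_neq0.
    have -> : 4 * t = (2 * k `^ (1 / 4)) ^+ 2.
      rewrite exprMn -(powR_mulrn 2 (powR_ge0 _ _)) -powRrM.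
      have -> : 1 / 4 * 2%:R = 2^-1 :> R by field.
      by rewrite powR12_sqrt ?(ltW k0)// -natrX.
    by rewrite tt -real_normK ?num_real// ler_sqr ?nnegrE// mulr_ge0// powR_ge0.
  have h := Pot_ub l0 hu uM; rewrite -/P -/q in h.
  have h2 : k <= (2 * k `^ (1 / 4)) `^ (p - 2).
    by apply: (le_trans kP); apply: (le_trans h); rewrite ler_piMr// powR_ge0.
  have e2 : (2 * k `^ (1 / 4)) `^ (p - 2) = A * k `^ c.
    rewrite powRM ?powR_ge0//; congr (_ * _).
      rewrite /A -[4 in RHS](_ : 2 ^+ 2 = 4 :> R); last by rewrite -natrX.
      by rewrite -powR_mulrn// -powRrM; congr (_ `^ _); rewrite /c; field.
    by rewrite -powRrM; congr (_ `^ _); rewrite /c; field.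
  have h3 : k `^ (1 - c) <= A.
    rewrite -(ler_pM2r (powR_gt0 c k0)) -e2 -powRD ?subrK ?powRr1 ?(ltW k0)//.
    by rewrite (gt_eqF k0) implybT.
  have -> : k = (k `^ (1 - c)) `^ (1 - c)^-1.
    by rewrite -powRrM divff ?powRr1 ?(ltW k0)// lt0r_neq0.
  by apply: ge0_ler_powR; rewrite ?nnegrE ?powR_ge0 ?invr_ge0 ?(ltW c1).
have uB e x : dom (eb l e) x -> `|u e x| <= MB.
  move=> ex; have := sup 1 _ _ ltr01 ex; rewrite divr1 mulr1 -real_normK ?num_real//.
  have := normr_ge0 (u e x); rewrite /MB; set y := `|u e x|; nra.
have PB : P <= MB `^ (p - 2).
  apply: (le_trans (Pot_ub l0 hu uB)); rewrite -/q ler_piMr//; exact: powR_ge0.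
have MB0 : 0 <= MB by rewrite /MB; lra.
have := powR_ge0 MB (p - 2) => MP.
split; [lra|lra|move=> e x ex; have := uB _ _ ex; lra].
Qed.

Lemma gconf_class l : 0 <= l -> conf_class p (gconf l).
Proof.
move=> l0; split.
- exact: gconf_ge0.
- move=> q k P c h c0; have := gconf_dil c ltr01 l0 h.
  by rewrite !divr1 mulr1 ger0_norm.
- move=> k P [u [g [hu [q0 _ <-]]]]; apply/le_anti; rewrite sumr_ge0 ?andbT; last first.
    by move=> e _; exact: Pf_ge0.
  move: hu => /H1_graphP[hu _].
  rewrite -[leRHS]q0 /Pot /Kin; apply: ler_sum => e _.
  have [M M0 uM] := H1_bounded (okb_eb e l0) (hu e).
  apply: (le_trans (Pf_ub p2 (H1_L2 (hu e)) uM)).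
  have -> : sq (eb l e) (u e) = 0; last by rewrite mulr0.
  apply/eqP; move/eqP: q0; rewrite /Kin psumr_eq0; last by move=> ? _; exact: sq_ge0.
  by move/allP => /(_ e (mem_index_enum _)).
- have h := gconf_intro (seg_cst p 0 l0) (fun i : 'I_N => seg_zero p2 0).
  by rewrite expr0n !mul0r normr0 (powR0 (lt0r_neq0 (p_gt0 p2))) !mul0r !big1_eq !addr0 in h.
- have [B [B1 hB]] := energy_bounds.
  exists (- (p^-1 * B)) => q k P [u [g [hu [<- <- <-]]]] q1.
  have pi0 : 0 < p^-1 by rewrite invr_gt0 p_gt0.
  have [e0|e0] := leP (En p (Kin l g) (Pot l u)) 0.
    have [_ PB _] := hB _ _ _ l0 hu q1 e0.
    have [_ k0 _] := gconf_ge0 (H1_graph_conf hu).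
    rewrite /En; have := ler_wpM2l (ltW pi0) PB; lra.
  by apply: le_trans (ltW e0); rewrite oppr_le0 mulr_ge0 ?(ltW pi0)//; lra.
Qed.

Definition ztail q k P := seg p None 0 0 q k P.

(** The function is put on one half-line and extended by 0; vanishing at the origin makes this
    continuous at the vertex. It represents mass that has run away along a half-line. *)
Lemma ztail_gconf l q k P : 0 <= l -> ztail q k P -> gconf l q k P.
Proof.
move=> l0 hz; pose i0 : 'I_N := Ordinal N0.
pose f (z : R) (i : 'I_N) : R := if i == i0 then z else 0.
have sf z : \sum_i f z i = z.
  by rewrite (bigD1 i0)//= /f eqxx big1 ?addr0// => i /negbTE ->.
have h := @gconf_intro l 0 0 0 0 0 (f q) (f k) (f P).
rewrite !sf !add0r in h; apply: h.
  have := seg_cst p 0 l0.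
  by rewrite expr0n !mul0r normr0 (powR0 (lt0r_neq0 (p_gt0 p2))) !mul0r.
by move=> i; rewrite /f; case: ifP => // _; exact: seg_zero.
Qed.

(** Nullity and the lower bound are inherited from the graph, whose length 1 is an arbitrary
    choice. *)
Lemma ztail_class : conf_class p ztail.
Proof.
have l1 : (0 : R) <= 1 by [].
have G := gconf_class l1; split.
- by move=> q k P; exact: seg_ge0.
- move=> q k P c h c0; have h2 := seg_scale p2 c (h : seg p None 0 0 q k P).
  by rewrite mulr0 ger0_norm// in h2.
- by move=> k P /(ztail_gconf l1); exact: conf_null G _ _.
- exact: seg_zero.
- have [B hB] := conf_lb G; exists B => q k P /(ztail_gconf l1) h q1; exact: hB h q1.
Qed.

Definition ER : R := infE p ztail.
Definition gE l : R := infE p (gconf l).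

Lemma gE_le_ER l : 0 <= l -> gE l <= ER.
Proof.
move=> l0; apply: (infE_ge ztail_class) => q k P h q1.
exact: (infE_le (gconf_class l0)) (ztail_gconf l0 h) q1.
Qed.

(** A trapezoid is dilated by [s] with its mass kept at 1. Its kinetic integral is then of order
    [s^2] and its potential of order [s^((p-2)/2)], a smaller exponent because [p < 6]. The chosen
    [s] makes the kinetic integral equal to the potential divided by [p], so the energy is minus
    half of it. *)
Lemma ER_lt0 : ER < 0.
Proof.
have [q1 [P1 [h1 hq hP]]] := seg_ramp p2 (1 : R).
have h := seg_cat p2 h1 (seg_cat p2 (seg_cst p 1 ler01)
  (seg_cat p2 (seg_rev p2 h1) (seg_zero p2 0))).
rewrite normr1 powR1 !expr1n !mulr1 in h.
set q := (q1 + _) in h; set k := (1 + _) in h; set P := (P1 + _) in h.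
have [q10 _ P10] := seg_ge0 h1.
have q0 : 0 < q by rewrite /q; lra.
have P0 : 0 < P by rewrite /P; lra.
have k0 : 0 < k by rewrite /k; lra.
have pi0 : 0 < p^-1 by rewrite invr_gt0 p_gt0.
pose c : R := (p - 2) / 2.
have c0 : 0 < c by rewrite divr_gt0//; exact: p_gt2.
have c2 : 0 < 2 - c by have := p6; rewrite /c; lra.
pose t : R := q^-1 `^ (p / 2) * (p^-1 * P) / (q^-1 * k).
have qi0 : 0 < q^-1 by rewrite invr_gt0.
have t0 : 0 < t.
  by apply: divr_gt0; apply: mulr_gt0 => //; [exact: powR_gt0|exact: mulr_gt0].
have [s s0 sE] : exists2 s : R, 0 < s & s `^ (2 - c) = t.
  exists (t `^ (2 - c)^-1); first exact: powR_gt0.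
  by rewrite -powRrM mulVf ?powRr1 ?(ltW t0)// lt0r_neq0.
pose a : R := Num.sqrt (s / q).
have a2 : a ^+ 2 = s / q by rewrite sqr_sqrtr// divr_ge0// ltW.
have a0 : 0 <= a by exact: sqrtr_ge0.
have := seg_dil p2 a s0 h; rewrite /= !mulr0 a2 => hz.
have e1 : s / q / s * q <= 1.
  by rewrite mulrAC divfK ?lt0r_neq0// divff ?lt0r_neq0.
have hle := infE_le ztail_class hz e1; rewrite -/ER in hle.
apply: (le_lt_trans hle); rewrite /En.
have -> : `|a| `^ p / s * P = s `^ c * (q^-1 `^ (p / 2) * P).
  rewrite ger0_norm// /a -powR12_sqrt ?divr_ge0 ?(ltW s0) ?(ltW q0)// -powRrM.
  have -> : 2^-1 * p = p / 2 :> R by rewrite mulrC.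
  rewrite powRM ?invr_ge0 ?(ltW s0) ?(ltW q0)//.
  have -> : s `^ (p / 2) = s `^ c * s.
    have -> : p / 2 = c + 1 by rewrite /c; field.
    by rewrite powRD ?powRr1 ?(ltW s0)// (gt_eqF s0) implybT.
  by field; rewrite lt0r_neq0.
have -> : s / q * s * k = s `^ c * (s `^ (2 - c) * (q^-1 * k)).
  rewrite mulrA -powRD; last by rewrite (gt_eqF s0) implybT.
  by rewrite addrC subrK (powR_mulrn 2) ?(ltW s0)//; ring.
rewrite sE.
have -> : t * (q^-1 * k) = q^-1 `^ (p / 2) * (p^-1 * P).
  by rewrite /t divfK// mulf_neq0// ?invr_eq0 lt0r_neq0.
have : 0 < s `^ c * (q^-1 `^ (p / 2) * (p^-1 * P)).
  by apply: mulr_gt0; [exact: powR_gt0|apply: mulr_gt0; [exact: powR_gt0|exact: mulr_gt0]].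
by set x := s `^ c; set y := q^-1 `^ _; set z := p^-1; lra.
Qed.

End graphs.

Lemma le_eps (R : realType) (x y C : R) :
  (forall e : R, 0 < e -> e <= 1 -> x <= y + e * C) -> x <= y.
Proof.
move=> h; rewrite leNgt; apply/negP => yx.
pose c : R := `|C| + 1.
have c0 : 0 < c by rewrite /c ltr_wpDl.
pose e : R := Num.min 1 ((x - y) / (2 * c)).
have e0 : 0 < e by rewrite lt_min ltr01 divr_gt0 ?subr_gt0 ?mulr_gt0.
have e1 : e <= 1 by rewrite ge_min lexx.
have e2 : e * (2 * c) <= x - y.
  by rewrite -ler_pdivlMr ?mulr_gt0// ge_min lexx orbT.
have := h e e0 e1; have : e * C <= e * c.
  by rewrite ler_pM2l// /c; have := ler_norm C; lra.
lra.
Qed.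

Lemma H1_holder0 (R : realType) b (v h : R -> R) y : H1 b v h -> dom b y ->
  (v y - v 0) ^+ 2 <= y * sq b h.
Proof.
by move=> hv dy; have := H1_holder hv (x := 0) (y := y); rewrite lexx (dom_ge0 dy) subr0 => /(_ isT dy).
Qed.

(** * Competitors with energy at most [ER] *)

Section tails.
Context {R : realType} (p : R) (p2 : 2 < p).
Implicit Types (u g : R -> R).

Lemma tail_small u g : H1 None u g -> forall e : R, 0 < e ->
  exists2 X : R, 0 <= X & forall x : R, X <= x -> [/\ u x ^+ 2 <= e,
    sq None u - sq (Some x) u <= e & Pf p None u - Pf p (Some x) u <= e].
Proof.
move=> hu e e0.
pose K := sq None g; have K0 : 0 <= K by exact: sq_ge0.
(* A window so short that the kinetic term of [H1_sup], divided by [s], is at most [e / 2]; [e']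
   then makes the mass left in the tail small relative to [s]. *)
pose s : R := e / (4 * (K + 1)).
have s0 : 0 < s by rewrite divr_gt0//; lra.
have sK : 2 * s * K <= e / 2.
  have : s * (4 * (K + 1)) = e by rewrite /s divfK// lt0r_neq0//; lra.
  nra.
pose e' : R := Num.min e (s * e / 4).
have e'0 : 0 < e' by rewrite lt_min e0 divr_gt0// mulr_gt0.
have [X1 X10 h1] := rint_tail (L2_sq (H1_L2 hu)) (fun x _ => sqr_ge0 (u x)) e'0.
have [X2 X20 h2] := rint_tail (@H1_intg_pow _ _ p2 None _ _ isT hu)
  (fun x _ => powR_ge0 _ _) e0.
exists (Num.max X1 X2); first by rewrite le_max X10.
move=> x; rewrite ge_max => /andP[x1 x2].
have x0 : 0 <= x by exact: le_trans x1.
have dx : dom None x by rewrite domP x0.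
have q1 : sq None u - sq (Some x) u <= e' by exact: h1.
have dxs : dom None (x + s) by rewrite domP addr_ge0// ltW.
split; [|by apply: le_trans q1 _; rewrite ge_min lexx|exact: h2].
have := H1_sup hu (ltW s0) dx dxs.
have : rint `[0, s] (fun y => u (x + y) ^+ 2) <= e'.
  apply: le_trans q1; have [_ _ ->] := L2_cut dx (H1_L2 hu).
  rewrite addrC addKr; apply: (sq_sub (b := osub None x)).
    by rewrite domP ltW.
  exact: H1_L2 (H1_cut' dx hu).
have e's : e' <= s * e / 4 by rewrite ge_min lexx orbT.
rewrite -/K => a1 a2; rewrite -(ler_pM2r s0); apply: (le_trans a2).
have -> : 2 * s ^+ 2 * K = (2 * s * K) * s by ring.
have := ler_wpM2r (ltW s0) sK; lra.
Qed.

(** Values tend to 0 at infinity, so beyond some point they stay below a given nonzero value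
    [|u x0|], and a compact interval remains. *)
Lemma tail_max u g : H1 None u g ->
  exists2 z : R, 0 <= z & forall x : R, 0 <= x -> `|u x| <= `|u z|.
Proof.
move=> hu.
have [[x0 x00 ux0]|h] := pselect (exists2 x : R, 0 <= x & u x != 0); last first.
  exists 0 => // x x0; have [->|ux] := eqVneq (u x) 0; first by rewrite normr0.
  by exfalso; apply: h; exists x.
have e0 : 0 < u x0 ^+ 2 by rewrite lt0r sqrf_eq0 ux0 sqr_ge0.
have [X X0 hX] := tail_small hu e0.
have a0 : 0 <= Num.max X x0 by rewrite le_max X0.
have da : dom None (Num.max X x0) by rewrite domP a0.
have [z /andP[z0 _] zm] := H1_max hu da.
exists z => // x x0'; have [xa|xa] := leP x (Num.max X x0); first by apply: zm; rewrite x0'.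
have [] := hX x; first by apply: le_trans (ltW xa); rewrite le_max lexx.
move=> h1 _ _; apply: (@le_trans _ _ `|u x0|).
  by rewrite -ler_sqr ?nnegrE// !real_normK ?num_real.
by apply: zm; rewrite x00 le_max lexx orbT.
Qed.

(** A half-line cannot be reversed. Truncating it and descending to 0 by a ramp gives a bounded
    piece that can be, so that two half-lines can be joined into one competitor vanishing at the
    origin. *)
Lemma seg_trunc u g (e : R) : H1 None u g -> 0 < e -> e <= 1 ->
  exists a q k P, [/\ seg p (Some a) (u 0) 0 q k P, q <= sq None u + e,
    k <= sq None g + e, Pf p None u - e <= P & P <= Pf p None u + e].
Proof.
move=> hu e0 e1; have [X X0 /(_ X (lexx X)) [uX _ hP]] := tail_small hu e0.
have dX : dom None X by rewrite domP X0.
have [q [P [hr hq hP']]] := seg_ramp p2 (u X).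
have [q0 _ P0] := seg_ge0 hr.
have h := seg_cat p2 (seg_sub p dX hu) (seg_rev p2 hr).
have h1 := sq_sub dX (H1_L2 hu); have h2 := sq_sub dX (H1_L2d hu).
have h3 := Pf_sub p2 (isT : okb None) dX hu.
have n1 : `|u X| <= 1.
  by rewrite -(@expr_le1 _ 2)// real_normK ?num_real// (le_trans uX).
have hP2 : `|u X| `^ p <= e.
  apply: le_trans uX; rewrite -[leRHS]real_normK ?num_real//.
  have := @powR_le_sq _ _ p2 `|u X| 1; rewrite normr_ge0 n1 powR1 mul1r; exact.
do 4 eexists; split; [exact: h|lra|lra|lra|lra].
Qed.

End tails.

(** * Surgery on the half-lines and location of the maximum *)

Section surgery.
Context {R : realType} (p : R) (p2 : 2 < p) (p6 : p < 6) (N : nat) (N3 : (2 < N)%N).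
Implicit Types (l : R) (u g : option 'I_N -> R -> R) (i j : 'I_N).

Let N0 : (0 < N)%N. Proof. by case: N N3. Qed.

Let ZC := ztail_class p2 p6 N0.
Let ER0 := ER_lt0 p2 p6 N0.

Let pi0 : 0 < p^-1. Proof. by rewrite invr_gt0 p_gt0. Qed.

(* The competitor on the line runs along half-line [j], reversed, then along [i1],
   with the mass of all other edges inserted as a constant piece of height [M] at
   [x1]; the kinetic integrals of the terminal edge and of [j'] are saved. *)
Lemma halfline_surgery l u g i1 j j' (x1 : R) (M := `|u (Some i1) x1| : R) :
  0 <= l -> H1_graph l u g -> Kin l u <= 1 -> 0 <= x1 ->
  (forall i (x : R), 0 <= x -> `|u (Some i) x| <= M) ->
  j != i1 -> j' != i1 -> j' != j ->
  ER p + 2^-1 * sq (Some l) (g None) + 2^-1 * sq None (g (Some j'))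
   - p^-1 * (Pf p (Some l) (u None) - M `^ (p - 2) * sq (Some l) (u None))
  <= En p (Kin l g) (Pot p l u).
Proof.
move=> l0 hG m1 x10 uM ji1 j'i1 j'j; have [hu u0] := (H1_graphP _ _ _).1 hG.
pose S3 (F : 'I_N -> R) := \sum_(i | (i != i1) && (i != j)) F i.
have S3E F : \sum_i F i = F i1 + (F j + S3 F).
  by rewrite (bigD1 i1)//= (bigD1 j).
have S3j' (F : 'I_N -> R) : (forall i, 0 <= F i) -> F j' <= S3 F.
  move=> F0; rewrite /S3 (bigD1 j') ?j'i1//= lerDl.
  by apply: sumr_ge0.
rewrite Kin_split S3E in m1; rewrite Kin_split Pot_split !S3E.
have := S3j' (fun i => sq None (g (Some i))) (fun i => sq_ge0 _ _) => hk'.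
have M0 : 0 <= M by exact: normr_ge0.
have dM i x : dom None x -> `|u (Some i) x| <= M by move=> /dom_ge0; exact: uM.
have PM i : Pf p None (u (Some i)) <= M `^ (p - 2) * sq None (u (Some i)).
  exact: Pf_ub (H1_L2 (hu (Some i))) (dM i).
have S3P : S3 (fun i => Pf p None (u (Some i))) <= M `^ (p - 2) * S3 (fun i => sq None (u (Some i))).
  by rewrite /S3 mulr_sumr; apply: ler_sum => i _.
set kT := sq (Some l) (g None) in hk' *; set qT := sq (Some l) (u None) in m1 *.
set PT := Pf p (Some l) (u None).
set k3 := S3 (fun i => sq None (g (Some i))) in hk' *.
set q3 := S3 (fun i => sq None (u (Some i))) in m1 S3P *.
set P3 := S3 (fun i => Pf p None (u (Some i))) in S3P *.
set k1 := sq None (g (Some i1)); set kj := sq None (g (Some j)).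
set P1 := Pf p None (u (Some i1)); set Pj := Pf p None (u (Some j)).
set q1 := sq None (u (Some i1)) in m1 *; set qj := sq None (u (Some j)) in m1 *.
have kT0 : 0 <= kT by exact: sq_ge0.
have qT0 : 0 <= qT by exact: sq_ge0.
have k10 : 0 <= k1 by exact: sq_ge0.
have kj0 : 0 <= kj by exact: sq_ge0.
have Pj0 : 0 <= Pj by exact: Pf_ge0.
have P10 : 0 <= P1 by exact: Pf_ge0.
have q30 : 0 <= q3 by apply: sumr_ge0 => i _; exact: sq_ge0.
(* A constant piece of height [M = 0] carries no mass, but then the half-lines contribute no
   potential and [ER < 0] is enough. *)
move: M0; rewrite le_eqVlt => /predU1P[M00|M0].
  have e0 : M `^ (p - 2) = 0 by rewrite -M00 powR0// lt0r_neq0// p_gt2.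
  have := PM i1; have := PM j; rewrite -/P1 -/Pj e0 !mul0r in S3P * => h1 h2.
  rewrite /En.
  have := ler_wpM2l (ltW pi0) h1; have := ler_wpM2l (ltW pi0) h2.
  by have := ler_wpM2l (ltW pi0) S3P; have := ER0; rewrite !mulr0 !mulrDr; lra.
(* The length of the constant piece of height [M] and mass [qT + q3]. *)
have rM0 : 0 <= (qT + q3) / M ^+ 2 by rewrite divr_ge0 ?sqr_ge0//; lra.
have M2 : M ^+ 2 != 0 by rewrite sqrf_eq0 lt0r_neq0.
apply: (@le_eps _ _ _ (2 + p^-1 + 3 * (p^-1 * (Pj + 1 + P1 + M `^ (p - 2) * (qT + q3))) - ER p)) => e e0 e1.
have [a [q [k [P [hs hq hk hP1 hP2]]]]] := seg_trunc p2 (hu (Some j)) e0 e1.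
rewrite -/qj in hq; rewrite -/kj in hk; rewrite -/Pj in hP1 hP2.
rewrite u0 in hs; have x1d : dom None x1 by rewrite domP x10.
have hsub := seg_sub p x1d (hu (Some i1)); rewrite u0 in hsub.
have hcut := @seg_cut _ _ p2 None _ _ _ isT x1d (hu (Some i1)).
have hz := seg_cat p2 (seg_rev p2 hs) (seg_cat p2 hsub
  (seg_cat p2 (seg_cst p (u (Some i1) x1) rM0) hcut)).
rewrite /= -/M -[u _ _ ^+ 2]real_normK ?num_real// -/M in hz.
rewrite [M ^+ 2 * _]mulrC divfK// in hz.
rewrite (powR_split p2 (ltW M0)) -[_ * M ^+ 2 * _]mulrA [M ^+ 2 * _]mulrC divfK// in hz.
rewrite -/P1 -/q1 -/k1 in hz.
move: hz; set Q := (q + _); set K := (k + _); set PP := (P + _) => hz.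
have Q1 : Q <= 1 + e by rewrite /Q; lra.
have := infE_superlinear p2 p6 ZC hz (ltW e0) Q1.
rewrite -/(ER p).
have PPl : PP <= Pj + 1 + P1 + M `^ (p - 2) * (qT + q3) by rewrite /PP; lra.
have PPg : Pj + P1 + P3 + M `^ (p - 2) * qT - e <= PP by rewrite /PP; lra.
have hQ : (1 + e) * ER p <= Q * ER p by rewrite ler_wnM2r// ltW.
have := ler_wpM2l (ltW pi0) PPg.
have := ler_wpM2l (mulr_ge0 (ltW e0) (ltW pi0)) PPl.
have KK : K <= kj + k1 + e by rewrite /K; lra.
by rewrite /En; set C := M `^ _; set E := ER p in hQ *; set p1 := p^-1; lra.
Qed.

(** Near the first point where it leaves 0, [V] climbs to a height [t] within a length [s], which
    costs a kinetic integral of at least [t^2 / s]. A ramp of length 1 up to the same height costs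
    only [t^2] and worsens mass and potential by a fixed multiple of [t^2]. For [s] small enough the
    replacement would fall below [ER]. *)
Lemma ER_not_attained (V h : R -> R) : H1 None V h -> V 0 = 0 -> sq None V <= 1 ->
  ER p < En p (sq None h) (Pf p None V).
Proof.
move=> hV V0 V1; rewrite ltNge; apply/negP => le.
(* An initial interval on which [V] vanishes is cut off, so that [V] has nonzero values arbitrarily
   near 0. *)
wlog nz : V h hV V0 V1 le / forall s : R, 0 < s -> exists2 x : R, 0 <= x <= s & V x != 0.
  move=> H; pose Z : set R := [set x | 0 <= x /\ V x != 0].
  have Z0 : Z !=set0.
    apply: contrapT => nZ; have Vz x : 0 <= x -> V x = 0.
      by move=> x0; apply: contrapT => /eqP Vx; apply: nZ; exists x.
    have P0 : Pf p None V = 0.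
      rewrite -[RHS](_ : Pf p None (fun=> 0) = 0); last by case: (seg_zero p2 0) => _ [v [w [_ _ _ [_ _ _]]]];
        rewrite /Pf normr0 powR0 ?lt0r_neq0 ?p_gt0// /rint /Rintegral integral0.
      by apply: eq_rint => x /dom_ge0 x0; rewrite Vz.
    have := sq_ge0 None h; have := ER0; rewrite /En P0 mulr0 subr0 in le; lra.
  have Zlb : has_lbound Z by exists 0 => x [].
  have Zinf : has_inf Z by [].
  pose x0 := inf Z.
  have x00 : 0 <= x0 by apply: lb_le_inf => // x [].
  have V0' x : 0 <= x -> x < x0 -> V x = 0.
    move=> xx0 xlt; apply: contrapT => /eqP Vx; have := ge_inf Zlb (conj xx0 Vx).
    by rewrite -/x0 leNgt xlt.
  have dx0 : dom None x0 by rewrite domP x00.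
  have Vx0 : V x0 = 0.
    move: x00; rewrite le_eqVlt => /predU1P[<-//|x0p].
    apply/eqP; rewrite -sqrf_eq0 eq_le sqr_ge0 andbT.
    apply: (@le_eps _ _ _ (x0 * sq None h)) => e e0 e1.
    have h1 : 0 <= x0 - e * x0 by rewrite subr_ge0 ler_piMl// ltW.
    have h2 : x0 - e * x0 < x0 by rewrite ltrBlDr ltrDl mulr_gt0.
    have := H1_holder hV (x := x0 - e * x0) (y := x0); rewrite h1 (ltW h2) => /(_ isT dx0).
    by rewrite (V0' _ h1 h2) subr0 opprB addrC subrK add0r mulrA.
  apply: (H _ _ (H1_cut' dx0 hV)).
  - by rewrite addr0.
  - exact: le_trans (sq_shift dx0 (H1_L2 hV)) V1.
  - apply: le_trans le; rewrite /En.
    have -> : Pf p None V = Pf p None (fun y => V (x0 + y)).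
      rewrite (Pf_cut p2 (isT : okb None) dx0 hV).
      rewrite [X in X + _](_ : _ = 0) ?add0r//.
      rewrite /Pf -(mul0r x0) -(rint_cst 0 x00); apply: eq_rint => x; rewrite /= in_itv /=.
      move=> /andP[xx0]; rewrite le_eqVlt => /predU1P[->|/V0' ->//];
        by rewrite ?Vx0 normr0 powR0// lt0r_neq0// p_gt0.
    by rewrite lerD2r ler_pM2l ?invr_gt0// (sq_shift dx0 (H1_L2d hV)).
  - move=> s s0; have [x [xx0 Vx] xlt] := inf_adherent s0 Zinf.
    have xge : x0 <= x by exact: ge_inf.
    by exists (x - x0); [rewrite subr_ge0 xge /= lerBlDl ltW|rewrite addrC subrK].
have [B B0 VB] := H1_bounded (isT : okb None) hV.
set K := sq None h in le; set PW := Pf p None V in le.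
have PW0 : 0 <= PW by exact: Pf_ge0.
pose b := B `^ (p - 2).
have b0 : 0 <= b by exact: powR_ge0.
pose C1 := PW + b * B ^+ 2.
have C10 : 0 <= C1 by rewrite addr_ge0// mulr_ge0// sqr_ge0.
(* [D t^2] bounds all losses: the kinetic energy of the ramp, the potential on [[0, r]] and the
   excess mass in [infE_superlinear]. With [s = 1 / (4 D)] the kinetic integral saved is at least
   [4 D t^2]. *)
pose D : R := 2^-1 + p^-1 * b + 3 * (p^-1 * C1) - ER p.
have D0 : 0 < D.
  by have := mulr_ge0 (ltW pi0) b0; have := mulr_ge0 (ltW pi0) C10; have := ER0; rewrite /D; lra.
pose s : R := (4 * D)^-1.
have s0 : 0 < s by rewrite invr_gt0 mulr_gt0.
have sD : s * (4 * D) = 1 by rewrite mulVf// lt0r_neq0// mulr_gt0.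
have s1 : s <= 1.
  rewrite invf_le1 ?mulr_gt0//; have := mulr_ge0 (ltW pi0) b0.
  by have := mulr_ge0 (ltW pi0) C10; have := ER0; rewrite /D; lra.
have ds : dom None s by rewrite domP ltW.
have [r /andP[r0 rs] rm] := H1_max hV ds.
pose t : R := `|V r|.
have t0 : 0 < t.
  have [x xs Vx] := nz s s0; apply: lt_le_trans (rm x xs); by rewrite normr_gt0.
have dr : dom None r by rewrite domP r0.
have rm' x : dom (Some r) x -> `|V x| <= t.
  by rewrite domP => /andP[x0 xr]; apply: rm; rewrite x0 (le_trans xr).
have hVr := H1_sub dr hV.
have tB : t <= B by exact: VB.
have Vr2 : V r ^+ 2 = t ^+ 2 by rewrite /t real_normK ?num_real.
have Kr : t ^+ 2 <= s * sq (Some r) h.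
  have drr : dom (Some r) r by rewrite domP r0 lexx.
  have := H1_holder hVr (x := 0) (y := r); rewrite lexx r0 => /(_ isT drr).
  rewrite V0 !subr0 Vr2 => h1; apply: (le_trans h1).
  by apply: ler_wpM2r => //; exact: sq_ge0.
have qr : sq (Some r) V <= t ^+ 2.
  apply: (@le_trans _ _ (t ^+ 2 * r)); last by rewrite ler_piMr ?sqr_ge0// (le_trans rs).
  rewrite -(rint_cst _ r0); apply: le_rint => //; [exact: L2_sq (H1_L2 hVr)|exact: intg_cst|].
  move=> x xr; rewrite -[leLHS]real_normK ?num_real// lerXn2r ?nnegrE ?normr_ge0 ?(ltW t0)//.
  exact: rm'.
have tb : t `^ (p - 2) <= b by apply: ge0_ler_powR; rewrite ?nnegrE ?(ltW (p_gt2 p2)) ?(ltW t0).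
have Pr : Pf p (Some r) V <= b * t ^+ 2.
  apply: (le_trans (Pf_ub p2 (H1_L2 hVr) rm')).
  by apply: ler_pM => //; [exact: powR_ge0|exact: sq_ge0].
have [q' [P' [hr hq' hP']]] := seg_ramp p2 (V r).
have hz := seg_cat p2 hr (@seg_cut _ _ p2 None _ _ _ isT dr hV).
rewrite -/K -/PW Vr2 -/t /= in hz hq' hP'.
have tp : t `^ p <= b * t ^+ 2.
  by rewrite (powR_split p2 (ltW t0)) ler_wpM2r ?sqr_ge0.
have tB2 : b * t ^+ 2 <= b * B ^+ 2.
  by rewrite ler_wpM2l// lerXn2r// nnegrE ltW.
have [_ _ P'0] := seg_ge0 hr.
move: hz; set Q := (q' + _); set KK := (_ + (K - _)); set PP := (P' + _) => hz.
have Q1 : Q <= 1 + t ^+ 2 by have := sq_ge0 (Some r) V; rewrite /Q; lra.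
have t20 : 0 <= t ^+ 2 by exact: sqr_ge0.
have := infE_superlinear p2 p6 ZC hz t20 Q1; rewrite -/(ER p).
have hQ : (1 + t ^+ 2) * ER p <= Q * ER p by rewrite ler_wnM2r// ltW.
have PPl : PP <= C1 by have := Pf_ge0 p (Some r) V; rewrite /PP /C1; lra.
have PPg : PW - b * t ^+ 2 <= PP by rewrite /PP; lra.
have := ler_wpM2l (ltW pi0) PPg.
have := ler_wpM2l (mulr_ge0 t20 (ltW pi0)) PPl.
have K4 : 4 * D * t ^+ 2 <= sq (Some r) h.
  by rewrite -(ler_pM2l s0) mulrA sD mul1r.
have tt : 0 < D * t ^+ 2 by rewrite mulr_gt0// exprn_gt0.
have DE : D * t ^+ 2 = 2^-1 * t ^+ 2 + p^-1 * b * t ^+ 2 + 3 * (p^-1 * C1) * t ^+ 2 - ER p * t ^+ 2.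
  by rewrite /D; ring.
move: le; rewrite /En /KK; set E := ER p in hQ DE *; set p1 := p^-1 in DE *.
clearbody C1 D; move=> *; lra.
Qed.

Lemma third_index i j : exists k, k != i /\ k != j.
Proof.
have : (0 < #|~: [set i; j]|)%N.
  rewrite cardsCs finset.setCK card_ord subn_gt0; apply: leq_ltn_trans N3.
  by rewrite cards2; case: (i != j).
by move=> /card_gt0P[k]; rewrite !inE negb_or => /andP[? ?]; exists k.
Qed.

Lemma halfline_max l u g : H1_graph l u g -> exists i1 (x1 : R), 0 <= x1 /\
  forall i (x : R), 0 <= x -> `|u (Some i) x| <= `|u (Some i1) x1|.
Proof.
move=> /H1_graphP[hu _].
have hex i : exists z : R, 0 <= z /\ forall x : R, 0 <= x -> `|u (Some i) x| <= `|u (Some i) z|.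
  by have [z z0 zm] := tail_max p2 (hu (Some i)); exists z.
have [z hz] := choice hex.
pose i0 : 'I_N := Ordinal N0.
have [i1 _ hi1] := @Order.TotalTheory.arg_maxP _ _ _ i0 xpredT (fun i => `|u (Some i) (z i)|) isT.
exists i1, (z i1); split; first by case: (hz i1).
by move=> i x x0; apply: le_trans (hi1 i isT); case: (hz i) => _; apply.
Qed.

(** Among constants only 0 is square integrable on a half-line; here [seg_sup] with a window of
    length [1 / e] bounds [v(x)^2] by [2 e] times the mass. *)
Lemma sq_const0 v h : H1 None v h -> sq None h = 0 -> forall x : R, 0 <= x -> v x = 0.
Proof.
move=> hv k0 x x0; have dx : dom None x by rewrite domP x0.
have hc := H1_cut' dx hv.
have hk : sq None (fun y => h (x + y)) = 0.
  by apply/le_anti; rewrite sq_ge0 -{1}k0 andbT; exact: sq_shift dx (H1_L2d hv).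
apply/eqP; rewrite -sqrf_eq0 eq_le sqr_ge0 andbT.
apply: (@le_eps _ _ _ (2 * sq None (fun y => v (x + y)))) => e e0 e1.
have ei : 0 < e^-1 by rewrite invr_gt0.
have := seg_sup (seg_H1T p hc) ei; rewrite addr0 hk mulr0 addr0 invrK add0r.
by rewrite mulrC.
Qed.

(** If a half-line [i1] had the strictly larger maximum, [halfline_surgery] would leave no room: the
    terminal edge and every half-line other than [i1] would have zero kinetic energy. Then [u]
    vanishes on all of them, and its restriction to [i1] contradicts [ER_not_attained]. *)
Lemma max_on_terminal_edge l u g : 0 <= l -> H1_graph l u g -> Kin l u <= 1 ->
  En p (Kin l g) (Pot p l u) <= ER p ->
  exists xm : R, 0 <= xm <= l /\
    forall e x, dom (eb l e) x -> `|u e x| <= `|u None xm|.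
Proof.
move=> l0 hG m1 hE; have [hu u0] := (H1_graphP _ _ _).1 hG.
have dl : dom (Some l) l by rewrite domP l0 lexx.
have [xm xml hxm] := H1_max (hu None) dl.
have [i1 [x1 [x10 uM]]] := halfline_max hG.
exists xm; split=> //.
have hT x : dom (Some l) x -> `|u None x| <= `|u None xm| by rewrite domP; exact: hxm.
have [mM|Mm] := leP `|u (Some i1) x1| `|u None xm|.
  by case=> [i|] x dx; [apply: le_trans mM; apply: uM; exact: dom_ge0 dx|exact: hT].
exfalso; set M : R := `|u (Some i1) x1| in uM Mm.
have PT : Pf p (Some l) (u None) <= M `^ (p - 2) * sq (Some l) (u None).
  apply: Pf_ub => //; first exact: H1_L2 (hu None).
  by move=> x /hT h; apply: le_trans h (ltW Mm).
have key j' : j' != i1 -> sq (Some l) (g None) = 0 /\ sq None (g (Some j')) = 0.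
  move=> j'i1; have [j [ji1 jj']] := third_index i1 j'.
  have j'j : j' != j by rewrite eq_sym.
  have := halfline_surgery l0 hG m1 x10 uM ji1 j'i1 j'j; rewrite -/M => hs.
  have h1 := sq_ge0 (Some l) (g None); have h2 := sq_ge0 None (g (Some j')).
  have h3 : p^-1 * (Pf p (Some l) (u None) - M `^ (p - 2) * sq (Some l) (u None)) <= 0.
    by rewrite pmulr_rle0// subr_le0.
  by split; lra.
have [j [ji1 _]] := third_index i1 i1.
have uz i : i != i1 -> forall x : R, 0 <= x -> u (Some i) x = 0.
  by move=> ii1; apply: sq_const0 (hu (Some i)) _; have [] := key i ii1.
have v0 : u None 0 = 0 by rewrite -(u0 j) uz.
have Tz x : dom (Some l) x -> u None x = 0.
  move=> dx; have := H1_holder0 (hu None) dx; rewrite v0 subr0.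
  have [-> _] := key j ji1; rewrite mulr0 => h; apply/eqP.
  by rewrite -sqrf_eq0 eq_le h sqr_ge0.
have sqz b (v : R -> R) : (forall x, dom b x -> v x = 0) -> sq b v = 0 /\ Pf p b v = 0.
  move=> vz; split.
    by rewrite -[RHS](sq0 b); apply: eq_rint => x /vz ->.
  rewrite /Pf -[RHS](sq0 b); apply: eq_rint => x /vz ->.
  by rewrite normr0 powR0 ?expr0n// lt0r_neq0// p_gt0.
have [qT PT0] := sqz (Some l) (u None) Tz.
have si (F : 'I_N -> R) : (forall i, i != i1 -> F i = 0) -> \sum_i F i = F i1.
  by move=> Fz; rewrite (bigD1 i1)//= big1 ?addr0.
have qi i : i != i1 -> sq None (u (Some i)) = 0 /\ Pf p None (u (Some i)) = 0.
  by move=> ii1; apply: sqz => x /dom_ge0; exact: uz.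
rewrite Kin_split si ?qT ?add0r in m1; last by move=> i /qi[].
have := ER_not_attained (hu (Some i1)) _ m1; rewrite u0 v0 => /(_ erefl).
rewrite Kin_split Pot_split (proj1 (key j ji1)) PT0 !add0r in hE.
rewrite si in hE; last by move=> i ii1; have [] := key i ii1.
rewrite si in hE; last by move=> i /qi[].
by rewrite ltNge hE.
Qed.

(** An energy at most [ER < 0] requires a potential of at least [- p ER], whereas the potential is
    at most [m^(p-2)] times the mass. *)
Lemma max_lower_bound l u g (m : R) : 0 <= l -> H1_graph l u g -> Kin l u <= 1 ->
  En p (Kin l g) (Pot p l u) <= ER p ->
  (forall e x, dom (eb l e) x -> `|u e x| <= m) -> p * - ER p <= m `^ (p - 2).
Proof.
move=> l0 hG m1 hE um; have h := Pot_ub p2 l0 hG um.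
have [q0 k0 P0] := gconf_ge0 (H1_graph_conf p hG).
have P1 : Pot p l u <= m `^ (p - 2) by apply: (le_trans h); rewrite ler_piMr// powR_ge0.
apply: le_trans P1; rewrite mulrC -ler_pdivlMr ?p_gt0// mulrC.
by move: hE; rewrite /En; lra.
Qed.

(** On a short terminal edge mass and potential are of order [l], so the surgery can fail to gain
    only by that much: the kinetic integrals of the terminal edge and of a third half-line are of
    order [l]. The latter makes the value at the vertex small, the former keeps the maximum near
    that value, and the maximum is at least [m0]. *)
Lemma terminal_edge_lower_bound : exists2 L0 : R, 0 < L0 & forall l u g, 0 <= l ->
  H1_graph l u g -> Kin l u <= 1 -> En p (Kin l g) (Pot p l u) <= ER p -> L0 <= l.
Proof.
have [B [B1 hB]] := energy_bounds p2 p6 N0.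
pose c0 : R := p * - ER p.
have c00 : 0 < c0.
  by have := ER0; rewrite /c0 -oppr_gt0 => h; rewrite mulr_gt0// p_gt0.
pose m0 : R := c0 `^ (p - 2)^-1.
have m00 : 0 < m0 by exact: powR_gt0.
pose C : R := B `^ (p - 2) * B ^+ 2.
have BB : 0 < B by lra.
have C0 : 0 < C by rewrite mulr_gt0// ?powR_gt0// exprn_gt0.
(* Makes the mass term [2 / s] of [seg_sup] equal to [m0^2 / 8]; in the end
   [m0^2 <= m0^2 / 4 + A l]. *)
pose s : R := 16 / m0 ^+ 2.
have m02 : 0 < m0 ^+ 2 by rewrite exprn_gt0.
have s0 : 0 < s by rewrite divr_gt0.
have ss : s * m0 ^+ 2 = 16 by rewrite /s divfK// lt0r_neq0.
pose A : R := 4 * s * C + 2 * C.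
have A0 : 0 < A by have := mulr_gt0 s0 C0; rewrite /A; lra.
pose L0 : R := Num.min 1 (m0 ^+ 2 / 2 / A).
exists L0; first by rewrite lt_min ltr01 !divr_gt0.
move=> l u g l0 hG m1 hE; have [hu u0] := (H1_graphP _ _ _).1 hG.
have [l1|l1] := leP 1 l; first by rewrite ge_min l1.
have hE0 : En p (Kin l g) (Pot p l u) <= 0 by apply: le_trans hE (ltW ER0).
have [_ _ uB] := hB _ _ _ l0 hG m1 hE0.
have [xm [/andP[xm0 xml] hxm]] := max_on_terminal_edge l0 hG m1 hE.
have := max_lower_bound l0 hG m1 hE hxm; rewrite -/c0; set m : R := `|u None xm| => cm.
have mm : m0 <= m.
  have -> : m = (m `^ (p - 2)) `^ (p - 2)^-1.
    by rewrite -powRrM divff ?powRr1 ?normr_ge0// lt0r_neq0// p_gt2.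
  by apply: ge0_ler_powR; rewrite ?nnegrE ?powR_ge0 ?invr_ge0 ?(ltW (p_gt2 p2)) ?(ltW c00).
have [i1 [x1 [x10 uM]]] := halfline_max hG.
have [j [ji1 _]] := third_index i1 i1.
have [j' [j'i1 j'j]] := third_index i1 j.
have := halfline_surgery l0 hG m1 x10 uM ji1 j'i1 j'j; set M : R := `|_| => hs.
have qT : sq (Some l) (u None) <= B ^+ 2 * l.
  rewrite -(rint_cst _ l0); apply: le_rint => //; [exact: L2_sq (H1_L2 (hu None))|exact: intg_cst|].
  move=> x xl; rewrite -[leLHS]real_normK ?num_real// lerXn2r ?nnegrE ?normr_ge0 ?(ltW BB)//.
  exact: uB.
have PT : Pf p (Some l) (u None) <= C * l.
  apply: (le_trans (@Pf_ub _ _ p2 (Some l) _ B (H1_L2 (hu None)) (uB None))).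
  by rewrite /C -mulrA ler_wpM2l// powR_ge0.
have h1 := sq_ge0 (Some l) (g None); have h2 := sq_ge0 None (g (Some j')).
have h3 : 0 <= M `^ (p - 2) * sq (Some l) (u None) by rewrite mulr_ge0 ?powR_ge0 ?sq_ge0.
have h4 : p^-1 * (Pf p (Some l) (u None) - M `^ (p - 2) * sq (Some l) (u None)) <= 2^-1 * (C * l).
  apply: (@le_trans _ _ (p^-1 * (C * l))); first by rewrite ler_pM2l//; lra.
  by apply: ler_wpM2r; [rewrite mulr_ge0// ltW|rewrite lef_pV2 ?posrE ?(p_gt0 p2)// ltW].
have kT : sq (Some l) (g None) <= C * l by lra.
have kj : sq None (g (Some j')) <= C * l by lra.
have he := seg_sup (seg_H1T p (hu (Some j'))) s0; rewrite u0 in he.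
have hq : sq None (u (Some j')) <= 1.
  apply: le_trans m1; rewrite Kin_split (bigD1 j')//=.
  have := sq_ge0 (Some l) (u None).
  have : 0 <= \sum_(i < N | i != j') sq None (u (Some i)) by apply: sumr_ge0 => i _; exact: sq_ge0.
  lra.
have he2 : u None 0 ^+ 2 <= 2 / s + 2 * s * (C * l).
  apply: (le_trans he); apply: lerD; last by rewrite ler_wpM2l// mulr_ge0// ltW.
  by rewrite ler_pM2r ?invr_gt0//; lra.
have dxm : dom (Some l) xm by rewrite domP xm0.
have hh := H1_holder0 (hu None) dxm.
have hh2 : (u None xm - u None 0) ^+ 2 <= C * l.
  apply: (le_trans hh); apply: (@le_trans _ _ (1 * (C * l))); last by rewrite mul1r.
  by apply: ler_pM => //; lra.
have hm : m ^+ 2 <= 2 * u None 0 ^+ 2 + 2 * (u None xm - u None 0) ^+ 2.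
  rewrite /m real_normK ?num_real//; have := sqr_ge0 (u None xm - 2 * u None 0).
  by set a := u None xm; set b := u None 0; nra.
have mm2 : m0 ^+ 2 <= m ^+ 2 by rewrite lerXn2r// nnegrE ltW// (lt_le_trans m00).
have s4 : 4 / s = m0 ^+ 2 / 4 by rewrite /s; field; rewrite lt0r_neq0.
rewrite ge_min; apply/orP; right.
rewrite ler_pdivrMr// /A.
lra.
Qed.

End surgery.

(** * Lengthening the terminal edge *)

Section loops.
Context {R : realType}.
Implicit Types (v h : R -> R).

Lemma sq_increment_lb b v h (x x' c : R) : H1 b v h -> 0 <= x -> x <= x' -> dom b x' -> 0 <= c ->
  (forall y : R, x <= y -> y <= x' -> c <= `|v y|) ->
  c ^+ 2 * (x' - x) <= sq (Some x') v - sq (Some x) v.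
Proof.
move=> hv x0 xx' dx' c0 hc; have hx' := H1_sub dx' hv.
have dx : dom (Some x') x by rewrite domP x0.
have [_ L ->] := L2_cut dx (H1_L2 hx').
rewrite [sq (Some x) v + _]addrC addrK -(rint_cst _ (_ : 0 <= x' - x)) ?subr_ge0//.
apply: le_rint => //; [exact: intg_cst|exact: (L2_sq L)|].
move=> y /=; rewrite in_itv /= => /andP[y0 yx].
rewrite -[leRHS]real_normK ?num_real// lerXn2r ?nnegrE ?normr_ge0//.
by apply: hc; lra.
Qed.

Lemma sq_increment_ub b v h (x x' M : R) : H1 b v h -> 0 <= x -> x <= x' -> dom b x' ->
  (forall y : R, x <= y -> y <= x' -> `|v y| <= M) ->
  sq (Some x') v - sq (Some x) v <= M ^+ 2 * (x' - x).
Proof.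
move=> hv x0 xx' dx' hc; have hx' := H1_sub dx' hv.
have dx : dom (Some x') x by rewrite domP x0.
have [_ L ->] := L2_cut dx (H1_L2 hx').
rewrite [sq (Some x) v + _]addrC addrK -(rint_cst _ (_ : 0 <= x' - x)) ?subr_ge0//.
apply: le_rint => //; [exact: (L2_sq L)|exact: intg_cst|].
move=> y /=; rewrite in_itv /= => /andP[y0 yx].
have vM : `|v (x + y)| <= M by apply: hc; lra.
rewrite -[leLHS]real_normK ?num_real// lerXn2r ?nnegrE ?normr_ge0//.
exact: le_trans (normr_ge0 _) vM.
Qed.

(* Near an interior maximum, [v] takes equal values at the two ends of arbitrarily
   short intervals, which can therefore be excised. *)
Lemma small_loop v h (z rho : R) : H1 None v h -> 0 < z -> v z != 0 ->
  (forall x : R, 0 <= x -> `|v x| <= `|v z|) -> 0 < rho ->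
  exists x x' : R, [/\ 0 <= x, x <= x', x' - x <= rho, v x = v x' &
    0 < sq (Some x') v - sq (Some x) v].
Proof.
move=> hv z0 vz0 vM rho0.
wlog vz : v h hv vz0 vM / 0 < v z.
  move=> H; move: (vz0); rewrite neq_lt => /orP[vn|]; last exact: H hv vz0 vM.
  have hv' := H1Z (-1) hv.
  have [|||x [x' [x0 xx' xr vv]]] := H _ _ hv'.
  - by rewrite mulN1r oppr_eq0.
  - by move=> x; rewrite !mulN1r !normrN; exact: vM.
  - by rewrite mulN1r oppr_gt0.
  move: vv; rewrite !mulN1r => /oppr_inj vv.
  have dx' : dom None x' by rewrite domP (le_trans x0).
  have dx : dom None x by rewrite domP x0.
  have [_ ->] := L2Z (-1) (H1_L2 (H1_sub dx' hv)).
  have [_ ->] := L2Z (-1) (H1_L2 (H1_sub dx hv)).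
  by rewrite sqrrN expr1n !mul1r => s; exists x, x'.
pose K := sq None h; have K0 : 0 <= K by exact: sq_ge0.
(* Within distance [d] of [z], [|v|] stays above [v z / 2], so an excised interval of length at
   least [d] carries positive mass. *)
pose d : R := Num.min (rho / 2) (Num.min z (v z ^+ 2 / (4 * (K + 1)))).
have v2 : 0 < v z ^+ 2 by rewrite exprn_gt0.
have K1 : 0 < 4 * (K + 1) by lra.
have d0 : 0 < d by rewrite !lt_min divr_gt0//= z0 divr_gt0.
have dr : d <= rho / 2 by rewrite ge_min lexx.
have dz : d <= z by rewrite !ge_min lexx orbT.
have dK : d * (4 * (K + 1)) <= v z ^+ 2.
  by rewrite -ler_pdivlMr// !ge_min lexx !orbT.
have dom0 (y : R) : 0 <= y -> dom None y by move=> y0; rewrite domP y0.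
have vle (y : R) : 0 <= y -> v y <= v z.
  by move=> y0; rewrite -[leRHS]gtr0_norm// (le_trans (ler_norm _))// vM.
have vge (y : R) : z - d <= y -> y <= z + d -> v z / 2 <= `|v y|.
  move=> y1 y2; have y0 : 0 <= y by lra.
  have := H1_holderN hv (dom0 _ (ltW z0)) (dom0 _ y0).
  have ad : `|y - z| <= d by rewrite ler_norml; lra.
  rewrite -/K => h1.
  have h2 : `|y - z| * K <= d * K by rewrite ler_wpM2r.
  have h3 : (v y - v z) ^+ 2 <= (v z / 2) ^+ 2 by lra.
  have h4 : v z - v y <= v z / 2.
    have vp : 0 <= v z / 2 by lra.
    have h5 : `|v y - v z| <= v z / 2.
      by rewrite -(@ler_sqr _ `|_|) ?nnegrE// real_normK ?num_real.
    by have := ler_norm (v z - v y); rewrite distrC; lra.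
  by have := ler_norm (v y); lra.
have fin (x x' : R) : z - d <= x -> x <= x' -> x' <= z + d -> d <= x' - x -> v x = v x' ->
    exists x x' : R, [/\ 0 <= x, x <= x', x' - x <= rho, v x = v x' &
    0 < sq (Some x') v - sq (Some x) v].
  move=> x1 xx' x2 dd vv; exists x, x'; split=> //; try lra.
  have x0 : 0 <= x by lra.
  have vp : 0 <= v z / 2 by lra.
  have := sq_increment_lb hv x0 xx' (dom0 _ (le_trans x0 xx')) vp.
  have hlb (y : R) : x <= y -> y <= x' -> v z / 2 <= `|v y| by move=> ? ?; apply: vge; lra.
  move=> /(_ hlb); apply: lt_le_trans; rewrite mulr_gt0 ?exprn_gt0//; lra.
have z1 : 0 <= z - d by lra.
have z2 : 0 <= z + d by lra.
(* The larger of the values at [z - d] and [z + d] is taken again on the other side of [z], by the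
   intermediate value theorem. *)
have [AB|BA] := leP (v (z - d)) (v (z + d)).
  have zz : 0 <= z - d <= z by rewrite z1; lra.
  have [|y /andP[y1 y2] vy] := H1_ivt (v := v (z + d)) hv zz (dom0 _ (ltW z0)).
    by rewrite AB vle.
  by apply: (fin y (z + d)) => //; lra.
have zz : 0 <= z <= z + d by rewrite ltW//=; lra.
have [|y /andP[y1 y2] vy] := H1_ivt (v := v (z - d)) hv zz (dom0 _ z2).
  by rewrite (ltW BA) vle// andbT orbC.
by apply: (fin (z - d) y) => //; lra.
Qed.

End loops.

Section extension.
Context {R : realType} (p : R) (p2 : 2 < p) (p6 : p < 6) (N : nat) (N3 : (2 < N)%N).
Implicit Types (l : R) (u g : option 'I_N -> R -> R) (i j : 'I_N).

Let N0 : (0 < N)%N. Proof. by case: N N3. Qed.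
Let ER0 := ER_lt0 p2 p6 N0.
Let pi0 : 0 < p^-1. Proof. by rewrite invr_gt0 p_gt0. Qed.

(** The piece of height [v x] and length [r / v(x)^2] adds mass [r] at no kinetic cost. At a maximum
    of [|v|] this is the most potential that mass [r] can carry. *)
Lemma insert_constant b v h (x r : R) : okb b -> H1 b v h -> dom b x -> 0 <= r -> v x != 0 ->
  seg p (oadd (r / v x ^+ 2) b) (v 0) (if b is Some a then v a else 0)
    (sq b v + r) (sq b h) (Pf p b v + `|v x| `^ (p - 2) * r).
Proof.
move=> ob hv dx r0 vx0.
have n0 : 0 < `|v x| by rewrite normr_gt0.
have d0 : 0 <= r / v x ^+ 2 by rewrite divr_ge0 ?sqr_ge0.
have v2 : v x ^+ 2 != 0 by rewrite sqrf_eq0.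
have hh := seg_cat p2 (seg_sub p dx hv) (seg_cat p2 (seg_cst p (v x) d0) (seg_cut p2 ob dx hv)).
have e : oadd x (oadd (r / v x ^+ 2) (osub b x)) = oadd (r / v x ^+ 2) b.
  by case: (b) => //= c; congr Some; ring.
rewrite e in hh; move: hh; rewrite [v x ^+ 2 * _]mulrC divfK//.
rewrite (powR_split p2 (ltW n0)) real_normK ?num_real//.
rewrite -[_ * v x ^+ 2 * _]mulrA [v x ^+ 2 * _]mulrC divfK//.
have -> : sq (Some x) v + (r + (sq b v - sq (Some x) v)) = sq b v + r by ring.
have -> : sq (Some x) h + (0 + (sq b h - sq (Some x) h)) = sq b h by ring.
by have -> : Pf p (Some x) v + (`|v x| `^ (p - 2) * r + (Pf p b v - Pf p (Some x) v)) =
  Pf p b v + `|v x| `^ (p - 2) * r by ring.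
Qed.

Lemma Pf_increment b v h (x x' M : R) : okb b -> H1 b v h -> 0 <= x -> x <= x' -> dom b x' ->
  (forall y, dom b y -> `|v y| <= M) ->
  Pf p (Some x') v - Pf p (Some x) v <= M `^ (p - 2) * (sq (Some x') v - sq (Some x) v).
Proof.
move=> ob hv x0 xx' dx' vM; have hx' := H1_sub dx' hv.
have dx : dom (Some x') x by rewrite domP x0.
have ox' : okb (Some x') by rewrite /= (le_trans x0).
have [_ L ->] := L2_cut dx (H1_L2 hx').
rewrite (Pf_cut p2 ox' dx hx') [sq (Some x) v + _]addrC addrK [Pf p (Some x) v + _]addrC addrK.
apply: Pf_ub => // y; rewrite domP => /andP[y0 yx]; apply: vM.
by apply: dom_le dx'; rewrite addr_ge0//=; lra.
Qed.

Section ext.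
Variables (l : R) (u g : option 'I_N -> R -> R) (xm : R).
Hypotheses (l0 : 0 <= l) (hG : H1_graph l u g) (xml : 0 <= xm <= l)
  (um : forall e x, dom (eb l e) x -> `|u e x| <= `|u None xm|)
  (m0 : u None xm != 0).

Let hu := (proj1 ((H1_graphP l u g).1 hG)).
Let u0 := (proj2 ((H1_graphP l u g).1 hG)).
Let dxm : dom (Some l) xm. Proof. by rewrite domP; have /andP[-> ->] := xml. Qed.
Let m2 : 0 < u None xm ^+ 2. Proof. by rewrite lt0r sqrf_eq0 m0 sqr_ge0. Qed.

(** The part of half-line [i] over [[x, x']] is excised, its equal end values being glued, and its
    mass [r] is inserted at the maximum. The excised potential is at most [M^(p-2) r], exactly what
    the insertion restores, and [r <= M^2 (x' - x)] bounds the added length. *)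
Lemma extend_loop i (x x' : R) : 0 <= x -> x <= x' -> u (Some i) x = u (Some i) x' ->
  0 < sq (Some x') (u (Some i)) - sq (Some x) (u (Some i)) ->
  exists l' q k P, [/\ l < l' <= l + (x' - x), gconf p N l' q k P, q <= Kin l u &
    En p k P <= En p (Kin l g) (Pot p l u)].
Proof.
move=> x0 xx' uxx'; set r := _ - _ => r0.
pose F (f : 'I_N -> R) (c : R) (j : 'I_N) : R := if j == i then f i - c else f j.
have FE f c : \sum_j F f c j = \sum_j f j - c.
  rewrite (bigD1 i)//= [in RHS](bigD1 i)//= /F eqxx addrAC.
  by congr (_ - _); congr (_ + _); apply: eq_bigr => j /negbTE ->.
have dx : dom None x by rewrite domP x0.
have dx' : dom None x' by rewrite domP (le_trans x0).
have hT := insert_constant (l0 : okb (Some l)) (hu None) dxm (ltW r0) m0.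
have hc := @seg_cut _ _ p2 None _ _ _ isT dx' (hu (Some i)); rewrite -uxx' in hc.
have hi := seg_cat p2 (seg_sub p dx (hu (Some i))) hc; rewrite u0 in hi.
pose ck := sq (Some x') (g (Some i)) - sq (Some x) (g (Some i)).
pose cP := Pf p (Some x') (u (Some i)) - Pf p (Some x) (u (Some i)).
have uM y : dom None y -> `|u (Some i) y| <= `|u None xm| by exact: (um (e := Some i)).
have hcP : cP <= `|u None xm| `^ (p - 2) * r.
  exact: (@Pf_increment None _ _ _ _ _ isT (hu (Some i)) x0 xx' dx' uM).
have ck0 : 0 <= ck.
  rewrite subr_ge0; apply: (@sq_sub _ (Some x')); first by rewrite domP x0.
  exact: H1_L2d (H1_sub dx' (hu (Some i))).
have rub : r <= u None xm ^+ 2 * (x' - x).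
  rewrite -[u None xm ^+ 2]real_normK ?num_real//.
  apply: (sq_increment_ub (hu (Some i)) x0 xx' dx') => y y0 _; apply: uM.
  by rewrite domP (le_trans x0).
have ht j : seg p None (u None 0) 0 (F (fun j => sq None (u (Some j))) r j)
    (F (fun j => sq None (g (Some j))) ck j) (F (fun j => Pf p None (u (Some j))) cP j).
  have [->|ji] := eqVneq j i; last first.
    by have := seg_H1T p (hu (Some j)); rewrite u0 /F (negbTE ji).
  rewrite /F eqxx.
  have e (a b c : R) : a + (b - c) = b - (c - a) by ring.
  by move: hi; rewrite !e.
have := gconf_intro hT ht; rewrite !FE => hg.
do 4 eexists; split; [|exact: hg| |].
- rewrite /= addrC ltrDl lerD2l divr_gt0//= ler_pdivrMr// mulrC; exact: rub.
- by rewrite Kin_split; lra.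
- rewrite Kin_split Pot_split /En.
  have := ler_wpM2l (ltW pi0) hcP; lra.
Qed.

(** The vertex is moved to the points at height [t]: the initial piece of half-line [i0], reversed,
    is prepended to the terminal edge, and the other initial pieces are removed, their mass being
    inserted at the maximum. The condition [0 < a i0] makes the lengthening strict. *)
Lemma extend_cut (i0 : 'I_N) (t : R) (a : 'I_N -> R) : (forall i, 0 <= a i) -> 0 < a i0 ->
  (forall i, u (Some i) (a i) = t) ->
  exists l' q k P, [/\ l < l' <= l + \sum_i a i, gconf p N l' q k P, q <= Kin l u &
    En p k P <= En p (Kin l g) (Pot p l u)].
Proof.
move=> a0 ai0 ua.
have dN (x : R) : 0 <= x -> dom None x by move=> x0; rewrite domP x0.
have uM i y : dom None y -> `|u (Some i) y| <= `|u None xm| by exact: (um (e := Some i)).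
pose S (f : 'I_N -> R) := \sum_(i | i != i0) f i.
have SE f : \sum_i f i = f i0 + S f by rewrite (bigD1 i0).
pose r := S (fun i => sq (Some (a i)) (u (Some i))).
have r0 : 0 <= r by apply: sumr_ge0 => i _; exact: sq_ge0.
have da i : dom (Some (a i)) 0 by rewrite domP lexx a0.
have z0 (f : R -> R) : rint `[0, 0] f = 0.
  by rewrite /rint set_itv1 Rintegral_set1.
have rub : r <= u None xm ^+ 2 * S a.
  rewrite /r /S mulr_sumr; apply: ler_sum => i _.
  have := @sq_increment_ub _ None _ _ 0 (a i) `|u None xm| (hu (Some i)) (lexx 0) (a0 i) (dN _ (a0 i)).
  rewrite /sq z0 !subr0 real_normK ?num_real//; apply => y y0 _; exact: uM (dN _ y0).
have hP i : Pf p (Some (a i)) (u (Some i)) <= `|u None xm| `^ (p - 2) * sq (Some (a i)) (u (Some i)).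
  have := @Pf_increment None _ _ 0 (a i) _ isT (hu (Some i)) (lexx 0) (a0 i) (dN _ (a0 i)) (uM i).
  by rewrite /sq /Pf !z0 !subr0.
have SP : S (fun i => Pf p (Some (a i)) (u (Some i))) <= `|u None xm| `^ (p - 2) * r.
  by rewrite /r /S mulr_sumr; apply: ler_sum => i _.
have Sk : 0 <= S (fun i => sq (Some (a i)) (g (Some i))).
  by apply: sumr_ge0 => i _; exact: sq_ge0.
have h0 := seg_rev p2 (seg_sub p (dN _ (a0 i0)) (hu (Some i0))); rewrite u0 ua in h0.
have hT := seg_cat p2 h0 (insert_constant (l0 : okb (Some l)) (hu None) dxm r0 m0).
have ht i : seg p None t 0 (sq None (u (Some i)) - sq (Some (a i)) (u (Some i)))
    (sq None (g (Some i)) - sq (Some (a i)) (g (Some i)))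
    (Pf p None (u (Some i)) - Pf p (Some (a i)) (u (Some i))).
  by have := @seg_cut _ _ p2 None _ _ _ isT (dN _ (a0 i)) (hu (Some i)); rewrite ua.
have := gconf_intro hT ht; rewrite !sumrB => hg.
do 4 eexists; split; [|exact: hg| |].
- rewrite /= [\sum_i _]SE; have : 0 <= r / u None xm ^+ 2 by rewrite divr_ge0// ltW.
  have : r / u None xm ^+ 2 <= S a by rewrite ler_pdivrMr// mulrC.
  by move=> h1 h2; apply/andP; split; lra.
- rewrite Kin_split [\sum_i sq (Some (a i)) _]SE -/r; lra.
- rewrite Kin_split Pot_split /En [\sum_i sq (Some (a i)) _]SE [\sum_i Pf p (Some (a i)) _]SE.
  have := ler_wpM2l (ltW pi0) SP; lra.
Qed.

End ext.

(** Either a half-line contains a loop to excise, or [|u|] is at most its vertex value on all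
    half-lines and these can be cut at a common height close to the vertex. *)
Lemma extend l u g (eta : R) : 0 <= l -> H1_graph l u g -> Kin l u <= 1 ->
  En p (Kin l g) (Pot p l u) <= ER p -> 0 < eta ->
  exists l' q k P, [/\ l < l' <= l + eta, gconf p N l' q k P, q <= 1 & En p k P <= ER p].
Proof.
move=> l0 hG m1 hE eta0.
wlog eps0 : u g hG m1 hE / 0 <= u None 0.
  move=> H; have [|en] := leP 0 (u None 0); first exact: H hG m1 hE.
  have [hu u0] := (H1_graphP _ _ _).1 hG.
  have K f : (forall e, L2 (dom (eb l e)) (f e)) -> Kin l (fun e x => -1 * f e x) = Kin l f.
    move=> Lf; apply: eq_bigr => e _; have [_ ->] := L2Z (-1) (Lf e).
    by rewrite sqrrN expr1n mul1r.
  have P : Pot p l (fun e x => -1 * u e x) = Pot p l u.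
    by apply: eq_bigr => e _; apply: eq_rint => x _; rewrite mulN1r normrN.
  have Ku := K N u (fun e => H1_L2 (hu e)); have Kg := K N g (fun e => H1_L2d (hu e)).
  apply: (H (fun e x => -1 * u e x) (fun e x => -1 * g e x)).
  - by apply/H1_graphP; split=> [e|i]; [exact: H1Z (hu e)|rewrite u0].
  - by rewrite Ku.
  - by rewrite P Kg.
  - by rewrite mulN1r oppr_ge0 ltW.
have [hu u0] := (H1_graphP _ _ _).1 hG.
have [xm [xml um]] := max_on_terminal_edge p2 p6 N3 l0 hG m1 hE.
have m0 : u None xm != 0.
  rewrite -normr_eq0; apply/eqP => mz; rewrite mz in um.
  have := max_lower_bound p2 l0 hG m1 hE um.
  rewrite powR0 ?lt0r_neq0 ?p_gt2// => h.
  have : 0 < p * - ER p by rewrite mulr_gt0 ?(p_gt0 p2)// oppr_gt0.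
  lra.
have concl (d : R) : d <= eta -> (exists l' q k P, [/\ l < l' <= l + d, gconf p N l' q k P,
    q <= Kin l u & En p k P <= En p (Kin l g) (Pot p l u)]) ->
  exists l' q k P, [/\ l < l' <= l + eta, gconf p N l' q k P, q <= 1 & En p k P <= ER p].
  move=> de [l' [q [k [P [/andP[h1 h2] h3 h4 h5]]]]]; exists l', q, k, P; split=> //; try lra.
have Np : 0 < N%:R :> R by rewrite ltr0n.
pose rho : R := eta / N%:R.
have rho0 : 0 < rho by rewrite divr_gt0.
have rhoN : rho * N%:R = eta by rewrite /rho divfK// lt0r_neq0.
have rhoe : rho <= eta by rewrite ler_pdivrMr// ler_peMr ?(ltW eta0)// ler1n.
have suma (a : 'I_N -> R) : (forall i, a i <= rho) -> \sum_i a i <= eta.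
  move=> h; apply: (@le_trans _ _ (\sum_(i < N) rho)); first by apply: ler_sum => i _.
  by rewrite sumr_const card_ord -[rho *+ N]mulr_natr rhoN.
have [[i [z [z0 vz vM]]]|noloop] := pselect (exists i, exists z : R, [/\ 0 < z, u (Some i) z != 0 &
    forall x : R, 0 <= x -> `|u (Some i) x| <= `|u (Some i) z|]).
  have [x [x' [x0 xx' xr uxx r0]]] := small_loop (hu (Some i)) z0 vz vM rho0.
  apply: (concl (x' - x)); first exact: le_trans rhoe.
  exact: (extend_loop l0 hG xml um m0 x0 xx' uxx r0).
have ueps i (x : R) : 0 <= x -> `|u (Some i) x| <= u None 0.
  move=> x0; have [z z0 zm] := tail_max p2 (hu (Some i)).
  apply: (le_trans (zm x x0)); have [->|uz] := eqVneq (u (Some i) z) 0.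
    by rewrite normr0.
  move: z0; rewrite le_eqVlt => /predU1P[<-|z0]; first by rewrite u0 ger0_norm.
  by exfalso; apply: noloop; exists i, z.
pose i0 : 'I_N := Ordinal N0.
(* With vertex value 0, [u] vanishes on all half-lines and any cut has common height 0. *)
move: eps0; rewrite le_eqVlt => /predU1P[e0|eps0].
  apply: (concl (\sum_(i < N) rho)); first exact: suma.
  apply: (extend_cut l0 hG xml um m0 (i0 := i0) (t := 0)) => // i; first exact: ltW.
  by apply/eqP; rewrite -normr_le0 e0; exact: ueps (ltW rho0).
have dN (x : R) : 0 <= x -> dom None x by move=> x0; rewrite domP x0.
have hex i : exists w : R, 0 <= w <= rho /\ forall x : R, 0 <= x <= rho -> u (Some i) w <= u (Some i) x.
  by have [w ? ?] := H1_min (hu (Some i)) (dN _ (ltW rho0)); exists w.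
have [w hw] := choice hex.
(* A half-line whose minimum over [[0, rho]] reaches the vertex value is constant there, and
   [[0, rho]] itself is a loop. *)
have [[i hi]|hall] := pselect (exists i, u None 0 <= u (Some i) (w i)).
  have uc (x : R) : 0 <= x -> x <= rho -> u (Some i) x = u None 0.
    move=> x0 xr; apply/le_anti; rewrite (le_trans (ler_norm _) (ueps i x x0)) /=.
    by apply: (le_trans hi); have [_] := hw i; apply; rewrite x0.
  apply: (concl (rho - 0)); first by rewrite subr0.
  apply: (extend_loop l0 hG xml um m0 (i := i) (x := 0) (x' := rho)) => //; first exact: ltW.
    by rewrite !uc// ltW.
  have := sq_increment_lb (hu (Some i)) (lexx 0) (ltW rho0) (dN _ (ltW rho0)) (ltW eps0).
  have hlb (y : R) : 0 <= y -> y <= rho -> u None 0 <= `|u (Some i) y|.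
    by move=> y0 yr; rewrite uc// ler_norm.
  by move=> /(_ hlb); apply: lt_le_trans; rewrite subr0 mulr_gt0// exprn_gt0.
have hlt i : u (Some i) (w i) < u None 0.
  by rewrite ltNge; apply/negP => h; apply: hall; exists i.
(* The height [t] is the largest of the minima over [[0, rho]]. It lies below the vertex value and
   is at least every other minimum, so each half-line takes the value [t] on [[0, rho]]. *)
have [i1 _ hi1] := @Order.TotalTheory.arg_maxP _ _ _ i0 xpredT (fun i => u (Some i) (w i)) isT.
pose t := u (Some i1) (w i1).
have hex2 i : exists a : R, 0 <= a <= rho /\ u (Some i) a = t.
  have [/andP[w0 wr] _] := hw i.
  have := @H1_ivt _ None _ _ 0 (w i) t (hu (Some i)); rewrite lexx w0 => /(_ isT (dN _ w0)).
  move=> [|a /andP[a0 aw] ua].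
    by apply/orP; right; rewrite /t u0 (ltW (hlt i1)) andbT; exact: hi1.
  by exists a; rewrite a0 (le_trans aw).
have [a ha] := choice hex2.
apply: (concl (\sum_i a i)).
  by apply: suma => i; have [/andP[]] := ha i.
apply: (extend_cut l0 hG xml um m0 (i0 := i0) (t := t)).
- by move=> i; have [/andP[]] := ha i.
- have [/andP[a0 _] uat] := ha i0; rewrite lt_neqAle a0 andbT; apply/eqP => az.
  by move: uat; rewrite -az u0 => e; have := hlt i1; rewrite -/t -e ltxx.
- by move=> i; have [] := ha i.
Qed.

(* Cut a nearly optimal function on the half-line at its maximum, replace the side
   with more kinetic energy by a constant piece of the same mass, and put the
   result on the terminal edge. *)
Lemma exists_long_edge : exists2 L : R, 0 <= L & gE p N L < ER p.
Proof.
have [B [B1 hB]] := energy_bounds p2 p6 N0.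
have ZC := ztail_class p2 p6 N0.
pose c : R := p * (- ER p / 2).
have c0 : 0 < c by rewrite mulr_gt0 ?(p_gt0 p2)// divr_gt0// oppr_gt0.
pose m0 : R := c `^ (p - 2)^-1.
have m00 : 0 < m0 by exact: powR_gt0.
have m02 : 0 < m0 ^+ 2 by rewrite exprn_gt0.
pose s : R := 4 / m0 ^+ 2.
have s0 : 0 < s by rewrite divr_gt0.
(* Lower bound for the kinetic integral of a nearly optimal function: its maximum is at least [m0],
   and [seg_sup] with [s = 4 / m0^2] gives [m0^2 <= m0^2 / 2 + 2 s k]. *)
pose kap : R := m0 ^+ 2 / (4 * s).
have kap0 : 0 < kap by rewrite divr_gt0// mulr_gt0.
pose C2 : R := B + 1 + (2 + 2 * B) `^ (p - 2).
have C20 : 0 < C2 by have := powR_ge0 (2 + 2 * B) (p - 2); rewrite /C2; lra.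
pose D : R := 2 + 3 * (p^-1 * C2) - ER p.
have D0 : 0 < D by have := mulr_gt0 pi0 C20; have := ER0; rewrite /D; lra.
(* So small that the kinetic energy saved, a quarter of [k] and hence at least [kap / 4], outweighs
   the errors, which are at most [e D]. *)
pose e : R := Num.min (Num.min 1 (- ER p / 2)) (kap / (8 * D)).
have e0 : 0 < e by rewrite !lt_min ltr01 !divr_gt0// ?oppr_gt0// mulr_gt0.
have e1 : e <= 1 by rewrite !ge_min lexx.
have eE : e <= - ER p / 2 by rewrite !ge_min lexx orbT.
have eD : e * (8 * D) <= kap by rewrite -ler_pdivlMr ?mulr_gt0// ge_min lexx orbT.
have [q [k [P [hz q1 hE]]]] := infE_approx ZC e0; rewrite -/(ER p) in hE.
have EN : En p k P <= ER p / 2 by lra.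
have [Kb Pb] : k <= B /\ P <= B.
  have [w [w' [hG [wq wk wP]]]] := ztail_gconf p2 N0 ler01 hz.
  have [||h1 h2 _] := hB _ _ _ ler01 hG; first by rewrite wq.
    by rewrite wk wP; have := ER0; lra.
  by rewrite -wk -wP.
have [_ [v [h [hv v0 _ [vq vk vP]]]]] := hz.
have q0 : 0 <= q by rewrite -vq sq_ge0.
have k0 : 0 <= k by rewrite -vk sq_ge0.
have P0 : 0 <= P by rewrite -vP Pf_ge0.
have [x1 x10 vM] := tail_max p2 hv.
have dx1 : dom None x1 by rewrite domP x10.
set m : R := `|v x1| in vM.
have vM' y : dom None y -> `|v y| <= m by move=> /dom_ge0; exact: vM.
have Pm : P <= m `^ (p - 2).
  rewrite -vP; apply: (le_trans (Pf_ub p2 (H1_L2 hv) vM')).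
  by rewrite vq ler_piMr// powR_ge0.
have cP : c <= P.
  rewrite /c mulrC -ler_pdivlMr ?(p_gt0 p2)// mulrC.
  by move: EN; rewrite /En; lra.
have mm : m0 <= m.
  have -> : m = (m `^ (p - 2)) `^ (p - 2)^-1.
    by rewrite -powRrM divff ?powRr1 ?normr_ge0// lt0r_neq0// p_gt2.
  apply: ge0_ler_powR; rewrite ?nnegrE ?powR_ge0 ?invr_ge0 ?(ltW (p_gt2 p2)) ?(ltW c0)//.
  exact: le_trans cP Pm.
have vx0 : v x1 != 0 by rewrite -normr_gt0; exact: lt_le_trans mm.
have kk : kap <= k.
  have hc := H1_cut' dx1 hv.
  have := seg_sup (seg_H1T p hc) s0; rewrite addr0.
  have h1 : sq None (fun y => v (x1 + y)) <= 1.
    by apply: le_trans q1; rewrite -vq; exact: sq_shift dx1 (H1_L2 hv).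
  have h2 : sq None (fun y => h (x1 + y)) <= k.
    by rewrite -vk; exact: sq_shift dx1 (H1_L2d hv).
  have h3 : m0 ^+ 2 <= v x1 ^+ 2.
    by rewrite -[leRHS]real_normK ?num_real// lerXn2r ?nnegrE ?(ltW m00)// (le_trans (ltW m00)).
  move=> h4.
  have h5 : 2 * sq None (fun y => v (x1 + y)) / s <= m0 ^+ 2 / 2.
    apply: (@le_trans _ _ (2 / s)); first by rewrite ler_pM2r ?invr_gt0//; lra.
    by rewrite /s invf_div mulrCA; lra.
  have h6 : 2 * s * sq None (fun y => h (x1 + y)) <= 2 * s * k.
    by rewrite ler_wpM2l// mulr_ge0// ltW.
  have h7 : m0 ^+ 2 <= m0 ^+ 2 / 2 + 2 * s * k by exact: le_trans h3 (le_trans h4 (lerD h5 h6)).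
  have h8 (X Y : R) : X <= X / 2 + Y -> X <= 2 * Y by move=> ?; lra.
  have s40 : 0 < 4 * s by rewrite mulr_gt0.
  rewrite /kap (ler_pdivrMr _ _ s40).
  by apply: (le_trans (h8 _ _ h7)); rewrite (_ : 2 * (2 * s * k) = k * (4 * s))//; ring.
suff [a [y [q' [k' [P' [hs hq' hk' hP1 hP2]]]]]] : exists a y q' k' P', [/\ seg p (Some a) 0 y q' k' P',
    q' <= 1 + e, k' <= k / 2 + e, P - e <= P' & P' <= C2].
  have hg := gconf_intro hs (fun i : 'I_N => seg_zero p2 0).
  rewrite !big1_eq !addr0 in hg; have a0 : 0 <= a by case: hs.
  exists a => //.
  have G := gconf_class p2 p6 N0 a0.
  have := infE_superlinear p2 p6 G hg (ltW e0) hq'; rewrite -/(gE p N a).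
  have I0 : gE p N a <= 0 by exact: infE_le0 G.
  have h1 : (1 + e) * gE p N a <= q' * gE p N a by rewrite ler_wnM2r.
  have h2 := ler_wpM2l (ltW pi0) hP1.
  have h3 := ler_wpM2l (mulr_ge0 (ltW e0) (ltW pi0)) hP2.
  have pe : p^-1 * e <= 2^-1 * e.
    by apply: ler_wpM2r; [exact: ltW|rewrite lef_pV2 ?posrE ?(p_gt0 p2)// ltW].
  move=> h4; rewrite -(ltr_pM2l (_ : 0 < 1 + e)); last lra.
  have DE : e * (8 * D) = 16 * e + 24 * (e * p^-1 * C2) - 8 * (e * ER p) by rewrite /D; ring.
  move: hE h4; rewrite /En; set p1 := p^-1 in h2 h3 pe DE *; set E := ER p in DE *.
  clearbody D C2 kap; move=> *; lra.
have mB : m `^ (p - 2) <= (2 + 2 * B) `^ (p - 2).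
  have b0 : 0 <= 2 + 2 * B by lra.
  apply: ge0_ler_powR; rewrite ?nnegrE ?(ltW (p_gt2 p2)) ?normr_ge0//.
  have hc := H1_cut' dx1 hv.
  have := seg_sup (seg_H1T p hc) ltr01; rewrite addr0 divr1 mulr1.
  have := sq_shift dx1 (H1_L2 hv); have := sq_shift dx1 (H1_L2d hv).
  rewrite -[v x1 ^+ 2]real_normK ?num_real// -/m vq vk => h1 h2 h3.
  have : m ^+ 2 <= 2 + 2 * B by apply: (le_trans h3); rewrite /= in h1 h2 *; lra.
  have m00' : 0 <= m by exact: normr_ge0.
  nra.
have [_ _ qE] := L2_cut dx1 (H1_L2 hv).
have [_ _ kE] := L2_cut dx1 (H1_L2d hv).
have PE := Pf_cut p2 (isT : okb None) dx1 hv.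
have hc := H1_cut' dx1 hv.
have n0 : 0 < m by rewrite normr_gt0.
have v2 : v x1 ^+ 2 != 0 by rewrite sqrf_eq0.
rewrite vq in qE; rewrite vk in kE; rewrite vP in PE.
set q1' := sq (Some x1) v in qE; set q2' := sq (osub None x1) _ in qE.
set k1 := sq (Some x1) h in kE; set k2 := sq (osub None x1) _ in kE.
set P1 := Pf p (Some x1) v in PE; set P2 := Pf p (osub None x1) _ in PE.
have q10 : 0 <= q1' by exact: sq_ge0.
have q20 : 0 <= q2' by exact: sq_ge0.
have P10 : 0 <= P1 by exact: Pf_ge0.
have P20 : 0 <= P2 by exact: Pf_ge0.
have B0 : 0 <= (2 + 2 * B) `^ (p - 2) by exact: powR_ge0.
have P1m : P1 <= m `^ (p - 2) * q1'.
  apply: Pf_ub => //; first exact: H1_L2 (H1_sub dx1 hv).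
  by move=> y /dom_ge0; exact: vM.
have P2m : P2 <= m `^ (p - 2) * q2'.
  apply: Pf_ub => //; first exact: H1_L2 hc.
  by move=> y /dom_ge0 y0; apply: vM; rewrite addr_ge0.
have cst r : 0 <= r -> seg p (Some (r / v x1 ^+ 2)) (v x1) (v x1) r 0 (m `^ (p - 2) * r).
  move=> r0; have d0 : 0 <= r / v x1 ^+ 2 by rewrite divr_ge0 ?sqr_ge0.
  have := seg_cst p (v x1) d0; rewrite [v x1 ^+ 2 * _]mulrC divfK//.
  rewrite (powR_split p2 (ltW n0)) real_normK ?num_real//.
  by rewrite -[_ * v x1 ^+ 2 * _]mulrA [v x1 ^+ 2 * _]mulrC divfK.
have mr r : 0 <= r -> r <= 1 -> m `^ (p - 2) * r <= (2 + 2 * B) `^ (p - 2).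
  by move=> r0 r1; apply: le_trans mB; rewrite ler_piMr// powR_ge0.
have m1r := mr _ q10; have m2r := mr _ q20.
have [kl|kl] := leP (k / 2) k1.
  have [a [q' [k' [P' [hs hq hk hP1 hP2]]]]] := seg_trunc p2 hc e0 e1.
  rewrite addr0 -/q2' -/k2 -/P2 in hs hq hk hP1 hP2.
  have hh := seg_rev p2 (seg_cat p2 (cst _ q10) hs).
  do 5 eexists; split; [exact: hh|lra|lra|lra|rewrite /C2; lra].
have hh := seg_cat p2 (seg_sub p dx1 hv) (cst _ q20); rewrite v0 -/q1' -/k1 -/P1 in hh.
do 5 eexists; split; [exact: hh|lra|lra|lra|rewrite /C2; lra].
Qed.

End extension.

(** * Compactness *)

Section completeness.
Context {R : realType}.

Lemma pow2_gt (x : R) : 0 < x -> exists n : nat, x < 2 ^+ n.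
Proof.
move=> x0; exists (Num.bound x); apply: (lt_trans (archi_boundP (ltW x0))).
by rewrite -natrX ltr_nat ltn_expl.
Qed.

(** Cauchy-Schwarz with weights [2^j], obtained by splitting off the first increment with
    [(a + b)^2 <= 2 a^2 + 2 b^2]. *)
Lemma weighted_telescope (f : nat -> R) n m :
  (f (n + m)%N - f n) ^+ 2 <=
    2 / 2 ^+ n * \sum_(n <= j < n + m) 2 ^+ j * (f j.+1 - f j) ^+ 2.
Proof.
elim: m n => [|m IH] n.
  by rewrite addn0 subrr expr0n big_geq// mulr0.
rewrite big_ltn; last by rewrite -[X in (X < _)%N]addn0 ltn_add2l.
have := IH n.+1; rewrite addSnnS => h.
have -> : f (n + m.+1)%N - f n = (f n.+1 - f n) + (f (n + m.+1)%N - f n.+1) by ring.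
set a := f n.+1 - f n; set b := f (n + m.+1)%N - f n.+1 in h *.
set S := \sum_(_ <= _ < _) _ in h *.
have n0 : 2 ^+ n != 0 :> R by rewrite expf_neq0.
have e1 (X Y Z : R) : X != 0 -> 2 / X * (X * Y + Z) = 2 * Y + 2 * (2 / (2 * X) * Z).
  by move=> X0; field.
rewrite e1// -exprS; have := sqr_ge0 (a - b); have : (a + b) ^+ 2 = 2 * a ^+ 2 + 2 * b ^+ 2 - (a - b) ^+ 2 by ring.
lra.
Qed.

(** The pointwise half of [L2_complete]: where the weighted series of squared increments is bounded,
    the sequence converges at a known rate. *)
Lemma fast_cauchy (f : nat -> R) (G : R) :
  (forall n, \sum_(j < n) 2 ^+ j * (f j.+1 - f j) ^+ 2 <= G) ->
  cvgn f /\ forall n, (f n - limn f) ^+ 2 <= 2 / 2 ^+ n * G.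
Proof.
move=> hG; have G0 : 0 <= G by have := hG 0%N; rewrite big_ord0.
have key n m : (n <= m)%N -> (f n - f m) ^+ 2 <= 2 / 2 ^+ n * G.
  move=> nm; rewrite -(subnKC nm) -sqrrN opprB; apply: (le_trans (weighted_telescope _ _ _)).
  rewrite ler_wpM2l ?divr_ge0 ?exprn_ge0//; apply: le_trans (hG m).
  rewrite subnKC// -(big_mkord xpredT (fun j => 2 ^+ j * (f j.+1 - f j) ^+ 2)).
  rewrite [leRHS](big_cat_nat (leq0n n) nm)/= lerDr; apply: sumr_ge0 => j _.
  by rewrite mulr_ge0 ?sqr_ge0// exprn_ge0.
have cf : cvgn f.
  apply: cauchy_cvg; apply: cauchy_exP => e e0.
  have c0 : 0 < 2 * (G + 1) / e ^+ 2 by rewrite divr_gt0 ?exprn_gt0// mulr_gt0//; lra.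
  have [n hn] := pow2_gt c0.
  exists (f n); exists n => // m /= nm; rewrite /ball /=.
  rewrite -(@ltr_sqr _ `|_|) ?nnegrE ?(ltW e0)// real_normK ?num_real//.
  apply: (le_lt_trans (key _ _ nm)).
  rewrite mulrAC ltr_pdivrMr ?exprn_gt0// mulrC.
  move: hn; rewrite ltr_pdivrMr ?exprn_gt0//; lra.
split=> // n.
have c2 : (fun m => (f n - f m) ^+ 2) @ \oo --> (f n - limn f) ^+ 2.
  rewrite expr2; under eq_fun do rewrite expr2.
  by apply: cvgM; apply: cvgB => //; exact: cvg_cst.
rewrite -(cvg_lim _ c2)//; apply: limr_le; first by apply/cvg_ex; eexists; exact: c2.
by exists n => // m /= nm; exact: key.
Qed.

(* The series [G = sum_j 2^j |f_(j+1) - f_j|^2] is integrable and dominates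
   [|f_n - g|^2] up to [2^(1 - n)], wherever it is finite. *)
Lemma L2_complete (D : set R) (f : nat -> R -> R) (C : R) : measurable D ->
  (forall j, L2 D (f j)) -> 0 <= C ->
  (forall j, L2 D (fun x => f j.+1 x - f j x) /\
     rint D (fun x => (f j.+1 x - f j x) ^+ 2) <= C / 4 ^+ j) ->
  exists2 g, L2 D g & forall n, L2 D (fun x => f n x - g x) /\
    rint D (fun x => (f n x - g x) ^+ 2) <= 4 * C / 2 ^+ n.
Proof.
move=> mD Lf C0 Ld.
pose d j x : R := 2 ^+ j * (f j.+1 x - f j x) ^+ 2.
have d0 j x : (0 <= (d j x)%:E)%E by rewrite lee_fin mulr_ge0 ?sqr_ge0// exprn_ge0.
have md j : measurable_fun D (EFin \o d j).
  apply/measurable_EFinP; apply: measurable_funM => //.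
  by apply: measurable_funX; case: (Ld j) => -[].
pose G x : \bar R := (\sum_(0 <= j <oo) (d j x)%:E)%E.
have mG : measurable_fun D G.
  apply: (@ge0_emeasurable_sum _ _ R D (fun j x => (d j x)%:E) xpredT) => [k x _ _|k _].
    exact: d0.
  exact: md.
have iG : (\int[leb]_(x in D) G x <= (2 * C)%:E)%E.
  rewrite integral_nneseries//.
  apply: lime_le; first by apply: is_cvg_nneseries => n _ _; exact: integral_ge0.
  apply: nearW => n.
  apply: (@le_trans _ _ (\sum_(0 <= j < n) (C / 2 ^+ j)%:E)%E).
    apply: lee_sum => j _; have [Lj hj] := Ld j.
    have [_ Ij] := (L2P _ mD).1 Lj.
    rewrite -(rintK mD (intgZ (2 ^+ j) mD Ij)) rintZ// lee_fin.
    apply: (le_trans (ler_wpM2l _ hj)); first by rewrite exprn_ge0.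
    have n0 : 2 ^+ j != 0 :> R by rewrite expf_neq0.
    have -> : (4 : R) ^+ j = 2 ^+ j * 2 ^+ j by rewrite -exprMn -natrM.
    have e (X : R) : X != 0 -> X * (C / (X * X)) = C / X by move=> X0; field.
    by rewrite e.
  rewrite sumEFin lee_fin big_mkord.
  have -> : \sum_(i < n) C / 2 ^+ i = 2 * C - 2 * C / 2 ^+ n.
    elim: n => [|n IH]; first by rewrite big_ord0 expr0; field.
    have n0 : 2 ^+ n != 0 :> R by rewrite expf_neq0.
    have e (X : R) : X != 0 -> 2 * C - 2 * C / X + C / X = 2 * C - 2 * C / (2 * X) by move=> X0; field.
    by rewrite big_ord_recr /= IH exprS e.
  by rewrite gerBl divr_ge0 ?exprn_ge0// mulr_ge0.
(* Off the set where [G] is finite the functions are replaced by 0, so that the limit exists on all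
   of [D] and is measurable; there the bound by [G] holds because [G] is infinite. *)
pose A := D `&` [set x | (G x < +oo)%E].
have mA : measurable A by exact: emeasurable_fun_infty_o.
pose h n x := f n x * \1_A x.
have hA x : D x -> (G x < +oo)%E -> forall n, h n x = f n x.
  by move=> Dx Gx n; rewrite /h indicE mem_set ?mulr1.
have hAn x : ~ (G x < +oo)%E -> forall n, h n x = 0.
  by move=> Gx n; rewrite /h indicE memNset ?mulr0// => -[].
have fG x : D x -> (G x < +oo)%E -> cvgn (f^~ x) /\
    forall n, (((f n x - limn (f^~ x)) ^+ 2)%:E <= (2 / 2 ^+ n)%:E * G x)%E.
  move=> Dx Gx; have G0 : (0 <= G x)%E by apply: nneseries_ge0 => n _ _; exact: d0.
  have Gf : G x = (fine (G x))%:E by rewrite fineK// ge0_fin_numE.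
  have [n|c l] := @fast_cauchy (f^~ x) (fine (G x)).
    rewrite -lee_fin -Gf -sumEFin -(big_mkord xpredT (fun j => (d j x)%:E)).
    by apply: nneseries_lim_ge => k _ _; exact: d0.
  by split=> // n; rewrite Gf -EFinM lee_fin; exact: l.
have hE x : D x -> (G x < +oo)%E -> h^~ x = f^~ x.
  by move=> Dx Gx; apply/funext => n; exact: hA.
pose g x : R := limn (h^~ x).
have mh n : measurable_fun D (h n).
  by apply: measurable_funM; [case: (Lf n)|exact: measurable_funTS].
have ch x : D x -> h^~ x @ \oo --> g x.
  move=> Dx; have [Gx|Gx] := pselect (G x < +oo)%E.
    rewrite hE//.
    have -> : g x = limn (f^~ x) by rewrite /g hE.
    by have [] := fG x Dx Gx.
  rewrite /g (_ : h^~ x = fun=> 0); last by apply/funext => n; exact: hAn.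
  by rewrite lim_cst//; exact: cvg_cst.
have mg : measurable_fun D g by exact: measurable_fun_cvg mh ch.
have bound n x : D x -> (((f n x - g x) ^+ 2)%:E <= (2 / 2 ^+ n)%:E * G x)%E.
  move=> Dx; have [Gx|Gx] := pselect (G x < +oo)%E.
    have -> : g x = limn (f^~ x) by rewrite /g hE.
    by have [] := fG x Dx Gx.
  have -> : G x = +oo%E by apply/eqP; rewrite -leye_eq leNgt; apply/negP.
  by rewrite gt0_muley ?leey// lte_fin divr_gt0// exprn_gt0.
have c0 n : 0 <= 2 / 2 ^+ n :> R by rewrite divr_ge0// exprn_ge0.
have mfg n : measurable_fun D (fun x => f n x - g x).
  by apply: measurable_funB => //; case: (Lf n).
have msq n : measurable_fun D (EFin \o (fun x => (f n x - g x) ^+ 2)).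
  by apply/measurable_EFinP; exact: measurable_funX.
have mGn n : measurable_fun D (fun x => (2 / 2 ^+ n)%:E * G x)%E by exact: measurable_funeM.
have ib n : (\int[leb]_(x in D) ((f n x - g x) ^+ 2)%:E <= (4 * C / 2 ^+ n)%:E)%E.
  apply: (@le_trans _ _ (\int[leb]_(x in D) ((2 / 2 ^+ n)%:E * G x))%E).
    apply: ge0_le_integral => //.
    - by move=> x _; rewrite lee_fin sqr_ge0.
    - exact: msq.
    - exact: mGn.
    - by move=> x; exact: bound.
  rewrite ge0_integralZl_EFin//; last by move=> x _; apply: nneseries_ge0 => k _ _; exact: d0.
  apply: (le_trans (lee_wpmul2l _ iG)); first by rewrite lee_fin.
  by rewrite -EFinM lee_fin le_eqVlt; apply/orP; left; apply/eqP; ring.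
have Lfg n : L2 D (fun x => f n x - g x).
  by split=> //; apply: le_lt_trans (ib n) _; exact: ltry.
exists g; last first.
  move=> n; split=> //; rewrite -lee_fin (rintK mD); first exact: ib.
  by have [] := (L2P _ mD).1 (Lfg n).
apply/(L2P _ mD); split=> //.
have [_ I1] := (L2P _ mD).1 (Lf 0%N); have [_ I2] := (L2P _ mD).1 (Lfg 0%N).
apply: (intg_le mD _ (intgD mD (intgZ 2 mD I1) (intgZ 2 mD I2))).
  exact: measurable_funX.
move=> x Dx /=; rewrite ger0_norm ?sqr_ge0//.
have := sqr_ge0 (g x - 2 * f 0%N x); nra.
Qed.

End completeness.

(** * Weak limits and lower semicontinuity of the kinetic integral *)

Section lower_semicontinuity.
Context {R : realType}.
Implicit Types (b : option R) (f g : R -> R).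

Lemma pow2_cvg (a : nat -> R) (l C : R) : (forall n, (a n - l) ^+ 2 <= C / 2 ^+ n) -> a @ \oo --> l.
Proof.
move=> h; apply/cvgrPdist_le => e e0.
have C0 : 0 <= C by have := h 0%N; rewrite expr0 divr1; apply: le_trans; exact: sqr_ge0.
have c0 : 0 < (C + 1) / e ^+ 2 by rewrite divr_gt0 ?exprn_gt0//; lra.
have [n hn] := pow2_gt c0; exists n => // m /= nm.
rewrite -(@ler_sqr _ `|_|) ?nnegrE ?(ltW e0)// real_normK ?num_real//.
rewrite -sqrrN opprB; apply: (le_trans (h m)).
rewrite ler_pdivrMr ?exprn_gt0// mulrC.
have hm : 2 ^+ n <= 2 ^+ m :> R by rewrite ler_eXn2l// ltr1n.
have e2 : 0 < e ^+ 2 by rewrite exprn_gt0.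
move: hn; rewrite ltr_pdivrMr// => hn.
have := ler_wpM2r (ltW e2) hm; lra.
Qed.

(** Used in two ways: bounds on two functions pass to their midpoint, and two functions whose
    midpoint is almost as large as they are must be close. *)
Lemma parallelogram b f g : L2 (dom b) f -> L2 (dom b) g ->
  [/\ L2 (dom b) (fun x => f x - g x), L2 (dom b) (fun x => 2^-1 * (f x + g x)) &
   sq b (fun x => 2^-1 * (f x + g x)) + 4^-1 * sq b (fun x => f x - g x) =
   2^-1 * sq b f + 2^-1 * sq b g].
Proof.
move=> Lf Lg; have [Lm _] := L2Z 2^-1 (L2D Lf Lg).
have Ld : L2 (dom b) (fun x => f x - g x).
  rewrite (_ : (fun _ => _) = (fun x => f x + -1 * g x)); last by apply/funext => x; rewrite mulN1r.
  by apply: L2D => //; have [] := L2Z (-1) Lg.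
split=> //; have mD := measurable_dom b.
have Id := intgZ (4^-1) mD (L2_sq Ld).
have If := intgZ (2^-1) mD (L2_sq Lf).
have Ig := intgZ (2^-1) mD (L2_sq Lg).
rewrite /sq -!rintZ//; try exact: L2_sq.
rewrite -!rintD//; last exact: L2_sq.
by apply: eq_rint => x _ /=; field.
Qed.

Lemma L2_limit b (v : nat -> R -> R) (u : R -> R) (C : R) : (forall n, L2 (dom b) (v n)) ->
  (forall x, dom b x -> v^~ x @ \oo --> u x) -> (forall n, sq b (v n) <= C) ->
  L2 (dom b) u /\ sq b u <= C.
Proof.
move=> Lv cv vC; have mD := measurable_dom b.
have mu : measurable_fun (dom b) u.
  by apply: measurable_fun_cvg cv => n; case: (Lv n).
have I : (\int[leb]_(x in dom b) ((u x) ^+ 2)%:E <= C%:E)%E.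
  have mv n : measurable_fun (dom b) (EFin \o (fun x => v n x ^+ 2)).
    by apply/measurable_EFinP; apply: measurable_funX; case: (Lv n).
  have := @fatou _ _ R leb (dom b) mD (fun n => EFin \o (fun x => v n x ^+ 2)) mv.
  have p0 (n : nat) (x : R) : dom b x -> (0 <= ((v n x) ^+ 2)%:E)%E.
    by move=> _; rewrite lee_fin sqr_ge0.
  move=> /(_ p0) F.
  have -> : (\int[leb]_(x in dom b) ((u x) ^+ 2)%:E =
      \int[leb]_(x in dom b) limn_einf (fun n => ((v n x) ^+ 2)%:E))%E.
    apply: eq_integral => x; rewrite inE => dx.
    have c2 : (fun n => ((v n x) ^+ 2)%:E) @ \oo --> ((u x) ^+ 2)%:E.
      apply: cvg_EFin; first by apply: nearW.
      rewrite expr2 (_ : _ \o _ = fun n => v n x * v n x); last by apply/funext => n /=; rewrite expr2.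
      by apply: cvgM; exact: cv.
    by have [-> _] := cvg_limn_einf_sup c2.
  apply: (le_trans F); rewrite limn_einf_lim; apply: lime_le; first exact: is_cvg_einfs.
  apply: nearW => n; apply: (@le_trans _ _ (\int[leb]_(x in dom b) ((v n x) ^+ 2)%:E)%E).
    by apply: ereal_inf_lbound; exists n => //=.
  by rewrite -(rintK mD (L2_sq (Lv n))) lee_fin; exact: vC.
have Lu : L2 (dom b) u by split=> //; apply: le_lt_trans I _; exact: ltry.
by split=> //; rewrite -lee_fin /sq rintK//; exact: L2_sq.
Qed.

Lemma rint_cvg_bounded (c M : R) (f : nat -> R -> R) (g : R -> R) :
  (forall n, measurable_fun `[0, c] (f n)) -> (forall n (x : R), 0 <= x <= c -> `|f n x| <= M) ->
  (forall x : R, 0 <= x <= c -> f^~ x @ \oo --> g x) ->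
  (fun n => rint `[0, c] (f n)) @ \oo --> rint `[0, c] g.
Proof.
move=> mf fM fg; have mD : measurable (`[0, c]%classic : set R) by exact: measurable_itv.
have mg : measurable_fun `[0, c] g.
  by apply: measurable_fun_cvg mf _ => x; rewrite /= in_itv /=; exact: fg.
have gM (x : R) : 0 <= x <= c -> `|g x| <= M.
  move=> hx; have cn : (fun n => `|f n x|) @ \oo --> `|g x| by apply: cvg_norm; exact: fg.
  rewrite -(cvg_lim _ cn)//; apply: limr_le; first by apply/cvg_ex; eexists; exact: cn.
  by apply: nearW => n; exact: fM.
have If n : intg `[0, c] (f n) by exact: intg_bd (mf n) (fM n).
have Ig : intg `[0, c] g by exact: intg_bd mg gM.
have mfE n : measurable_fun `[0, c] (EFin \o f n) by apply/measurable_EFinP.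
have mgE : measurable_fun `[0, c] (EFin \o g) by apply/measurable_EFinP.
have := @dominated_convergence _ _ R leb _ mD (fun n => EFin \o f n) (EFin \o g)
  (EFin \o (fun=> M)) mfE mgE.
have h1 : {ae leb, forall x, (`[0, c]%classic : set R) x ->
    (EFin \o f n) x @[n --> \oo] --> (EFin \o g) x}.
  apply: aeW => x /=; rewrite in_itv /= => hx; apply: cvg_EFin; first exact: nearW.
  exact: fg.
have h2 : {ae leb, forall x n, (`[0, c]%classic : set R) x -> (`|(f n x)%:E| <= M%:E)%E}.
  by apply: aeW => x n /=; rewrite in_itv /= => hx; rewrite lee_fin; exact: fM.
move=> /(_ h1 (intg_cst c M) h2) [_ _ h].
have := fine_cvg (a := rint `[0, c] g); apply.
by rewrite rintK//; apply: cvg_trans h; exact: near_eq_cvg.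
Qed.

Section midpoints.
Variables (b : option R) (v h : nat -> R -> R) (B : R).
Hypotheses (hv : forall n, H1 b (v n) (h n)) (hB : forall n, sq b (h n) <= B).

(* Mazur's lemma only needs midpoint convexity here. *)
Inductive mids (k : nat) : (R -> R) -> (R -> R) -> Prop :=
| mids_term n : (k <= n)%N -> mids k (v n) (h n)
| mids_mid f f' g g' : mids k f f' -> mids k g g' ->
    mids k (fun x => 2^-1 * (f x + g x)) (fun x => 2^-1 * (f' x + g' x)).

Lemma mids_H1 k f f' : mids k f f' -> H1 b f f'.
Proof. by elim=> [n _|? ? ? ? _ ? _ ?]; [exact: hv|apply: H1Z; exact: H1D]. Qed.

Lemma mids_le k k' f f' : (k <= k')%N -> mids k' f f' -> mids k f f'.
Proof.
move=> kk; elim=> [n kn|? ? ? ? _ ? _ ?]; last exact: mids_mid.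
by apply: mids_term; exact: leq_trans kn.
Qed.

Lemma mids_near k f f' (x c e : R) : mids k f f' ->
  (forall n, (k <= n)%N -> `|c - v n x| <= e) -> `|c - f x| <= e.
Proof.
move=> m hn; elim: m => [n|? ? ? ? _ h1 _ h2]; first exact: hn.
by move: h1 h2; rewrite !ler_norml => /andP[? ?] /andP[? ?]; lra.
Qed.

Lemma mids_sq k f f' c (C : R) : mids k f f' -> dom b c ->
  (forall n, (k <= n)%N -> sq (Some c) (h n) <= C) -> sq (Some c) f' <= C.
Proof.
move=> m dc hC; elim: m => [n|f1 f2 g1 g2 m1 h1 m2 h2]; first exact: hC.
have L1 := L2_sub dc (H1_L2d (mids_H1 m1)); have L2' := L2_sub dc (H1_L2d (mids_H1 m2)).
have [_ _] := parallelogram L1 L2'.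
by have := sq_ge0 (Some c) (fun x => f2 x - g2 x); lra.
Qed.

(** As in the projection theorem. [sup S] is the supremum of lower bounds for the kinetic integral
    of midpoints built from the tails of the sequence. Elements within [4^-j] of it have midpoints
    at least [sup S - 4^-j], and the parallelogram identity bounds their squared distance by
    [8 / 4^j]. *)
Lemma mids_fast_cauchy : exists f f' : nat -> R -> R, forall j,
  [/\ mids j (f j) (f' j), L2 (dom b) (fun x => f' j.+1 x - f' j x) &
   sq b (fun x => f' j.+1 x - f' j x) <= 8 / 4 ^+ j].
Proof.
pose S : set R := [set e | exists k, forall f f', mids k f f' -> e <= sq b f'].
have hS : has_sup S.
  split; first by exists 0, 0%N => f f' _; exact: sq_ge0.
  exists B => e [k hk]; apply: le_trans (hB k); exact: hk (mids_term (leqnn k)).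
pose e j : R := (4 ^+ j)^-1.
have e0 j : 0 < e j by rewrite invr_gt0 exprn_gt0.
have eS j : e j.+1 <= e j.
  by rewrite lef_pV2 ?posrE ?exprn_gt0// exprS ler_peMl ?exprn_ge0// ler1n.
have hex j : exists k, forall f f', mids k f f' -> sup S - e j < sq b f'.
  have [x [k hk] xe] := sup_adherent (e0 j) hS.
  by exists k => f f' m; apply: lt_le_trans (hk _ _ m).
have [K hK] := choice hex.
(* A nondecreasing majorant of [K] that is also at least [j]. *)
pose kk j := (\sum_(i < j.+1) (K i + 1))%N.
have kkS j : (kk j <= kk j.+1)%N by rewrite /kk [leqRHS]big_ord_recr /= leq_addr.
have kkK j : (K j <= kk j)%N by rewrite /kk big_ord_recr /= addnCA leq_addr.
have kkj j : (j <= kk j)%N.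
  elim: j => [|j IH] //; rewrite /kk big_ord_recr /= -/(kk j) addnA addn1 ltnS.
  exact: leq_trans IH (leq_addr _ _).
have hex2 j : exists z : (R -> R) * (R -> R), mids (kk j) z.1 z.2 /\ sq b z.2 < sup S + e j.
  apply: contrapT => hn; have : S (sup S + e j).
    exists (kk j) => f f' m; rewrite leNgt; apply/negP => lt; apply: hn; by exists (f, f').
  by move=> /(ub_le_sup hS.2); have := e0 j; lra.
have [z hz] := choice hex2.
exists (fun j => (z j).1), (fun j => (z j).2) => j.
have [m0 s0] := hz j; have [m1 s1] := hz j.+1.
have m1' := mids_le (kkS j) m1.
have [Ld _ P] := parallelogram (H1_L2d (mids_H1 m1)) (H1_L2d (mids_H1 m0)).
have lb := hK j _ _ (mids_le (kkK j) (mids_mid m1' m0)).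
split=> //; first exact: mids_le (kkj j) m0.
have ej := eS j; rewrite -/(e j); lra.
Qed.

(** The derivatives of suitable midpoints converge strongly to [g], while the midpoints themselves
    still tend to [u] pointwise; convexity carries every eventual bound over to [g]. Bounds are
    stated on each [[0, c]] because minimizing sequences are controlled on truncated half-lines. *)
Lemma weak_limit (u : R -> R) : okb b -> L2 (dom b) u ->
  (forall x, dom b x -> v^~ x @ \oo --> u x) ->
  exists2 g, H1 b u g & forall (c C : R) n0, dom b c ->
    (forall n, (n0 <= n)%N -> sq (Some c) (h n) <= C) -> sq (Some c) g <= C.
Proof.
move=> ob Lu vu; have [f [f' hf]] := mids_fast_cauchy.
have Hf j : H1 b (f j) (f' j) by have [m _ _] := hf j; exact: mids_H1 m.
have mD := measurable_dom b.
have [||g Lg hg] := @L2_complete R (dom b) f' 8 mD (fun j => H1_L2d (Hf j)).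
- by [].
- by move=> j; have [_ ? ?] := hf j.
have hgc n c : dom b c -> [/\ L2 (dom (Some c)) (fun x => f' n x - g x) &
    sq (Some c) (fun x => f' n x - g x) <= 32 / 2 ^+ n].
  move=> dc; have [L h1] := hg n; split; first exact: L2_sub dc L.
  by apply: (le_trans (sq_sub dc L)); apply: (le_trans h1); rewrite -natrM.
have fu x : dom b x -> f^~ x @ \oo --> u x.
  move=> dx; apply/cvgrPdist_le => e e0.
  have /cvgrPdist_le /(_ e e0) [k _ hk] := vu x dx.
  exists k => // j /= kj; have [m _ _] := hf j.
  exact: mids_near (mids_le kj m) hk.
exists g.
  split=> // x dx.
  have Lgx := L2_sub dx Lg; have x0 := dom_ge0 dx.
  have c1 : (fun n => rint `[0, x] (f' n)) @ \oo --> rint `[0, x] g.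
    apply: (@pow2_cvg _ _ (x * 32)) => n.
    have Lfx := L2_sub dx (H1_L2d (Hf n)); have [L hL] := hgc n x dx.
    rewrite -rintB//; [|exact: L2_intg|exact: L2_intg].
    apply: (le_trans (cauchy_schwarz x0 L)); rewrite -mulrA.
    by apply: ler_wpM2l => //; exact: hL.
  have c2 : f^~ x @ \oo --> u 0 + rint `[0, x] g.
    rewrite (_ : f^~ x = fun n => f n 0 + rint `[0, x] (f' n)); last first.
      by apply/funext => n; have [_ _ ->] := Hf n.
    by apply: cvgD => //; apply: fu; exact: dom0.
  exact: cvg_unique (fu x dx) c2.
move=> c C n0 dc hC.
have C0 : 0 <= C by apply: le_trans (hC n0 (leqnn _)); exact: sq_ge0.
apply: (@le_eps _ _ _ (C + 1)) => e e0 e1.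
have q0 : 0 < (1 + e^-1) * 32 / e by rewrite divr_gt0// mulr_gt0// addr_gt0// invr_gt0.
have [n1 hn1] := pow2_gt q0; pose n := maxn n0 n1.
have [L hL] := hgc n c dc; have [m _ _] := hf n.
have fC : sq (Some c) (f' n) <= C.
  apply: (mids_sq m dc) => j nj; apply: hC; exact: leq_trans (leq_maxl _ _) nj.
have hn : (1 + e^-1) * (32 / 2 ^+ n) <= e.
  rewrite mulrA ler_pdivrMr ?exprn_gt0// [e * _]mulrC -ler_pdivrMr//.
  by apply: (le_trans (ltW hn1)); rewrite ler_eXn2l ?ltr1n// leq_maxr.
have Lf := L2_sub dc (H1_L2d (Hf n)); have mc := measurable_dom (Some c).
have I1 := intgZ (1 + e) mc (L2_sq Lf); have I2 := intgZ (1 + e^-1) mc (L2_sq L).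
apply: (@le_trans _ _ ((1 + e) * sq (Some c) (f' n) +
    (1 + e^-1) * sq (Some c) (fun x => f' n x - g x))).
  rewrite /sq -!rintZ//; try exact: L2_sq.
  rewrite -rintD//; apply: le_rint => //; first exact: L2_sq (L2_sub dc Lg).
    exact: intgD.
  move=> x _ /=; rewrite -subr_ge0.
  have -> : (1 + e) * f' n x ^+ 2 + (1 + e^-1) * (f' n x - g x) ^+ 2 - g x ^+ 2 =
      (e * f' n x + (f' n x - g x)) ^+ 2 / e by field; rewrite lt0r_neq0.
  by rewrite divr_ge0 ?sqr_ge0// ltW.
have i0 : 0 <= 1 + e^-1 by rewrite addr_ge0// invr_ge0 ltW.
have := ler_wpM2l i0 hL; have e10 : 0 <= 1 + e by lra.
have := ler_wpM2l e10 fC; lra.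
Qed.

End midpoints.

End lower_semicontinuity.

(** In place of a diagonal extraction, the limits are taken along an ultrafilter; the term [s k] is
    then chosen so that the sequences with code below [k] are within [1 / (k + 1)] of their
    limits. *)
Lemma common_subsequence (R : realType) (I : countType) (a : I -> nat -> R) (B : I -> R) :
  (forall i n, `|a i n| <= B i) ->
  exists (L : I -> R) (s : nat -> nat), (forall k, (k <= s k)%N) /\
    forall i, (fun k => a i (s k)) @ \oo --> L i.
Proof.
move=> aB; have [U [UF sU]] := ultraFilterLemma eventually_filter.
have hL i : exists L : R, a i @ U --> L.
  have [|L [_ hL]] := @segment_compact R (- B i) (B i) (a i @ U) _.
    change (U (a i @^-1` `[- B i, B i])).
    apply: filterE => n; have := aB i n; rewrite ler_norml => h.
    by change (a i n \in `[- B i, B i]%R); rewrite in_itv.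
  exists L => V VL; have [//|Vc] := in_ultra_setVsetC (a i @^-1` V) UF.
  by have [y [/= ? ?]] := hL _ _ (Vc : (a i @ U) (~` V)) VL.
have [L hL'] := choice hL.
have fin K (e : R) : 0 < e -> U [set n | forall i, (pickle i < K)%N -> `|L i - a i n| <= e].
  move=> e0; elim: K => [|K IH]; first by apply: filterE => n i.
  have [[i hi]|hn] := pselect (exists i : I, pickle i = K); last first.
    apply: filterS IH => n h i; rewrite ltnS leq_eqVlt => /predU1P[iK|]; last exact: h.
    by exfalso; apply: hn; exists i.
  have /cvgrPdist_le/(_ e e0) Ui := hL' i.
  apply: filterS (filterI IH Ui) => n [h1 h2] j.
  rewrite ltnS leq_eqVlt => /predU1P[jK|]; last exact: h1.
  by rewrite (_ : j = i)//; apply: (pcan_inj pickleK); rewrite jK.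
have hs k : exists n, (k <= n)%N /\ forall i, (pickle i < k)%N -> `|L i - a i n| <= k.+1%:R^-1.
  have k0 : 0 < k.+1%:R^-1 :> R by rewrite invr_gt0.
  have Uk : U [set n | (k <= n)%N] by apply: sU; exists k.
  by have [n [n1 n2]] := filter_ex (filterI Uk (fin k _ k0)); exists n.
have [s hs'] := choice hs.
exists L, s; split=> [k|i]; first by case: (hs' k).
apply/cvgrPdist_le => e e0.
have ei : 0 < e^-1 by rewrite invr_gt0.
have [n1 hn1] := pow2_gt ei.
exists (maxn (2 ^ n1) (pickle i).+1) => // k /=; rewrite geq_max => /andP[k1 k2].
have [_ /(_ i k2) h] := hs' k; apply: (le_trans h).
rewrite -[e]invrK lef_pV2 ?posrE ?invr_gt0//; apply: (le_trans (ltW hn1)).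
by rewrite -natrX ler_nat; exact: leqW.
Qed.

Section limits.
Context {R : realType}.

(** The common bound on the kinetic integrals makes the sequence equicontinuous, so convergence at
    rational points suffices. *)
Lemma equi_holder_cvg b (v h : nat -> R -> R) (B : R) :
  (forall n, H1 b (v n) (h n)) -> (forall n, sq b (h n) <= B) ->
  (forall q : rat, dom b (ratr q) -> cvgn (fun n => v n (ratr q))) ->
  forall x, dom b x -> cvgn (fun n => v n x).
Proof.
move=> hv hB hq x dx; apply: cauchy_cvg; apply: cauchy_exP => e e0.
have B0 : 0 <= B by apply: le_trans (hB 0%N); exact: sq_ge0.
pose d : R := (e / 2) ^+ 2 / (B + 1).
have e20 : 0 < e / 2 by rewrite divr_gt0.
have d0 : 0 < d by rewrite divr_gt0 ?exprn_gt0//; lra.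
have x0 := dom_ge0 dx.
have [q [dq qx]] : exists q : rat, dom b (ratr q) /\ `|x - ratr q| <= d.
  have [->|xn] := eqVneq x 0.
    exists 0; rewrite raddf0 subr0 normr0 (ltW d0); split=> //; apply: dom_le dx; rewrite lexx//.
  have xp : 0 < x by rewrite lt0r xn.
  have lt : Num.max 0 (x - d) < x by rewrite gt_max xp/=; lra.
  have [q] := rat_in_itvoo lt; rewrite in_itv /= gt_max => /andP[/andP[q0 qd] qx].
  exists q; split; first by apply: dom_le dx; rewrite !ltW.
  by rewrite ler_norml; lra.
have close n : `|v n (ratr q) - v n x| <= e / 2.
  rewrite -(@ler_sqr _ `|_|) ?nnegrE ?(ltW e20)// real_normK ?num_real//.
  rewrite -sqrrN opprB; apply: (le_trans (H1_holderN (hv n) dq dx)).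
  apply: (@le_trans _ _ (d * (B + 1))); last by rewrite /d divfK// gt_eqF//; lra.
  by apply: ler_pM => //; [exact: sq_ge0|have := hB n; lra].
exists (limn (fun n => v n (ratr q))).
have /cvgrPdist_lt/(_ (e / 2) e20) := hq q dq.
apply: filterS => n hn; rewrite /ball /=.
have -> : limn (fun n => v n (ratr q)) - v n x =
  (limn (fun n => v n (ratr q)) - v n (ratr q)) + (v n (ratr q) - v n x) by ring.
apply: (le_lt_trans (ler_normD _ _)).
by have := close n; lra.
Qed.

Lemma cvg_norm_powR (p : R) (a : nat -> R) (l : R) : 2 < p -> a @ \oo --> l ->
  (fun n => `|a n| `^ p) @ \oo --> `|l| `^ p.
Proof.
move=> p2 al; have [l0|l0] := eqVneq l 0; last first.
  have n0 : 0 < `|l| by rewrite normr_gt0.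
  have an : (fun n => `|a n|) @ \oo --> `|l| by exact: cvg_norm.
  have cp : {for `|l|, continuous (fun x : R => x `^ p)}.
    apply: differentiable_continuous; apply/derivable1_diffP; apply: derivable_powR.
    by rewrite in_itv /= n0.
  exact: cvg_comp an cp.
rewrite l0 normr0 powR0 ?lt0r_neq0 ?(p_gt0 p2)//.
have a2 : (fun n => a n ^+ 2) @ \oo --> (0 : R).
  rewrite (_ : (fun _ => _) = (fun n => a n * a n)); last by apply/funext => n; rewrite expr2.
  by rewrite -[X in _ --> X](mulr0 0); rewrite l0 in al; exact: cvgM.
apply: (squeeze_cvgr _ (@cvg_cst R 0 nat \oo _) a2).
have /cvgrPdist_le/(_ 1 ltr01) := al; apply: filterS => n; rewrite l0 sub0r normrN => n1.
rewrite powR_ge0/= -[leRHS]real_normK ?num_real//.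
apply: (le_trans (powR_le_sq p2 (M := 1) _)); first by rewrite normr_ge0.
by rewrite powR1 mul1r.
Qed.

End limits.

(** * Concentration-compactness and existence of minimizers *)

Section compactness.
Context {R : realType} (p : R) (p2 : 2 < p) (p6 : p < 6) (N : nat) (N0 : (0 < N)%N).
Implicit Types (l m : R) (u g : option 'I_N -> R -> R).

Let ER0 := ER_lt0 p2 p6 N0.
Let ZC := ztail_class p2 p6 N0.
Let pi0 : 0 < p^-1. Proof. by rewrite invr_gt0 p_gt0. Qed.

Lemma cvg_sumr (I : finType) (f : I -> nat -> R) (a : I -> R) :
  (forall i, f i @ \oo --> a i) -> (fun n => \sum_i f i n) @ \oo --> \sum_i a i.
Proof. by move=> h; apply: cvg_big => [|i _]; [exact: add_continuous|exact: h]. Qed.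

Definition core l m (e : option 'I_N) : R := if e is Some _ then m else l.

Definition Kcore l m u : R := \sum_(e : option 'I_N) sq (Some (core l m e)) (u e).
Definition Pcore l m u : R := \sum_(e : option 'I_N) Pf p (Some (core l m e)) (u e).

Lemma dom_core l m e : 0 <= l -> 0 <= m -> dom (eb l e) (core l m e).
Proof. by case: e => [i|] l0 m0; rewrite domP /= ?m0 ?l0 ?lexx. Qed.

Lemma Kcore_split l m u : Kcore l m u = sq (Some l) (u None) + \sum_i sq (Some m) (u (Some i)).
Proof. exact: big_option_split. Qed.

Lemma Pcore_split l m u :
  Pcore l m u = Pf p (Some l) (u None) + \sum_i Pf p (Some m) (u (Some i)).
Proof. exact: big_option_split. Qed.

(* Each tail, prolonged by a ramp to 0, is a competitor for [ER]. *)
Lemma tails_energy l m u g (B : R) : 0 <= l -> 0 <= m -> H1_graph l u g -> Kin l u <= 1 ->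
  Pot p l u <= B -> (forall e x, dom (eb l e) x -> `|u e x| <= B) ->
  (1 - Kcore l m u) * ER p + 2^-1 * Kcore l m g - p^-1 * Pcore l m u
    - (2^-1 + 3 * p^-1 * (B `^ p + B) - ER p) * \sum_i u (Some i) m ^+ 2
  <= En p (Kin l g) (Pot p l u).
Proof.
move=> l0 m0 hG m1 PB uB; have [hu _] := (H1_graphP _ _ _).1 hG.
have dm : dom None m by rewrite domP m0.
have le3 (a b c d : R) : 0 <= b -> 0 <= c -> 0 <= d -> a - b <= c + (a + d) by move=> *; lra.
set C := _ + _ - ER p.
have tail i : (sq None (u (Some i)) - sq (Some m) (u (Some i))) * ER p <=
    2^-1 * (sq None (g (Some i)) - sq (Some m) (g (Some i)))
    - p^-1 * (Pf p None (u (Some i)) - Pf p (Some m) (u (Some i))) + C * u (Some i) m ^+ 2.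
  have ht := @seg_cut _ _ p2 None _ _ _ isT dm (hu (Some i)).
  have [q [P [hr hq hP]]] := seg_ramp p2 (u (Some i) m).
  have hz : ztail p _ _ _ := seg_cat p2 hr ht.
  have [qt0 _ Pt0] := seg_ge0 ht; have [_ _ P0] := seg_ge0 hr.
  move: hz qt0 Pt0; set qt := sq None (u _) - _; set kt := sq None (g _) - _; set Pt := Pf _ None _ - _.
  move=> hz qt0 Pt0; set c2 := u (Some i) m ^+ 2 in hr hq hz *.
  have c20 : 0 <= c2 by exact: sqr_ge0.
  have qt1 : qt <= 1.
    apply: le_trans m1; rewrite Kin_split (bigD1 i)//= /qt.
    by apply: le3; [exact: sq_ge0|exact: sq_ge0|apply: sumr_ge0 => j _; exact: sq_ge0].
  have PtB : Pt <= B.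
    apply: le_trans PB; rewrite Pot_split (bigD1 i)//= /Pt.
    by apply: le3; [exact: Pf_ge0|exact: Pf_ge0|apply: sumr_ge0 => j _; exact: Pf_ge0].
  have PB' : P <= B `^ p.
    apply: (le_trans hP); apply: ge0_ler_powR; rewrite ?nnegrE ?normr_ge0 ?(ltW (p_gt0 p2))//.
      exact: le_trans (normr_ge0 _) (uB (Some i) m dm).
    exact: (uB (Some i)).
  have q1 : q + qt <= 1 + c2 by lra.
  have := infE_superlinear p2 p6 ZC hz c20 q1; rewrite -/(ER p) /En => h.
  have h1 : (c2 + qt) * ER p <= (q + qt) * ER p by rewrite ler_wnM2r ?(ltW ER0)// lerD2r.
  have h2 : p^-1 * (P + Pt) <= p^-1 * (B `^ p + B) by rewrite ler_wpM2l ?(ltW pi0)// lerD.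
  have h3 := ler_wpM2l c20 h2.
  have h4 : 0 <= p^-1 * P by rewrite mulr_ge0// ltW.
  rewrite /C; set p1 := p^-1 in h h2 h3 h4 *; set E := ER p in h h1 *.
  clearbody p1 E c2 qt kt Pt; clear -h h1 h3 h4; lra.
have := ler_sum (index_enum 'I_N) (fun i (_ : true) => tail i).
rewrite -mulr_suml !big_split /= !sumrN -!mulr_sumr !sumrB.
rewrite !Kcore_split Pcore_split /En Kin_split Pot_split.
have := m1; rewrite Kin_split.
set S1 := \sum_i sq None (u _); set S2 := \sum_i sq (Some m) (u _).
move=> h1; have h2 : S1 - S2 <= 1 - (sq (Some l) (u None) + S2) by clear -h1; lra.
have := ler_wnM2r (ltW ER0) h2; clearbody C; clear -pi0; lra.
Qed.

Lemma core_exhaust l u g (e : R) : 0 <= l -> H1_graph l u g -> 0 < e ->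
  exists m : nat, [/\ Kin l u <= Kcore l m%:R u + e, Kin l g <= Kcore l m%:R g + e,
    Pcore l m%:R u <= Pot p l u & \sum_i u (Some i) m%:R ^+ 2 <= e].
Proof.
move=> l0 /H1_graphP[hu _] e0; pose d : R := e / N%:R.
have Np : 0 < N%:R :> R by rewrite ltr0n.
have d0 : 0 < d by rewrite divr_gt0.
have sumd : \sum_(i < N) d = e by rewrite sumr_const card_ord -[d *+ N]mulr_natr /d divfK ?gt_eqF.
have hex i : exists X : R, 0 <= X /\ forall x : R, X <= x -> [/\ u (Some i) x ^+ 2 <= d,
    sq None (u (Some i)) - sq (Some x) (u (Some i)) <= d &
    sq None (g (Some i)) - sq (Some x) (g (Some i)) <= d].
  have [X X0 hX] := tail_small p2 (hu (Some i)) d0.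
  have [Y Y0 hY] := rint_tail (L2_sq (H1_L2d (hu (Some i)))) (fun x _ => sqr_ge0 _) d0.
  exists (X + Y); split=> [|x hx]; first exact: addr_ge0.
  have Xx : X <= x by lra.
  have [h1 h2 _] := hX x Xx.
  by split=> //; apply: hY; lra.
have [X hX] := choice hex.
pose m := Num.bound (\sum_i X i).
have X0 : 0 <= \sum_i X i by apply: sumr_ge0 => i _; have [] := hX i.
have Xm i : X i <= m%:R.
  apply: (@le_trans _ _ (\sum_i X i)); last exact: ltW (archi_boundP X0).
  by rewrite (bigD1 i)//= lerDl; apply: sumr_ge0 => j _; have [] := hX j.
have hm i := proj2 (hX i) _ (Xm i).
exists m; split.
- rewrite Kin_split Kcore_split -addrA lerD2l -sumd -big_split; apply: ler_sum => i _ /=.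
  by have [_ + _] := hm i; lra.
- rewrite Kin_split Kcore_split -addrA lerD2l -sumd -big_split; apply: ler_sum => i _ /=.
  by have [_ _ +] := hm i; lra.
- rewrite Pot_split Pcore_split lerD2l; apply: ler_sum => i _.
  by apply: (Pf_sub p2 _ _ (hu (Some i))) => //; rewrite domP ler0n.
- by rewrite -sumd; apply: ler_sum => i _; have [] := hm i.
Qed.

(** Normalization to mass 1 multiplies the kinetic term by [t^2] and the potential by [t^p > t^2];
    the strictness excludes a loss of mass in [minimizer_exists]. *)
Lemma strict_superlinear l u g : 0 <= l -> H1_graph l u g -> 0 < Kin l u -> Kin l u < 1 ->
  0 < Pot p l u -> Kin l u * gE p N l < En p (Kin l g) (Pot p l u).
Proof.
move=> l0 hG q0 q1 P0; set q := Kin l u in q0 q1 *.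
pose t : R := Num.sqrt q^-1.
have t2 : t ^+ 2 = q^-1 by rewrite sqr_sqrtr// invr_ge0 ltW.
have t0 : 0 < t by rewrite sqrtr_gt0 invr_gt0.
have t1 : 1 < t by rewrite -(@expr_gt1 _ 2) ?sqrtr_ge0// t2 invf_gt1.
have GC := gconf_class p2 p6 N0 l0.
have c := conf_scale GC (H1_graph_conf p hG) (ltW t0).
rewrite -/q t2 mulVf ?gt_eqF// in c.
have := infE_le GC c (lexx 1); rewrite -/(gE p N l) => h.
rewrite -ltr_pdivlMl//; apply: (le_lt_trans h).
have tp : q^-1 < t `^ p.
  rewrite -t2 (powR_split p2 (ltW t0)) ltr_pMl ?exprn_gt0//.
  have := @gt0_ltr_powR R (p - 2) (p_gt2 p2) 1 t.
  by rewrite powR1 !nnegrE; apply => //; exact: ltW.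
have pP : 0 < p^-1 * Pot p l u by rewrite mulr_gt0.
have := tp; rewrite -(ltr_pM2r pP) /En; lra.
Qed.

(** Mass [1 - q] missing from the limit [u] has gone along the half-lines and costs at least [ER]
    per unit, so [(1 - q) ER + E(u) <= gE l]. The bound [c0] gives [q > 0]. If [q < 1], then
    [q gE l < E(u)] and [gE l <= ER] contradict this inequality. *)
Lemma minimizer_exists l (c0 : R) : 0 <= l -> 0 < c0 ->
  (forall eta : R, 0 < eta -> exists u g, [/\ H1_graph l u g, Kin l u <= 1,
     En p (Kin l g) (Pot p l u) <= gE p N l + eta & c0 <= sq (Some l) (u None)]) ->
  exists u g, [/\ H1_graph l u g, Kin l u = 1 & En p (Kin l g) (Pot p l u) <= gE p N l].
Proof.
move=> l0 c00 hmin.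
have [B [B1 hB]] := energy_bounds p2 p6 N0.
have eE : gE p N l <= ER p := gE_le_ER p2 p6 N0 l0.
pose eta (n : nat) : R := - ER p / 2 ^+ n.
have eta0 n : 0 < eta n by rewrite divr_gt0 ?oppr_gt0// exprn_gt0.
have etaE n : eta n <= - ER p.
  by rewrite ler_pdivrMr ?exprn_gt0// ler_peMr ?oppr_ge0 ?(ltW ER0)// exprn_ege1// ler1n.
have hex n : exists w : (option 'I_N -> R -> R) * (option 'I_N -> R -> R),
    [/\ H1_graph l w.1 w.2, Kin l w.1 <= 1,
     En p (Kin l w.2) (Pot p l w.1) <= gE p N l + eta n & c0 <= sq (Some l) (w.1 None)].
  by have [u [g h]] := hmin _ (eta0 n); exists (u, g).
have [w hw] := choice hex.
have hbd n : [/\ Kin l (w n).2 <= B, Pot p l (w n).1 <= B &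
    forall e x, dom (eb l e) x -> `|(w n).1 e x| <= B].
  have [hG m1 En1 _] := hw n; apply: (hB _ _ _ l0 hG m1).
  by have := etaE n; lra.
have hH n e : H1 (eb l e) ((w n).1 e) ((w n).2 e).
  by have [/H1_graphP[+ _] _ _ _] := hw n; apply.
have Kin_edge (f : option 'I_N -> R -> R) e : sq (eb l e) (f e) <= Kin l f.
  by rewrite /Kin (bigD1 e)//= lerDl; apply: sumr_ge0 => j _; exact: sq_ge0.
(* One countable family, so that a single subsequence makes both the values at rational points and
   the kinetic integrals on all truncated edges converge. *)
pose a (i : option 'I_N * rat + option 'I_N * nat) (n : nat) : R := match i with
  | inl (e, q) => if pselect (dom (eb l e) (ratr q)) then (w n).1 e (ratr q) else 0
  | inr (e, m) => sq (Some (core l m%:R e)) ((w n).2 e) end.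
have aB i n : `|a i n| <= B.
  have [K1 P1 uB] := hbd n.
  case: i => [[e q]|[e m]] /=.
    by case: pselect => dq; [exact: uB|rewrite normr0; lra].
  rewrite ger0_norm ?sq_ge0//; apply: le_trans K1; apply: le_trans (Kin_edge _ e).
  by apply: sq_sub (H1_L2d (hH n e)); exact: dom_core.
have [L [s [sk hL]]] := common_subsequence aB.
pose v k := (w (s k)).1; pose h k := (w (s k)).2.
have hv k e : H1 (eb l e) (v k e) (h k e) by exact: hH.
have hsq k e : sq (eb l e) (h k e) <= B.
  by have [K1 _ _] := hbd (s k); apply: le_trans K1; exact: Kin_edge.
have vc e x : dom (eb l e) x -> cvgn (fun k => v k e x).
  apply: (equi_holder_cvg (fun k => hv k e) (fun k => hsq k e)) => q dq.
  apply/cvg_ex; exists (L (inl (e, q))); have := hL (inl (e, q)).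
  rewrite (_ : (fun k => _) = (fun k => v k e (ratr q)))//.
  by apply/funext => k; rewrite /a; case: pselect.
pose u e x : R := limn (fun k => v k e x).
have vu e x : dom (eb l e) x -> (fun k => v k e x) @ \oo --> u e x by exact: vc.
have Lu e : L2 (dom (eb l e)) (u e).
  have v1 k : sq (eb l e) (v k e) <= 1.
    by have [_ m1 _ _] := hw (s k); apply: le_trans m1; exact: (Kin_edge (v k)).
  by have [] := L2_limit (fun k => H1_L2 (hv k e)) (vu e) v1.
have hex2 e : exists g : R -> R, H1 (eb l e) (u e) g /\ forall (c C : R) n0, dom (eb l e) c ->
    (forall n, (n0 <= n)%N -> sq (Some c) (h n e) <= C) -> sq (Some c) g <= C.
  have [g ? ?] := @weak_limit _ (eb l e) (fun k => v k e) (fun k => h k e) B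
    (fun k => hv k e) (fun k => hsq k e) (u e) (okb_eb e l0) (Lu e) (vu e).
  by exists g.
have [g hg] := choice hex2.
have hG : H1_graph l u g.
  apply/H1_graphP; split=> [e|i]; first by have [] := hg e.
  rewrite /u; congr (limn _); apply/funext => k.
  by have [/H1_graphP[_ +] _ _ _] := hw (s k); apply.
have gL e (m : nat) : sq (Some (core l m%:R e)) (g e) <= L (inr (e, m)).
  apply: (@le_eps _ _ _ 1) => d d0 _; rewrite mulr1.
  have /cvgrPdist_le/(_ d d0)[n0 _ hn] := hL (inr (e, m)).
  have [_ /(_ _ _ n0)] := hg e; apply; first exact: dom_core.
  move=> n /hn /=; rewrite ler_norml => /andP[+ _]; rewrite /h; lra.
have sqc e (m : nat) : (fun k => sq (Some (core l m%:R e)) (v k e)) @ \oo -->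
    sq (Some (core l m%:R e)) (u e).
  have dc : dom (eb l e) (core l m%:R e) by exact: dom_core.
  apply: (@rint_cvg_bounded _ _ (B ^+ 2)).
  - by move=> k; apply: measurable_funX; exact: L2_meas (L2_sub dc (H1_L2 (hv k e))).
  - move=> k x hx; rewrite ger0_norm ?sqr_ge0// -real_normK ?num_real// lerXn2r ?nnegrE//; first lra.
    by have [_ _ +] := hbd (s k); apply; exact: dom_le hx dc.
  - by move=> x hx; under eq_fun do rewrite expr2; rewrite expr2; apply: cvgM;
      apply: vu; exact: dom_le hx dc.
have Pfc e (m : nat) : (fun k => Pf p (Some (core l m%:R e)) (v k e)) @ \oo -->
    Pf p (Some (core l m%:R e)) (u e).
  have dc : dom (eb l e) (core l m%:R e) by exact: dom_core.
  have vB k x : dom (Some (core l m%:R e)) x -> `|v k e x| <= B.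
    by rewrite domP => hx; have [_ _ +] := hbd (s k); apply; exact: dom_le hx dc.
  apply: (@rint_cvg_bounded _ _ (B `^ p)).
  - move=> k; apply: intg_meas; exact: (intg_pow p2 (L2_sub dc (H1_L2 (hv k e))) (vB k)).
  - move=> k x hx; rewrite ger0_norm ?powR_ge0//.
    apply: ge0_ler_powR; rewrite ?nnegrE ?(ltW (p_gt0 p2))//; first lra.
    by apply: vB; rewrite domP.
  - by move=> x hx; apply: cvg_norm_powR => //; apply: vu; exact: dom_le hx dc.
pose C : R := 2^-1 + 3 * p^-1 * (B `^ p + B) - ER p.
have C0 : 0 <= C.
  have : 0 <= 3 * p^-1 * (B `^ p + B).
    by rewrite mulr_ge0 ?mulr_ge0 ?(ltW pi0)// addr_ge0 ?powR_ge0//; lra.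
  by have := ER0; rewrite /C; lra.
(* [tails_energy] in the limit. The kinetic integrals need not converge to those of [g], so their
   limits [L], which dominate the latter, are kept. *)
have ineq (m : nat) : (1 - Kcore l m%:R u) * ER p + 2^-1 * \sum_e L (inr (e, m))
    - p^-1 * Pcore l m%:R u - C * \sum_i u (Some i) m%:R ^+ 2 <= gE p N l.
  have etac : (fun k => gE p N l + eta (s k)) @ \oo --> gE p N l.
    apply: (@pow2_cvg _ _ _ (ER p ^+ 2)) => k; rewrite addrAC subrr add0r.
    have s1 : eta (s k) <= - ER p / 2 ^+ k.
      rewrite /eta ler_pM2l ?oppr_gt0// lef_pV2 ?posrE ?exprn_gt0//.
      by rewrite ler_eXn2l ?ltr1n.
    apply: (@le_trans _ _ (eta (s k) * (- ER p))).
      by rewrite expr2 ler_wpM2l ?(ltW (eta0 _)).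
    have := ler_wpM2r (_ : 0 <= - ER p) s1; rewrite oppr_ge0 => /(_ (ltW ER0)).
    by move/le_trans; apply; rewrite le_eqVlt; apply/orP; left; apply/eqP; ring.
  have lhs : (fun k => (1 - Kcore l m%:R (v k)) * ER p + 2^-1 * Kcore l m%:R (h k)
      - p^-1 * Pcore l m%:R (v k) - C * \sum_i v k (Some i) m%:R ^+ 2) @ \oo -->
    (1 - Kcore l m%:R u) * ER p + 2^-1 * \sum_e L (inr (e, m))
      - p^-1 * Pcore l m%:R u - C * \sum_i u (Some i) m%:R ^+ 2.
    apply: cvgB; first apply: cvgB; first apply: cvgD.
    - apply: cvgM; last exact: cvg_cst; apply: cvgB; first exact: cvg_cst.
      by apply: cvg_sumr => e; exact: sqc.
    - apply: cvgM; first exact: cvg_cst.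
      by apply: cvg_sumr => e; exact: (hL (inr (e, m))).
    - apply: cvgM; first exact: cvg_cst.
      by apply: cvg_sumr => e; exact: Pfc.
    - apply: cvgM; first exact: cvg_cst.
      apply: cvg_sumr => i; under eq_fun do rewrite expr2; rewrite expr2.
      by apply: cvgM; apply: vu; rewrite domP ler0n.
  apply: (ler_cvg_to lhs etac); apply: nearW => k.
  have [hGk m1 Ek _] := hw (s k); have [_ P1 uB] := hbd (s k).
  exact: le_trans (tails_energy l0 (ler0n _ _) hGk m1 P1 uB) Ek.
have Kc1 (m : nat) : Kcore l m%:R u <= 1.
  have c : (fun k => Kcore l m%:R (v k)) @ \oo --> Kcore l m%:R u.
    by apply: cvg_sumr => e; exact: sqc.
  apply: (ler_cvg_to c (@cvg_cst R 1 nat \oo _)); apply: nearW => k.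
  have [_ m1 _ _] := hw (s k); apply: le_trans m1; apply: ler_sum => e _.
  by apply: sq_sub (H1_L2 (hv k e)); exact: dom_core.
have Kg (m : nat) : Kcore l m%:R g <= \sum_e L (inr (e, m)) by apply: ler_sum => e _; exact: gL.
have main : (1 - Kin l u) * ER p + En p (Kin l g) (Pot p l u) <= gE p N l.
  apply: (@le_eps _ _ _ (- ER p + 2^-1 + C)) => d d0 _.
  have [m [h1 h2 h3 h4]] := core_exhaust l0 hG d0.
  have e1 : (1 - Kin l u + d) * ER p <= (1 - Kcore l m%:R u) * ER p.
    by rewrite ler_wnM2r ?(ltW ER0)//; lra.
  have e2 := ler_wpM2l (ltW pi0) h3; have e3 := ler_wpM2l C0 h4.
  have := ineq m; have := Kg m; move: e1 e2 e3 h2; rewrite /En; clearbody C; clear; lra.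
have K1 : Kin l u <= 1.
  apply: (@le_eps _ _ _ 1) => d d0 _; have [m [h1 _ _ _]] := core_exhaust l0 hG d0.
  by have := Kc1 m; lra.
have K0 : 0 < Kin l u.
  apply: (lt_le_trans c00); apply: (@le_trans _ _ (sq (Some l) (u None))).
    apply: (ler_cvg_to (@cvg_cst R c0 nat \oo _) (sqc None 0%N)); apply: nearW => k.
    by have [_ _ _ +] := hw (s k).
  by rewrite Kin_split lerDl; apply: sumr_ge0 => i _; exact: sq_ge0.
have [Klt|Kge] := ltP (Kin l u) 1; last first.
  have K1' : Kin l u = 1 by apply/le_anti; rewrite K1.
  by exists u, g; split=> //; move: main; rewrite K1' subrr mul0r add0r.
exfalso; have P0 : 0 < Pot p l u.
  have [_ k0 P0] := gconf_ge0 (H1_graph_conf p hG).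
  rewrite lt0r P0 andbT; apply/eqP => Pz; move: main; rewrite Pz /En mulr0 subr0.
  have := mulr_gt0 K0 (_ : 0 < - ER p); rewrite oppr_gt0 => /(_ ER0).
  by move: eE k0; clear; lra.
have := strict_superlinear l0 hG K0 Klt P0; move: main eE Klt; clear; nra.
Qed.

End compactness.

(** * The threshold *)

Section threshold.
Context {R : realType} (p : R) (p2 : 2 < p) (p6 : p < 6) (N : nat) (N3 : (2 < N)%N).
Implicit Types (l q k P : R) (u g : option 'I_N -> R -> R).

Let N0 : (0 < N)%N. Proof. by case: N N3. Qed.
Let ER0 := ER_lt0 p2 p6 N0.
Let ZC := ztail_class p2 p6 N0.
Let pi0 : 0 < p^-1. Proof. by rewrite invr_gt0 p_gt0. Qed.

(** The maximum [|u xm|] is at least [m0], and the Hölder bound keeps [|u|] above [m0 / 2] within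
    distance [d] of [xm]. Since [d <= lam / 2], an interval of length [d] on one side of [xm] fits
    into the terminal edge. *)
Lemma mass_on_terminal_edge (lam : R) : 0 < lam -> exists2 c : R, 0 < c & forall l u g,
  lam <= l -> H1_graph l u g -> Kin l u <= 1 -> En p (Kin l g) (Pot p l u) <= ER p ->
  c <= sq (Some l) (u None).
Proof.
move=> lam0; have [B [B1 hB]] := energy_bounds p2 p6 N0.
pose c : R := p * - ER p.
have c0 : 0 < c by rewrite mulr_gt0 ?(p_gt0 p2)// oppr_gt0.
pose m0 : R := c `^ (p - 2)^-1; have m00 : 0 < m0 by exact: powR_gt0.
have m2 : 0 < m0 ^+ 2 by rewrite exprn_gt0.
pose d : R := Num.min (lam / 2) (m0 ^+ 2 / (4 * B)).
have B40 : 0 < 4 * B by lra.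
have d0 : 0 < d by rewrite lt_min !divr_gt0.
have dl : d <= lam / 2 by rewrite ge_min lexx.
have dB : d * (4 * B) <= m0 ^+ 2 by rewrite -ler_pdivlMr// ge_min lexx orbT.
have m20 : 0 < m0 / 2 by rewrite divr_gt0.
exists ((m0 / 2) ^+ 2 * d); first by rewrite mulr_gt0 ?exprn_gt0.
move=> l u g ll hG m1 hE; have l0 : 0 <= l by lra.
have hu := ((H1_graphP _ _ _).1 hG).1 None; rewrite /eb in hu.
have [xm [/andP[x0 xl] um]] := max_on_terminal_edge p2 p6 N3 l0 hG m1 hE.
have mlb := max_lower_bound p2 l0 hG m1 hE um.
have En0 : En p (Kin l g) (Pot p l u) <= 0 by have := ER0; lra.
have [KB _ _] := hB _ _ _ l0 hG m1 En0.
have kB : sq (Some l) (g None) <= B.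
  by apply: le_trans KB; rewrite Kin_split lerDl; apply: sumr_ge0 => i _; exact: sq_ge0.
set m : R := `|u None xm| in mlb.
have mm : m0 <= m.
  have -> : m = (m `^ (p - 2)) `^ (p - 2)^-1.
    by rewrite -powRrM divff ?powRr1 ?normr_ge0// lt0r_neq0// p_gt2.
  apply: ge0_ler_powR; rewrite ?nnegrE ?powR_ge0 ?invr_ge0 ?(ltW (p_gt2 p2)) ?(ltW c0)//.
have dT (y : R) : 0 <= y -> y <= l -> dom (Some l) y by move=> ? ?; rewrite domP; apply/andP.
have near (y : R) : 0 <= y -> y <= l -> `|y - xm| <= d -> m0 / 2 <= `|u None y|.
  move=> y0 yl yd; have := H1_holderN hu (dT _ x0 xl) (dT _ y0 yl).
  have h1 : `|y - xm| * sq (Some l) (g None) <= d * B by apply: ler_pM => //; exact: sq_ge0.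
  move=> h2; have h3 : `|u None y - u None xm| <= m0 / 2.
    rewrite -(@ler_sqr _ `|_|) ?nnegrE ?(ltW m20)// real_normK ?num_real//; lra.
  have := ler_distD (u None y) (u None xm) 0; rewrite !subr0 -/m distrC; lra.
have fin (x : R) : 0 <= x -> x + d <= l -> `|x - xm| <= d -> `|x + d - xm| <= d ->
    (m0 / 2) ^+ 2 * d <= sq (Some l) (u None).
  move=> y0 yl; rewrite !ler_norml => /andP[? ?] /andP[? ?].
  have xd : x <= x + d by rewrite lerDl ltW.
  have hlb (y : R) : x <= y -> y <= x + d -> m0 / 2 <= `|u None y|.
    by move=> ? ?; apply: near; rewrite ?ler_norml; lra.
  have dxd := dT _ (le_trans y0 xd) yl.
  have := sq_increment_lb hu y0 xd dxd (ltW m20) hlb.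
  have := sq_sub dxd (H1_L2 hu); have := sq_ge0 (Some x) (u None).
  by rewrite addrAC subrr add0r; lra.
have [xr|xr] := leP (xm + d) l.
  by apply: fin x0 xr _ _; [rewrite subrr normr0 ltW|rewrite addrAC subrr add0r gtr0_norm].
apply: (fin (xm - d)); rewrite ?subrK//; first lra.
  by rewrite addrAC subrr add0r normrN gtr0_norm.
by rewrite subrr normr0 ltW.
Qed.

Definition good l : Prop :=
  0 < l /\ exists q k P, [/\ gconf p N l q k P, q <= 1 & En p k P <= ER p].

(** If [gE l < ER], nearly optimal functions have energy at most [ER] and thus keep mass on the
    terminal edge. If [gE l = ER], functions on a nearby good length are dilated to length [l], with
    an amplitude that leaves the mass of every edge unchanged. With [l' = l] this also provides the
    ground state on a good length. *)
Lemma good_limit l : 0 < l ->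
  (forall d : R, 0 < d -> exists2 l', good l' & `|l' - l| <= d) ->
  exists u g, [/\ H1_graph l u g, Kin l u = 1 & En p (Kin l g) (Pot p l u) <= gE p N l].
Proof.
move=> l0 hl; have G := gconf_class p2 p6 N0 (ltW l0).
have l20 : 0 < l / 2 by rewrite divr_gt0.
have [c c0 hc] := mass_on_terminal_edge l20.
have [B [B1 hB]] := energy_bounds p2 p6 N0.
apply: (minimizer_exists p2 p6 N0 (ltW l0) c0) => eta eta0.
have [lt|ge] := ltP (gE p N l) (ER p).
  pose e : R := Num.min eta (ER p - gE p N l).
  have e0 : 0 < e by rewrite lt_min eta0 subr_gt0.
  have e1 : e <= eta by rewrite ge_min lexx.
  have e2 : e <= ER p - gE p N l by rewrite ge_min lexx orbT.
  have [q [k [P [[u [g [hG [Eq Ek EP]]]] q1 hE]]]] := infE_approx G e0.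
  rewrite -Eq in q1; rewrite -Ek -EP -/(gE p N l) in hE.
  exists u, g; split=> //; first lra.
  by apply: hc hG q1 _; lra.
pose t : R := Num.min (1 / 2) (eta / (3 * B)).
have B30 : 0 < 3 * B by lra.
have t0 : 0 < t by rewrite lt_min !divr_gt0.
have t1 : t <= 1 / 2 by rewrite ge_min lexx.
have tB : t * (3 * B) <= eta by rewrite -ler_pdivlMr// ge_min lexx orbT.
have [l' [l'0 [q [k [P [[u [g [hG [Eq Ek EP]]]] q1 hE]]]]] ll'] := hl _ (mulr_gt0 l0 t0).
pose b : R := l' / l; have b0 : 0 < b by rewrite divr_gt0.
have bt : `|b - 1| <= t.
  rewrite -(ler_pM2l l0) -{1}(gtr0_norm l0) -normrM mulrBr /b mulr1 mulrCA divff ?gt_eqF//.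
  by rewrite mulr1.
have l'l : l / 2 <= l' by have := mulr_ge0 (ltW l0) (_ : 0 <= 1 / 2 - t); move: ll'; rewrite ler_norml; nra.
rewrite -Eq in q1; rewrite -Ek -EP in hE.
have hc' := hc _ _ _ l'l hG q1 hE.
have En0 : En p (Kin l' g) (Pot p l' u) <= 0 by have := ER0; lra.
have [KB PB _] := hB _ _ _ (ltW l'0) hG q1 En0.
have [hu u0] := (H1_graphP _ _ _).1 hG.
pose a : R := Num.sqrt b; have a2 : a ^+ 2 = b by rewrite sqr_sqrtr// ltW.
have hT := seg_dil p2 a b0 (@seg_H1 _ p (Some l') _ _ (ltW l'0) (hu None)).
have ht i := seg_dil p2 a b0 (seg_H1T p (hu (Some i))).
have lE : l' / b = l by rewrite /b invf_div mulrCA divff ?mulr1 ?gt_eqF.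
rewrite a2 /= lE in hT.
have ht' i : seg p None (a * u None 0) 0 _ _ _ := eq_ind _ (fun z => seg p None (a * z) 0 _ _ _) (segT_any 0 (ht i)) _ (u0 i).
have [v [h [hGv [Kv Kh Pv Tv]]]] := graph_intro hT ht'.
rewrite !a2 -mulr_sumr -mulrDr -Kin_split in Kv; rewrite !a2 -mulr_sumr -mulrDr -Kin_split in Kh.
rewrite -mulr_sumr -mulrDr -Pot_split in Pv.
have bb : b / b = 1 by rewrite divff ?gt_eqF.
rewrite bb mul1r in Kv; rewrite bb mul1r in Tv.
exists v, h; split=> //.
- by rewrite Kv.
- have pP0 : 0 <= p^-1 * Pot p l' u by rewrite mulr_ge0 ?(ltW pi0)// sumr_ge0// => e _; exact: Pf_ge0.
  have k0 : 0 <= Kin l' g by apply: sumr_ge0 => e _; exact: sq_ge0.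
  have pB : p^-1 * Pot p l' u <= B.
    rewrite (le_trans _ PB)// ler_piMl// ?sumr_ge0// => [e _|]; first exact: Pf_ge0.
    by rewrite invf_le1 ?(p_gt0 p2)//; have := p2; lra.
  set r := `|a| `^ p / b in Pv.
  have a0 : 0 < a by rewrite sqrtr_gt0.
  have bt' := bt; rewrite ler_norml in bt'; move/andP: bt' => [bt1 bt2].
  rewrite Kh Pv; apply: (@le_trans _ _ (En p (Kin l' g) (Pot p l' u) + eta)); last by move: ge hE; clear -ER0; lra.
  have tB3 : 3 * t * B <= eta by move: tB; clear -ER0; lra.
  (* The dilation multiplies the kinetic integral by [b^2] and the potential by [r = b^(p/2 - 1)],
     which is at least 1 for [b >= 1] and, by [p < 6], at least [b^2] for [b < 1]. Either way the
     energy rises by at most [3 t B]. *)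
  have [b1|b1] := leP 1 b.
    have r1 : 1 <= r.
      rewrite /r ler_pdivlMr// mul1r -{1}a2 (gtr0_norm a0) -(powR_mulrn 2 (ltW a0)).
      apply: ler_powR; last exact: ltW.
      by rewrite -(@expr_ge1 _ 2) ?(ltW a0)// a2.
    have h1 := ler_wpM2r pP0 r1.
    have bb1 : b * b - 1 <= 3 * t by move: bt2 b1 t1 t0; clear -ER0; nra.
    have bb0 : 0 <= b * b - 1 by move: b1; clear -ER0; nra.
    have h2 := ler_pM bb0 k0 bb1 KB.
    by move: h1 h2 tB3 eta0; rewrite /En; clear -ER0; lra.
  have r1 : b * b <= r.
    rewrite /r ler_pdivlMr// (gtr0_norm a0).
    have -> : b * b * b = a `^ 6.
      by rewrite (powR_mulrn 6 (ltW a0)) (exprM _ 2 3) a2 !exprS expr0 mulr1 mulrA.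
    apply: ger_powR; last exact: ltW.
    by rewrite a0 -(@expr_le1 _ 2) ?(ltW a0)// a2 ltW.
  have h1 := ler_wpM2r pP0 r1.
  have bb1 : 1 - b * b <= 3 * t by move: bt1 b1 t1 t0; clear -ER0; nra.
  have bb0 : 0 <= 1 - b * b by move: b1 b0; clear -ER0; nra.
  have h2 := ler_pM bb0 pP0 bb1 pB.
  have h3 := mulr_ge0 bb0 k0.
  by move: h1 h2 h3 tB3 eta0; rewrite /En; clear -ER0; lra.
- by rewrite Tv.
Qed.

Lemma good_closed l : 0 < l ->
  (forall d : R, 0 < d -> exists2 l', good l' & `|l' - l| <= d) -> good l.
Proof.
move=> l0 /(good_limit l0)[u [g [hG K1 hE]]]; split=> //.
exists 1, (Kin l g), (Pot p l u); split=> //; first by exists u, g.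
exact: le_trans hE (gE_le_ER p2 p6 N0 (ltW l0)).
Qed.

Lemma good_lb : exists2 L0 : R, 0 < L0 & forall l, good l -> L0 <= l.
Proof.
have [L0 L00 hL] := terminal_edge_lower_bound p2 p6 N3; exists L0 => //.
move=> l [l0 [q [k [P [[u [g [hG [Eq Ek EP]]]] q1 hE]]]]].
by apply: hL (ltW l0) hG _ _; rewrite ?Ek ?EP ?Eq.
Qed.

Lemma good_nonempty : exists l, good l.
Proof.
have [L L0 gL] := exists_long_edge p2 p6 N3.
have G := gconf_class p2 p6 N0 L0.
have e0 : 0 < ER p - gE p N L by rewrite subr_gt0.
have [q [k [P [hg q1 hE]]]] := infE_approx G e0; rewrite -/(gE p N L) addrC subrK in hE.
exists L; split; last by exists q, k, P; split=> //; exact: ltW.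
have [L1 L10 hL] := terminal_edge_lower_bound p2 p6 N3.
move: hg => [u [g [hG [Eq Ek EP]]]]; apply: (lt_le_trans L10).
by apply: hL L0 hG _ _; rewrite ?Ek ?EP ?Eq// ltW.
Qed.

(** The steps of [extend] could shrink, so a supremum replaces iteration: it is good by closedness,
    and if it were below [l2], [extend] would pass beyond it. *)
Lemma good_upward l1 l2 : good l1 -> l1 <= l2 -> good l2.
Proof.
move=> S1 l12; have l10 : 0 < l1 by case: S1.
pose Z : set R := [set x | good x /\ x <= l2].
have hZ : has_sup Z by split; [exists l1|exists l2 => x []].
have l1s : l1 <= sup Z by apply: ub_le_sup; [case: hZ|].
have s0 : 0 < sup Z by exact: lt_le_trans l1s.
have sl2 : sup Z <= l2 by apply: ge_sup => [|x []//]; case: hZ.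
have Ss : good (sup Z).
  apply: good_closed => // d d0; have [x [gx xl] xs] := sup_adherent d0 hZ.
  exists x => //; have : x <= sup Z by apply: ub_le_sup; [case: hZ|].
  by move: xs; rewrite ler_norml; lra.
move: sl2; rewrite le_eqVlt => /predU1P[<-//|sl2].
have [_ [q [k [P [[u [g [hG [Eq Ek EP]]]] q1 hE]]]]] := Ss.
have e0 : 0 < l2 - sup Z by rewrite subr_gt0.
rewrite -Eq in q1; rewrite -Ek -EP in hE.
have [l' [q' [k' [P' [/andP[l'1 l'2] h1 h2 h3]]]]] := extend p2 p6 N3 (ltW s0) hG q1 hE e0.
have : l' <= sup Z.
  apply: ub_le_sup; first by case: hZ.
  split; last by rewrite addrC subrK in l'2.
  by split; [exact: lt_trans l'1|exists q', k', P'].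
by rewrite leNgt l'1.
Qed.

Lemma good_threshold : exists2 C : R, 0 < C & forall l, good l <-> C <= l.
Proof.
have [L0 L00 hL] := good_lb; have [l1 gl1] := good_nonempty.
have hS : has_inf good by split; [exists l1|exists L0].
have C0 : 0 < inf good by apply: (lt_le_trans L00); apply: lb_le_inf => //; exists l1.
exists (inf good) => // l; split=> [gl|Cl]; first by apply: ge_inf => //; case: hS.
apply: (good_upward _ Cl); apply: good_closed => // d d0.
have [x gx xd] := inf_adherent d0 hS; exists x => //.
have : inf good <= x by apply: ge_inf => //; case: hS.
by move: xd; rewrite ler_norml; lra.
Qed.

Lemma ground_state_existsP l (mu : R) : ground_state_exists N l p mu <->
  exists k P, gconf p N l mu k P /\ forall k' P', gconf p N l mu k' P' -> En p k P <= En p k' P'.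
Proof.
split=> [[u [g [hG [m hmin]]]]|[k [P [[u [g [hG [Eq Ek EP]]]] hmin]]]].
  exists (Kin l g), (Pot p l u); split; first by exists u, g; rewrite -massE.
  move=> k' P' [u' [g' [hG' [Eq' <- <-]]]]; rewrite -!energyE; apply: hmin => //.
  by rewrite massE.
exists u, g; split; first exact: hG.
split; first by rewrite massE.
move=> u' g' hG' m'; rewrite !energyE Ek EP; apply: hmin; exists u', g'; split=> //.
by rewrite -massE.
Qed.

(** For the converse, a nearly optimal function on the half-line is normalized to mass 1, which
    lowers its negative energy, and placed on the graph; the ground state lies below it. *)
Lemma good_ground_state l : 0 < l -> good l <-> ground_state_exists N l p 1.
Proof.
move=> l0; have G := gconf_class p2 p6 N0 (ltW l0).
rewrite ground_state_existsP; split=> [gl|[k [P [hg hmin]]]].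
  have [|u [g [hG K1 hE]]] := good_limit l0.
    by move=> d d0; exists l => //; rewrite subrr normr0 ltW.
  exists (Kin l g), (Pot p l u); split; first by exists u, g.
  by move=> k' P' h'; apply: (le_trans hE); exact: (infE_le G h' (lexx 1)).
split=> //; exists 1, k, P; split=> //.
apply: (@le_eps _ _ _ (- ER p)) => e e0 e1.
(* The error is proportional to [- ER] with [e <= 1], so the nearly optimal energy is still
   negative, as normalization requires. *)
have e'0 : 0 < e * - ER p by rewrite mulr_gt0// oppr_gt0.
have [q [k1 [P1 [hz q1 hE]]]] := infE_approx ZC e'0; rewrite -/(ER p) in hE.
apply: le_trans (ltW hE).
have E0 : En p k1 P1 < 0.
  apply: (lt_le_trans hE); rewrite mulrN subr_le0 ler_nMl//.
have [q0 k0 P0] := conf_ge0 ZC hz.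
move: q0; rewrite le_eqVlt => /predU1P[qz|q0].
  rewrite -qz in hz; move: E0; rewrite /En (conf_null ZC hz) mulr0 subr0.
  by rewrite ltNge mulr_ge0.
have [k' [P' [hz' hE']]] := conf_normalize p2 ZC hz q0 q1.
apply: (le_trans (hmin _ _ (ztail_gconf p2 N0 (ltW l0) hz'))); apply: (le_trans hE').
by rewrite ler_pdivrMr// ler_nMr.
Qed.

(** [beta] is the exponent for which amplitude [mu^(-(beta+1)/2)] and dilation [mu^(-beta)] divide
    the mass by [mu] and multiply kinetic and potential integrals by one common factor. Scaling by
    the inverse of [mu] carries competitors back, so minimality is preserved. *)
Lemma ground_state_scale l (mu nu : R) : 0 < mu -> 0 <= l -> ground_state_exists N l p nu ->
  ground_state_exists N (mu `^ ((p - 2) / (6 - p)) * l) p (nu / mu).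
Proof.
have p60 : 0 < 6 - p by have := p6; rewrite subr_gt0.
set beta := (p - 2) / (6 - p).
pose t (x : R) := x `^ (- (2 * beta + 1)).
have scale (x r q k P : R) : 0 < x -> 0 <= r -> gconf p N r q k P ->
    gconf p N (x `^ beta * r) (q / x) (t x * k) (t x * P).
  move=> x0 r0 h; have s0 : 0 < x `^ (- beta) by exact: powR_gt0.
  have := gconf_dil p2 (x `^ (- (beta + 1) / 2)) s0 r0 h.
  have pD (a b : R) : x `^ a * x `^ b = x `^ (a + b) by rewrite powRD// (gt_eqF x0) implybT.
  have pN (a : R) : (x `^ a)^-1 = x `^ (- a) by rewrite -powRN.
  rewrite -(powR_mulrn 2 (powR_ge0 _ _)) -powRrM pN opprK !pD.
  have -> : - (beta + 1) / 2 * 2%:R + beta = - 1 by field.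
  have -> : - (beta + 1) / 2 * 2%:R + - beta = - (2 * beta + 1) by field.
  rewrite ger0_norm ?powR_ge0// -powRrM pD.
  have -> : - (beta + 1) / 2 * p + beta = - (2 * beta + 1).
    by rewrite /beta; field; exact: lt0r_neq0.
  by rewrite powR_inv1 ?(ltW x0)// [r * _]mulrC [x^-1 * _]mulrC.
move=> mu0 l0 /ground_state_existsP[k [P [h hmin]]]; apply/ground_state_existsP.
have t0 x : 0 < x -> 0 < t x by move=> x0; exact: powR_gt0.
have tE x k0 P0 : En p (t x * k0) (t x * P0) = t x * En p k0 P0 by rewrite /En; ring.
exists (t mu * k), (t mu * P); split; first exact: scale.
move=> k' P' h'; have mi0 : 0 < mu^-1 by rewrite invr_gt0.
have := scale _ _ _ _ _ mi0 (mulr_ge0 (powR_ge0 _ _) l0) h'.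
rewrite mulrA -powRM ?(ltW mu0) ?(ltW mi0)// mulVf ?gt_eqF// powR1 mul1r.
rewrite invrK divfK ?gt_eqF// => /hmin; rewrite !tE.
have tt : t mu * t mu^-1 = 1.
  by rewrite /t -powRM ?(ltW mu0) ?(ltW mi0)// divff ?gt_eqF// powR1.
by rewrite -(ler_pM2l (t0 _ mu0)) mulrA tt mul1r.
Qed.

End threshold.

Theorem theorem4p4 (R : realType) (p : R) (N : nat) :
  2 < p < 6 -> (3 <= N)%N ->
  exists Cstar : R, 0 < Cstar /\
    forall mu l : R, 0 < mu -> 0 < l ->
      (ground_state_exists N l p mu <-> Cstar <= mu `^ ((p - 2) / (6 - p)) * l).
Proof.
move=> /andP[p2 p6] N3; have [C C0 hC] := good_threshold p2 p6 N3.
exists C; split=> // mu l mu0 l0.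
set b := (p - 2) / (6 - p); have ml0 : 0 < mu `^ b * l by rewrite mulr_gt0 ?powR_gt0.
rewrite -hC (good_ground_state p2 p6 N3 ml0); split=> h.
  have := ground_state_scale p2 p6 mu0 (ltW l0) h.
  by rewrite divff ?gt_eqF.
have mi0 : 0 < mu^-1 by rewrite invr_gt0.
have := ground_state_scale p2 p6 mi0 (ltW ml0) h.
by rewrite mulrA -powRM ?(ltW mu0) ?(ltW mi0)// mulVf ?gt_eqF// powR1 mul1r invrK mul1r.
Qed.
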